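(* Let $N,k$ be positive integers with $N<k$. Consider the B-model Gauss–Manin system $$\partial_x\tilde\psi_\alpha(x)=\tilde\psi_{\alpha+1}(x)+\sum_{d=1}^\infty e^{dx}\,\tilde L_{N-2-\alpha}^{N,k,d}\,\tilde\psi_{\alpha+1+(k-N)d}(x)\qquad(\alpha\in{\bf Z})\qquad( * )$$ whose coefficients are the virtual structure constants, and the ODE $$\Bigl((\partial_x)^{N-1}-k\,e^x(k\partial_x+k-1)\cdots(k\partial_x+2)(k\partial_x+1)\Bigr)w(x)=0.\qquad( ** )$$ Then $( ** )$ can be reconstructed from $( * )$: the limit operator $F_\infty(e^x,\partial_x)$ of $( * )$ (defined in the context) satisfies $$\frac1{F_\infty(e^x,\partial_x)}(\partial_x)^{N-1}=\Bigl(1-k\,e^x(k\partial_x+k-1)\cdots(k\partial_x+2)(k\partial_x+1)\frac1{(\partial_x)^{N-1}}\Bigr)(\partial_x)^{N-1},$$ or equivalently $$F_\infty(e^x,\partial_x)=1+\sum_{d=1}^\infty e^{dx}\prod_{m=0}^{kd-1}(k\partial_x+m)\prod_{j=0}^{d-1}\frac1{(\partial_x+j)^N}.$$ Conversely, the numbers $\tilde L_n^{N,k,d}$ $(d\ge1,\ 0\le n\le N-1+(k-N)d)$ are determined by $( ** )$: they are the only numbers for which the limit operator $F_\infty$ of the system of the form $( * )$ satisfies $$F_\infty(e^x,\partial_x)=1+\sum_{d=1}^\infty e^{dx}\prod_{m=0}^{kd-1}(k\partial_x+m)\prod_{j=0}^{d-1}\frac1{(\partial_x+j)^N}.$$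
   Context: **Operator algebra.** Work with formal pseudo-differential operators $\sum_{d\ge0}e^{dx}R_d(\partial_x)$, $R_d$ a rational function, with rules $\partial_x\cdot\frac1{\partial_x}=\frac1{\partial_x}\cdot\partial_x=1$, $\partial_xe^{jx}=e^{jx}(\partial_x+j)$, $\frac1{\partial_x}e^{jx}=e^{jx}\frac1{\partial_x+j}$. **The operator $F_\infty$.** For coefficients $\tilde L_n^{N,k,d}$ that vanish unless $0\le n\le N-1+(k-N)d$, the system $( * )$ gives $\tilde\psi_j=(\partial_x)^{j-N+1}\tilde\psi_{N-1}$ for $j\ge N-1$. Using $\tilde\psi_\alpha=\frac1{\partial_x}\bigl(\tilde\psi_{\alpha+1}+\sum_{d\ge1}e^{dx}\tilde L_{N-2-\alpha}^{N,k,d}\tilde\psi_{\alpha+1+(k-N)d}\bigr)$ for $\alpha=N-2,N-3,\dots$, every $\tilde\psi_\alpha$ is inductively written as an operator applied to $\tilde\psi_{N-1}$. For $j\ge0$ the operator $F_j(e^x,\partial_x)$ is defined by $(\partial_x)^{N-1+j}\tilde\psi_{-j}=F_j(e^x,\partial_x)\tilde\psi_{N-1}$, and $F_\infty:=\lim_{j\to\infty}F_j$ (the coefficient of each $e^{dx}$ stabilizes). **Virtual structure constants.** Fix $k$. The rational numbers $\tilde L_n^{N,k,d}$ ($N,n\in{\bf Z}$, $d\ge1$) are defined by descending recursion on $N$. For $N\ge2k$: $\tilde L_n^{N,k,1}$ is given by $\sum_{n=0}^{k-1}\tilde L_n^{N,k,1}w^n=k\prod_{j=1}^{k-1}(jw+(k-j))$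 (and $\tilde L_n^{N,k,1}=0$ for $n\notin\{0,\dots,k-1\}$), and $\tilde L_n^{N,k,d}=0$ for $d\ge2$. For $N<2k$: $\tilde L_n^{N,k,d}=\phi_n^{N,k}(Poly_d)$, where $\phi_n^{N,k}$ is the ${\bf Q}$-linear map on homogeneous polynomials of degree $d-1$ in $x,y,z_1,\dots,z_{d-1}$ with $$\phi_n^{N,k}\bigl(x^{d_{i_0}}z_{i_1}^{d_{i_1}}\cdots z_{i_{l-1}}^{d_{i_{l-1}}}y^{d_{i_l}}\bigr)=\prod_{j=1}^l\tilde L_{n+\delta_j}^{N+1,k,i_j-i_{j-1}} .$$ Here each monomial is written uniquely with $0=i_0<i_1<\cdots<i_l=d$, $d_{i_j}\ge1$ for $1\le j\le l-1$, $d_{i_0},d_{i_l}\ge0$, $\sum_{j=0}^ld_{i_j}=d-1$, and $\delta=(\delta_1,\dots,\delta_l)=\alpha+\beta+\gamma+\sum_{j=1}^{l-1}(d_{i_j}-1)\epsilon_j+d_{i_l}\epsilon_l\in{\bf Z}^l$ with $\alpha=(l-d,\dots,l-d)$, $\beta=(0,i_1-1,i_2-2,\dots,i_{l-1}-l+1)$, $\gamma=(0,i_1(N-k),\dots,i_{l-1}(N-k))$, $\epsilon_j=(1,\dots,1,0,\dots,0)$ ($j$ ones). The number $\tilde L_n^{N,k,d}$ vanishes unless $0\le n\le N-1+(k-N)d$. **The polynomial $Poly_d$.** With $u_0=x$, $u_d=y$, $$Poly_d(x,y,z_1,\dots,z_{d-1})=\frac{d}{(2\pi\sqrt{-1})^{d-1}}\int_{D_1}du_1\cdots\int_{D_{d-1}}du_{d-1}\prod_{j=1}^{d-1}\frac{u_j^2}{(2u_j-u_{j-1}-u_{j+1})(u_j-z_j)},$$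 where $D_j$ goes around both poles $u_j=\frac{u_{j-1}+u_{j+1}}2$ and $u_j=z_j$. Concretely, take counterclockwise circles $|u_j|=R_j$ with $R_j>|z_j|$ and $2R_j>R_{j-1}+R_{j+1}$, where $R_0=|x|$, $R_d=|y|$. It is a homogeneous polynomial of degree $d-1$, and $Poly_1=1$. *)

(* Defs.v *)
From HB Require Import structures.
From mathcomp Require Import all_boot all_order all_algebra.
From mathcomp Require Import all_classical all_reals all_analysis.
From mathcomp Require Import complex.
(* The notations of mpoly.v are incompatible with those of MathComp-Analysis. *)
From mathcomp Require Import -(notations) mpoly.

Set Implicit Arguments.
Unset Strict Implicit.
Unset Printing Implicit Defensive.

Import Order.TTheory GRing.Theory Num.Theory.

Local Open Scope ring_scope.

Local Notation "x %:F" := (FracField.tofrac x).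

(* The substitution f(t) |-> f(t + a) on K(t). *)
Definition frac_shift (K : fieldType) (a : K) (f : {fraction {poly K}}) :
    {fraction {poly K}} :=
  ((frac (repr f)).1 \Po ('X + a%:P))%:F / ((frac (repr f)).2 \Po ('X + a%:P))%:F.

(* F : pdo K stands for the formal sum of the e^{dx} (F d)(∂_x), d >= 0. *)
Definition pdo (K : fieldType) : Type := nat -> {fraction {poly K}}.

HB.instance Definition _ (K : fieldType) := GRing.Zmodule.on (pdo K).

(* e^{ix} A(∂_x) e^{jx} B(∂_x) = e^{(i+j)x} A(∂_x + j) B(∂_x) *)
Definition pdo_mul (K : fieldType) (F G : pdo K) : pdo K :=
  fun d => \sum_(i < d.+1) frac_shift (d - i)%:R (F i) * G (d - i)%N.

Definition pdo_one (K : fieldType) : pdo K := fun d => (d == 0%N)%:R.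

Lemma comp_polyXDC_eq0 (K : fieldType) (a : K) (p : {poly K}) :
  (p \Po ('X + a%:P) == 0) = (p == 0).
Proof. by rewrite -!size_poly_eq0 size_comp_poly2 // size_XaddC. Qed.

Lemma frac_numden (R : idomainType) (f : {fraction R}) :
  f = ((frac (repr f)).1)%:F / (frac (repr f)).2%:F.
Proof.
have nzd : (frac (repr f)).2 != 0 by exact: denom_ratioP.
apply: (canRL (mulfK _)); first by rewrite tofrac_eq0.
rewrite -{1}[f]reprK; set x := repr f in nzd *.
rewrite !piE; apply/eqmodP => /=; rewrite /FracField.equivf /FracField.mulf.
by rewrite !numden_Ratio ?oner_eq0 ?mulr1 ?denom_ratioP // mulrC.
Qed.

Lemma frac_shiftE (K : fieldType) (a : K) (p q : {poly K}) : q != 0 ->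
  frac_shift a (p%:F / q%:F) =
  (p \Po ('X + a%:P))%:F / (q \Po ('X + a%:P))%:F.
Proof.
move=> nzq; rewrite /frac_shift; set f := p%:F / q%:F.
have nzd : (frac (repr f)).2 != 0 by exact: denom_ratioP.
have /eqP := frac_numden f; rewrite {1}/f.
rewrite eqr_div ?tofrac_eq0 // -!tofracM tofrac_eq => /eqP e.
apply/eqP; rewrite eqr_div ?tofrac_eq0 ?comp_polyXDC_eq0 //.
by rewrite -!tofracM -!comp_polyM -e.
Qed.

Lemma frac_shift_is_zmod_morphism (K : fieldType) (a : K) :
  zmod_morphism (@frac_shift K a).
Proof.
move=> f g; rewrite (frac_numden f) (frac_numden g).
set p := (frac (repr f)).1; set q := (frac (repr f)).2.
set r := (frac (repr g)).1; set s := (frac (repr g)).2.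
have nzq : q != 0 by exact: denom_ratioP.
have nzs : s != 0 by exact: denom_ratioP.
rewrite -mulNr addf_div ?tofrac_eq0 // mulNr -!tofracM -tofracB.
rewrite !frac_shiftE ?mulf_neq0 //.
rewrite -[- (_ / _)]mulNr addf_div ?tofrac_eq0 ?comp_polyXDC_eq0 //.
by rewrite mulNr -!tofracM -tofracB -!comp_polyM -comp_polyB.
Qed.

Lemma frac_shift_is_monoid_morphism (K : fieldType) (a : K) :
  monoid_morphism (@frac_shift K a).
Proof.
split=> [|f g].
  rewrite -[1 in LHS](divff (oner_neq0 _)) -tofrac1 frac_shiftE ?oner_eq0 //.
  by rewrite rmorph1 tofrac1 divr1.
rewrite (frac_numden f) (frac_numden g).
rewrite mulf_div -!tofracM !frac_shiftE ?mulf_neq0 ?denom_ratioP //.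
by rewrite mulf_div -!tofracM -!comp_polyM.
Qed.

HB.instance Definition _ (K : fieldType) (a : K) :=
  GRing.isZmodMorphism.Build {fraction {poly K}} {fraction {poly K}}
    (@frac_shift K a) (@frac_shift_is_zmod_morphism K a).
HB.instance Definition _ (K : fieldType) (a : K) :=
  GRing.isMonoidMorphism.Build {fraction {poly K}} {fraction {poly K}}
    (@frac_shift K a) (@frac_shift_is_monoid_morphism K a).

Lemma frac_shiftD (K : fieldType) (a b : K) (f : {fraction {poly K}}) :
  frac_shift a (frac_shift b f) = frac_shift (a + b) f.
Proof.
rewrite [frac_shift b f]/frac_shift frac_shiftE ?comp_polyXDC_eq0 ?denom_ratioP //.
by rewrite -!comp_polyA !comp_polyD !comp_polyX !comp_polyC -!addrA -!polyCD
  /frac_shift.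
Qed.

Lemma frac_shift0 (K : fieldType) (f : {fraction {poly K}}) :
  frac_shift 0 f = f.
Proof. by rewrite /frac_shift addr0 !comp_polyXr -frac_numden. Qed.

Lemma pdo_mulA (K : fieldType) : associative (@pdo_mul K).
Proof.
move=> F G H; apply/funext => n.
have revE (A B : pdo K) m : pdo_mul A B m =
    \sum_(j < m.+1) frac_shift j%:R (A (m - j)%N) * B j.
  rewrite /pdo_mul (reindex_inj rev_ord_inj) /=.
  by apply: eq_bigr => j _; rewrite subSS subKn // -ltnS.
rewrite [RHS]revE {1}/pdo_mul.
pose c j k := frac_shift (n - j)%:R (F j) *
              (frac_shift k%:R (G (n - j - k)%N) * H k).
transitivity (\sum_(j < n.+1) \sum_(k < n.+1 | (k <= n - j)%N) c j k).
  apply: eq_bigr => /= j _; rewrite revE big_distrr /=.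
  by rewrite (big_ord_narrow_leq (leq_subr _ _)).
rewrite (exchange_big_dep predT) //=; apply: eq_bigr => k _.
transitivity (\sum_(j < n.+1 | (j <= n - k)%N) c j k).
  apply: eq_bigl => j; rewrite -ltnS -(ltnS j) -!subSn ?leq_ord //.
  by rewrite -subn_gt0 -(subn_gt0 j) -!subnDA addnC.
rewrite (big_ord_narrow_leq (leq_subr _ _)) /pdo_mul raddf_sum big_distrl /=.
apply: eq_bigr => j _; rewrite /c rmorphM /= frac_shiftD -natrD mulrA.
have lejk : (j <= n - k)%N by rewrite -ltnS.
have lekn : (k <= n)%N by rewrite -ltnS.
by rewrite addnBA // subnKC // -!subnDA [(k + j)%N]addnC.
Qed.

Lemma pdo_mul1l (K : fieldType) : left_id (@pdo_one K) (@pdo_mul K).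
Proof.
move=> F; apply/funext => n; rewrite /pdo_mul big_ord_recl /= big1 => [|i _].
  by rewrite /pdo_one eqxx rmorph1 mul1r addr0 subn0.
by rewrite /pdo_one rmorph0 mul0r.
Qed.

Lemma pdo_mul1r (K : fieldType) : right_id (@pdo_one K) (@pdo_mul K).
Proof.
move=> F; apply/funext => n; rewrite /pdo_mul big_ord_recr /= big1 => [|i _].
  by rewrite /pdo_one subnn eqxx mulr1 frac_shift0 add0r.
by rewrite /pdo_one subn_eq0 leqNgt ltn_ord mulr0.
Qed.

Lemma pdo_mulDl (K : fieldType) :
  left_distributive (@pdo_mul K) (fun F G : pdo K => F + G).
Proof.
move=> F G H; apply/funext => n; rewrite /pdo_mul.
rewrite [RHS]/GRing.add /= -big_split /=.
by apply: eq_bigr => i _; rewrite -mulrDl -rmorphD.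
Qed.

Lemma pdo_mulDr (K : fieldType) :
  right_distributive (@pdo_mul K) (fun F G : pdo K => F + G).
Proof.
move=> F G H; apply/funext => n; rewrite /pdo_mul.
rewrite [RHS]/GRing.add /= -big_split /=.
by apply: eq_bigr => i _; rewrite -mulrDr.
Qed.

Lemma pdo_one_neq0 (K : fieldType) : pdo_one K != 0.
Proof.
by apply/eqP => /(congr1 (@^~ 0%N)) /eqP; rewrite /pdo_one eqxx oner_eq0.
Qed.

HB.instance Definition _ (K : fieldType) := GRing.Zmodule_isNzRing.Build (pdo K)
  (@pdo_mulA K) (@pdo_mul1l K) (@pdo_mul1r K) (@pdo_mulDl K) (@pdo_mulDr K)
  (pdo_one_neq0 K).

(* The operator r(∂_x). *)
Definition pdo_rat (K : fieldType) (r : {fraction {poly K}}) : pdo K :=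
  fun d => if d == 0%N then r else 0.

Definition pdo_exp (K : fieldType) (i : nat) : pdo K := fun d => (d == i)%:R.

Definition pdo_D (K : fieldType) : pdo K := pdo_rat 'X%:F.

Definition pdo_Dinv (K : fieldType) : pdo K := pdo_rat ('X%:F)^-1.

(* The sum of the G e, e >= 1, for G e a left multiple of e^{ex}: the terms
   with e > d do not contribute to the coefficient of e^{dx}. *)
Definition pdo_sum (K : fieldType) (G : nat -> pdo K) : pdo K :=
  fun d => \sum_(1 <= e < d.+1) G e d.

Lemma pdo_rat_exp (K : fieldType) (r : {fraction {poly K}}) (j : nat) :
  pdo_rat r * pdo_exp K j = pdo_exp K j * pdo_rat (frac_shift j%:R r).
Proof.
apply/funext => d; rewrite /GRing.mul /= /pdo_mul big_ord_recl big1 => [|i _].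
  rewrite big_ord_recr big1 /= => [|i _].
    rewrite /pdo_rat /pdo_exp /= subnn subn0 add0r addr0.
    rewrite rmorph_nat; have [->|_] := eqVneq d j; first by rewrite mulrC.
    by rewrite mulr0 mul0r.
  by rewrite /pdo_rat subn_eq0 leqNgt ltn_ord mulr0.
by rewrite /pdo_rat /= rmorph0 mul0r.
Qed.

(* psi alpha is the operator expressing the alpha-th unknown of the system
   through a fixed reference function. *)
Definition gauss_manin (K : fieldType) (N k : nat) (L : int -> nat -> K)
    (psi : int -> pdo K) : Prop :=
  forall alpha : int,
    pdo_D K * psi alpha =
    psi (alpha + 1) +
    pdo_sum (fun d => pdo_exp K d *
                      pdo_rat (L (N%:Z - 2 - alpha) d)%:P%:F *
                      psi (alpha + 1 + (k%:Z - N%:Z) * d%:Z)).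

(* F is the coefficientwise limit of the F_j, where the reference function is
   the unknown of index N - 1 and ∂_x^{N-1+j} psi_{-j} = F_j psi_{N-1}. *)
Definition limit_operator (K : fieldType) (N k : nat) (L : int -> nat -> K)
    (F : pdo K) : Prop :=
  (forall (n : int) (d : nat), (0 < d)%N ->
     ~~ (0 <= n <= N%:Z - 1 + (k%:Z - N%:Z) * d%:Z) -> L n d = 0) /\
  exists psi : int -> pdo K,
    [/\ gauss_manin N k L psi,
        psi (N%:Z - 1) = 1 &
        forall d : nat, exists J : nat, forall j : nat, (J <= j)%N ->
          (pdo_D K ^+ (N.-1 + j) * psi (- j%:Z)) d = F d].

Definition ode_term (K : fieldType) (k : nat) : pdo K :=
  k%:R * pdo_exp K 1 * \prod_(1 <= j < k) (k%:R * pdo_D K + j%:R).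

(* ∂_x^{N-1} - k e^x (k∂_x + k - 1) ... (k∂_x + 2) (k∂_x + 1) *)
Definition ode_operator (K : fieldType) (N k : nat) : pdo K :=
  pdo_D K ^+ N.-1 - ode_term K k.

Definition hypergeometric_operator (K : fieldType) (N k : nat) : pdo K :=
  1 + pdo_sum (fun d =>
    pdo_exp K d * \prod_(0 <= m < k * d) (k%:R * pdo_D K + m%:R) *
    \prod_(0 <= j < d) pdo_rat (('X + j%:R)%:F ^- N)).

Section Poly_d.
Local Open Scope complex_scope.

(* The integral of f over the counterclockwise circle |w| = r. *)
Definition circle_integral (R : realType) (r : R) (f : R[i] -> R[i]) : R[i] :=
  let g (t : R) := let e := cos t +i* sin t in f (r%:C * e) * ('i%C * r%:C * e) in
  (\int[lebesgue_measure]_(t in `[0, 2 * pi]%classic) complex.Re (g t)) +i*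
  (\int[lebesgue_measure]_(t in `[0, 2 * pi]%classic) complex.Im (g t)).

(* The iterated integral over u_j, ..., u_{j+n-1}, with u_i on the circle of
   radius rad i and u_j the outermost variable. *)
Fixpoint iterated_integral (R : realType) (rad : nat -> R) (j n : nat)
    (f : (nat -> R[i]) -> R[i]) (u : nat -> R[i]) : R[i] :=
  if n is n'.+1 then
    circle_integral (rad j)
      (fun w => iterated_integral rad j.+1 n' f [eta u with j |-> w])
  else f u.

(* The variables of index 0, d and 0 < j < d are x, y and z_j; v is a point
   with these coordinates, and the fixed u_0, u_d are its ends. *)
Definition is_Poly_d (R : realType) (d : nat) (P : mpoly d.+1 rat) : Prop :=
  P \is ishomog1 d.-1 (@mdeg d.+1) /\
  forall (v : nat -> R[i]) (rad : nat -> R),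
    (rad 0%N)%:C = `|v 0%N| -> (rad d)%:C = `|v d| ->
    (forall j, (0 < j < d)%N ->
       `|v j| < (rad j)%:C /\ rad j.-1 + rad j.+1 < 2 * rad j) ->
    meval (fun i : 'I_d.+1 => v i) (map_mpoly ratr P) =
    d%:R / (2 * pi%:C * 'i%C) ^+ d.-1 *
    iterated_integral rad 1 d.-1
      (fun u => \prod_(1 <= j < d)
         (u j ^+ 2 / ((2 * u j - u j.-1 - u j.+1) * (u j - v j)))) v.

End Poly_d.

Definition Poly_d (R : realType) (d : nat) : mpoly d.+1 rat :=
  xget 0 [set P | is_Poly_d R P]%classic.

(* The polynomial below has degree k - 1, so that its coefficients of index
   n >= k vanish. *)
Definition vsc_init (k : nat) (n : int) (d : nat) : rat :=
  match n, d with
  | Posz m, 1 =>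
      (k%:R *: \prod_(1 <= j < k) (j%:R *: 'X + (k - j)%:R%:P) : {poly rat})`_m
  | _, _ => 0
  end.

(* The indices i_0 < ... < i_l of a monomial. *)
Definition mon_indices (d : nat) (m : multinom d.+1) : seq nat :=
  [seq nat_of_ord i | i <- enum 'I_d.+1 & [|| i == ord0, i == ord_max | 0 < m i]%N].

(* delta_j; the four summands after l - d are the j-th entries of beta, gamma,
   and of the two terms in the epsilon_a (whose j-th entry is 1 iff j <= a). *)
Definition vsc_delta (k : nat) (N : int) (d : nat) (m : multinom d.+1)
    (j : nat) : int :=
  let i := nth 0%N (mon_indices m) in
  let l := (size (mon_indices m)).-1 in
  let e a : int := (m (inord (i a)))%:Z in
  (l%:Z - d%:Z) + ((i j.-1)%:Z - (j.-1)%:Z) + (i j.-1)%:Z * (N - k%:Z)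
  + \sum_(j <= a < l) (e a - 1) + e l.

Definition vsc_monomial (k : nat) (N : int) (L : int -> nat -> rat) (n : int)
    (d : nat) (m : multinom d.+1) : rat :=
  let i := nth 0%N (mon_indices m) in
  let l := (size (mon_indices m)).-1 in
  \prod_(1 <= j < l.+1) L (n + vsc_delta k N m j) (i j - i j.-1)%N.

(* L stands for the constants of parameter N + 1. *)
Definition vsc_phi (k : nat) (N : int) (L : int -> nat -> rat) (n : int)
    (d : nat) (P : mpoly d.+1 rat) : rat :=
  \sum_(m <- msupp P) mcoeff m P * vsc_monomial k N L n m.

(* The constants of parameter N = 2k - t. *)
Fixpoint vsc_rec (R : realType) (k t : nat) : int -> nat -> rat :=
  if t is t'.+1 then
    fun n d => vsc_phi k ((2 * k)%:Z - t%:Z) (vsc_rec R k t') n (Poly_d R d)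
  else vsc_init k.

Definition vsc (R : realType) (k : nat) (N n : int) (d : nat) : rat :=
  if (2 * k)%:Z <= N then vsc_init k n d
  else vsc_rec R k `|(2 * k)%:Z - N|%N n d.

(* Main.v *)
(* The coefficient of e^{dx} in F_oo is a sum T over chains of constants of total
   degree d, with the weights prescribed by (∂_x + f), 0 <= f <= d. Lowering the
   parameter from N + 1 to N multiplies this sum by ∂_x (∂_x + 1) ... (∂_x + d - 1):
   the sum for N is a linear functional applied to a chain of polynomials Poly_m,
   in which consecutive links are joined at z_j by the resolvent 1 / (v_j - z_j),
   with v_j = ∂_x + d - j. Computing the integrals defining Poly_d by residues
   gives a recursion that makes sense over every commutative ring; since the v_j
   form an arithmetic progression, it makes the chain telescope to the product of
   the v_j^2 / (v_j - z_j), which is the chain for N + 1 up to the factors v_j.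
   For N = 2k only constants of degree 1 are left and F_oo is a product, whence
   the hypergeometric series for all smaller N.
   Conversely the constants of degree d enter the coefficient of e^{dx} of F_oo
   only through the sum of the L_n^d (∂_x + d)^n ∂_x^{(k-N)d-n}, and these rational
   functions of ∂_x are linearly independent. *)

(* The integral defining [Poly_d] lives at complex points with suitable radii, whereas the chains
   need its blocks at formal variables z_j, with ends v_0 and v_d in a field of rational functions.
   The relations of [poly_family] contain no division, so one generic solution can be compared with
   the integral at all complex points and then carried to any ring by a morphism. The functional
   that evaluates chains is linear but not multiplicative: a z_j of exponent 0 enlarges a block of
   constants instead of closing it. So v_j - z_j cannot be inverted after evaluation. The
   telescoping is done before it, in the polynomial ring, modulo the ideal of the polynomials that
   no chain detects; there a truncated geometric series is an inverse. For a fixed starting index n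
   the variable x has no counterpart: its exponent shifts n. Only the sum over n of the w_d^n T d n
   absorbs this shift, as a power of x = v_0 = w_d, so the two parameters are compared through this
   total and not index by index. *)
From HB Require Import structures.
Require Import Defs.
From mathcomp Require Import all_boot all_order all_algebra.
From mathcomp Require Import all_classical all_reals all_analysis.
From mathcomp Require Import complex.
From mathcomp Require Import -(notations) mpoly.
From mathcomp Require Import ring lra zify.

Set Implicit Arguments.
Unset Strict Implicit.
Unset Printing Implicit Defensive.

Import Order.TTheory GRing.Theory Num.Theory.

Local Open Scope ring_scope.

(** * The polynomial recursion behind Poly_d *)

(* P p m, evaluated at z p, is Poly_m in the variables z_p, ..., z_{p+m}
   (Poly_d_family). Q p m and De p m are the divided differences split off by
   the poles z_{p+1} and ((m - 1) x + z_{p+m}) / m of the integrand. *)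
Definition poly_family (A : comNzRingType) (d : nat) (z : nat -> A)
    (P Q : nat -> nat -> {poly A}) (De : nat -> nat -> {poly {poly A}}) : Prop :=
  [/\ forall p, P p 1%N = 1,
      forall p m, (1 < m <= d)%N ->
        ('X - (z p.+1)%:P) * Q p m =
        'X^2 * P p.+1 m.-1 - (z p.+1 ^+ 2 * (P p.+1 m.-1).[z p.+1])%:P
    & forall p m, (1 < m <= d)%N ->
        (m%:R *: 'X - (m.-1%:R *: 'X + (z (p + m)%N)%:P)%:P) * De p m =
        map_poly polyC (Q p m) - (P p m)%:P +
        \sum_(2 <= i < m)
           (z (p + i)%N ^+ 2 * (P (p + i)%N (m - i)%N).[z (p + i)%N])%:P%:P * De p i].

Section Quotient.
Variable A : comNzRingType.
Import Pdiv.CommonRing Pdiv.RingMonic.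

Lemma XsubC_rdivp (p : {poly A}) (c : A) :
  ('X - c%:P) * rdivp (p - p.[c]%:P) ('X - c%:P) = p - p.[c]%:P.
Proof.
have /factor_theorem [q ->] : root (p - p.[c]%:P) c.
  by rewrite /root hornerD hornerN hornerC subrr.
by rewrite rdivp_mull ?monicXsubC // mulrC.
Qed.

End Quotient.

(** Only the blocks of length [d.+1] are new. The third relation forces P to be its right-hand side
    at the t where the prefactor vanishes ([mid]); the factor theorem then provides De. Solving for
    that t takes the inverses of the positive integers. *)
Lemma poly_family_exists (A : comNzRingType) (inv : nat -> A) (d : nat)
    (z : nat -> A) :
  (forall m, (0 < m)%N -> m%:R * inv m = 1) ->
  exists P Q De, poly_family d z P Q De.
Proof.
move=> invP.
elim: d => [|d [P [Q [De [h1 h2 h3]]]]].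
  by exists (fun _ _ => 1), (fun _ _ => 0), (fun _ _ => 0); split=> // p m; lia.
have [d1|d1] := ltnP d.+1 2.
  by exists P, Q, De; split=> // p m hm; lia.
pose m := d.+1.
pose src p := 'X^2 * P p.+1 d : {poly A}.
pose Q0 p := Pdiv.CommonRing.rdivp (src p - (src p).[z p.+1]%:P) ('X - (z p.+1)%:P).
pose rhs p := map_poly polyC (Q0 p) + \sum_(2 <= i < m)
  (z (p + i)%N ^+ 2 * (P (p + i)%N (m - i)%N).[z (p + i)%N])%:P%:P * De p i.
pose mid p := (inv m * d%:R) *: 'X + (inv m * z (p + m)%N)%:P : {poly A}.
pose P0 p := (rhs p).[mid p].
pose D0 p := (inv m)%:P *: Pdiv.CommonRing.rdivp (rhs p - (P0 p)%:P) ('X - (mid p)%:P).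
exists (fun p i => if i == m then P0 p else P p i),
  (fun p i => if i == m then Q0 p else Q p i),
  (fun p i => if i == m then D0 p else De p i); split.
- by move=> p; rewrite ltn_eqF.
- move=> p i /andP[i1 id].
  have -> : (i.-1 == m) = false by apply/eqP; rewrite /m; lia.
  have [e|ne] := eqVneq i m; last by apply: h2; rewrite /m in ne; lia.
  by rewrite e /= XsubC_rdivp /src hornerM hornerXn.
- move=> p i /andP[i1 id].
  have sumE : \sum_(2 <= j < i) (z (p + j)%N ^+ 2 *
      (if (i - j)%N == m then P0 (p + j)%N else P (p + j)%N (i - j)%N).[z (p + j)%N])%:P%:P *
      (if j == m then D0 p else De p j) =
    \sum_(2 <= j < i) (z (p + j)%N ^+ 2 *
      (P (p + j)%N (i - j)%N).[z (p + j)%N])%:P%:P * De p j.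
    rewrite !big_nat; apply: eq_bigr => j hj.
    have -> : (i - j == m)%N = false by apply/eqP; rewrite /m; lia.
    by have -> : (j == m)%N = false by apply/eqP; rewrite /m; lia.
  rewrite sumE {sumE}.
  have [e|ne] := eqVneq i m; last by apply: h3; rewrite /m in ne; lia.
  rewrite e /= [RHS]addrAC -/(rhs p).
  have -> : m%:R *: 'X - (d%:R *: 'X + (z (p + m)%N)%:P)%:P =
            m%:R *: ('X - (mid p)%:P) :> {poly {poly A}}.
    rewrite scalerBr; congr (_ - _); rewrite scale_polyC /mid; congr (_%:P).
    rewrite -polyC_natr mul_polyC scalerDr scalerA scale_polyC !mulrA invP //.
    by rewrite !mul1r.
  rewrite /D0 -scalerAl -scalerAr scalerA -polyC_natr -polyCM invP // scale1r.
  exact: XsubC_rdivp.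
Qed.

Section Evaluation.
Variables (A : comNzRingType) (d : nat) (z : nat -> A).
Variables (P Q : nat -> nat -> {poly A}) (De : nat -> nat -> {poly {poly A}}).
Hypothesis fam : poly_family d z P Q De.

Lemma poly_family_hornerQ p m t : (1 < m <= d)%N ->
  (t - z p.+1) * (Q p m).[t] =
  t ^+ 2 * (P p.+1 m.-1).[t] - z p.+1 ^+ 2 * (P p.+1 m.-1).[z p.+1].
Proof.
case: fam => _ f2 _ hm.
by have /(congr1 (horner^~ t)) := f2 p m hm; rewrite !hornerE.
Qed.

Lemma poly_family_hornerD p m t x : (1 < m <= d)%N ->
  (m%:R * t - m.-1%:R * x - z (p + m)%N) * (De p m).[t%:P].[x] =
  (Q p m).[t] - (P p m).[x] + \sum_(2 <= i < m)
    z (p + i)%N ^+ 2 * (P (p + i)%N (m - i)%N).[z (p + i)%N] *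
      (De p i).[t%:P].[x].
Proof.
case: fam => _ _ f3 hm.
have /(congr1 (fun q => q.[t%:P].[x])) := f3 p m hm.
rewrite !hornerE /= -(rmorph_nat polyC) !hornerE horner_map /= hornerC.
rewrite opprD addrA => ->; congr (_ + _).
by rewrite !horner_sum; apply: eq_bigr => i _; rewrite !hornerE.
Qed.
End Evaluation.

Section StrongRecursion.
Variables (T : Type) (x0 : T) (F : nat -> (nat -> T) -> T).

Fixpoint strong_rec_fuel (n : nat) : nat -> T :=
  if n is n'.+1 then fun m => F m (strong_rec_fuel n') else fun=> x0.

(** All kernels defined by a sum over shorter chains are built this way; the fuel [m.+1] suffices
    because the step at m consults smaller arguments only. *)
Definition strong_rec (m : nat) : T := strong_rec_fuel m.+1 m.

Hypothesis F_ext : forall m f g, (forall i, (i < m)%N -> f i = g i) -> F m f = F m g.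

Lemma strong_recE m : strong_rec m = F m strong_rec.
Proof.
have gE n n' k : (k < n)%N -> (k < n')%N -> strong_rec_fuel n k = strong_rec_fuel n' k.
  elim: n n' k => // n IH [//|n'] k kn kn' /=.
  by apply: F_ext => i ik; apply: IH; lia.
rewrite /strong_rec /=; apply: F_ext => i im.
by apply: (gE m i.+1 i).
Qed.
End StrongRecursion.

(** * Collapse of the chain kernel along an arithmetic progression *)

Section PartialFractions.
Variables (A : comNzRingType) (J : A -> Prop).
Hypothesis JD : forall x y, J x -> J y -> J (x + y).
Hypothesis JM : forall a x, J x -> J (a * x).
Variables (d : nat) (z v g : nat -> A) (tau : A).
Variables (P Q : nat -> nat -> {poly A}) (De : nat -> nat -> {poly {poly A}}).
Hypothesis fam : poly_family d z P Q De.
Hypothesis vS : forall j, v j.+1 = v j + tau.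
Hypothesis gP : forall j, (0 < j < d)%N -> J (g j * (v j - z j) - 1).
Hypothesis vd : J (v d - z d).
(* Modulo the ideal J, g j is 1 / (v j - z j), the ends z 0 and z d are v 0 and
   v d, and the points v j are in arithmetic progression: the prefactor of
   De then vanishes, so that the kernel K collapses to a product (K_prod). *)
Variable K : nat -> nat -> A.
Hypothesis KE : forall p q, (p < q)%N -> K p q = (P p (q - p)).[v p] +
  \sum_(p.+1 <= s < q) K p s * (z s ^+ 2 * g s * (P s (q - s)).[z s]).

Lemma ideal_sum (I : Type) (r : seq I) (F : I -> A) (C : pred I) :
  (forall i, C i -> J (F i)) -> J (\sum_(i <- r | C i) F i).
Proof.
move=> h; apply: (big_ind J) => //.
by move: (JM 0 vd); rewrite mul0r.
Qed.

(** Let D_s be De p (s - p) at t = v_{p+1}, x = v_p. Its prefactor becomes v_s - z_s, and g_s (v_s -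
    z_s) is 1 modulo J. So the corrections (v_s - z_s) D_s supplied by induction for s < q cancel
    the sum in the relation for D_q. *)
Lemma K_step p q : (p.+1 < q <= d)%N ->
  J (K p q - (v p.+1 ^+ 2 * g p.+1 * K p.+1 q -
              (v q - z q) * (De p (q - p)).[(v p.+1)%:P].[v p])).
Proof.
case: fam => f1 f2 f3.
have vE j : v (p + j)%N = v p + j%:R * tau.
  by elim: j => [|j IH]; rewrite ?addn0 ?mul0r ?addr0 // addnS vS IH; ring.
elim/ltn_ind: q => q IH /andP[pq qd].
pose D s := (De p (s - p)).[(v p.+1)%:P].[v p].
pose c s := z s ^+ 2 * g s * (P s (q - s)).[z s].
have hm : (1 < q - p <= d)%N by lia.
have pq' : (p + (q - p) = q)%N by lia.
have Deq : (v q - z q) * D q = (Q p (q - p)).[v p.+1] - (P p (q - p)).[v p] +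
    \sum_(p.+2 <= s < q) z s ^+ 2 * (P s (q - s)).[z s] * D s.
  (* Here the arithmetic progression enters: m v_{p+1} - (m - 1) v_p = v_{p+m}. *)
  have pref : (q - p)%:R * v p.+1 - ((q - p).-1%:R * v p + z q) = v q - z q.
    have -> : v q = v p + (q - p)%:R * tau by rewrite -vE pq'.
    have -> : (q - p)%:R = (q - p).-1%:R + 1 :> A by rewrite natr1 prednK //; lia.
    by rewrite vS; ring.
  have := poly_family_hornerD fam p (v p.+1) (v p) hm.
  rewrite pq' -[X in X * _]addrA -opprD pref => ->; congr (_ + _).
  rewrite -[p.+2]add2n big_addn.
  apply: eq_big_nat => i hi.
  rewrite /D (addnC i p) addKn.
  by have -> : (q - (p + i) = q - p - i)%N by lia.
have Qeq : (v p.+1 - z p.+1) * (Q p (q - p)).[v p.+1] =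
    v p.+1 ^+ 2 * (P p.+1 (q - p.+1)).[v p.+1] -
    z p.+1 ^+ 2 * (P p.+1 (q - p.+1)).[z p.+1].
  rewrite (poly_family_hornerQ fam _ _ hm).
  by have -> : (q - p.+1 = (q - p).-1)%N by lia.
have K1 : K p q = (P p (q - p)).[v p] + c p.+1 +
    \sum_(p.+2 <= s < q) K p s * c s.
  rewrite KE; last by lia.
  rewrite big_ltn; last by lia.
  rewrite addrA; congr (_ + _ + _).
  rewrite KE // big_geq // addr0 subSnn f1 hornerC mul1r.
  by [].
have K2 : K p.+1 q = (P p.+1 (q - p.+1)).[v p.+1] +
    \sum_(p.+2 <= s < q) K p.+1 s * c s by rewrite KE.
(* [E s] lies in J: it is [c s] times the induction hypothesis at s, minus a multiple of the defect
   of [g s] as an inverse. *)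
pose E s := c s * (K p s - (v p.+1 ^+ 2 * g p.+1 * K p.+1 s - (v s - z s) * D s))
  - (g s * (v s - z s) - 1) * (z s ^+ 2 * (P s (q - s)).[z s] * D s).
have -> : K p q - (v p.+1 ^+ 2 * g p.+1 * K p.+1 q -
              (v q - z q) * (De p (q - p)).[(v p.+1)%:P].[v p]) =
   - (Q p (q - p)).[v p.+1] * (g p.+1 * (v p.+1 - z p.+1) - 1) +
   \sum_(p.+2 <= s < q) E s.
  rewrite -/(D q) Deq K1 K2.
  have -> : \sum_(p.+2 <= s < q) E s =
    \sum_(p.+2 <= s < q) K p s * c s - v p.+1 ^+ 2 * g p.+1 *
    \sum_(p.+2 <= s < q) K p.+1 s * c s +
    \sum_(p.+2 <= s < q) z s ^+ 2 * (P s (q - s)).[z s] * D s.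
    rewrite mulr_sumr -sumrB -big_split; apply: eq_bigr => s _.
    by rewrite /E /= /c; ring.
  have -> : - (Q p (q - p)).[v p.+1] * (g p.+1 * (v p.+1 - z p.+1) - 1) =
    (Q p (q - p)).[v p.+1] - g p.+1 * (v p.+1 ^+ 2 * (P p.+1 (q - p.+1)).[v p.+1] -
    z p.+1 ^+ 2 * (P p.+1 (q - p.+1)).[z p.+1]) by rewrite -Qeq; ring.
  by rewrite /c; ring.
apply: JD; first by apply/JM/gP; lia.
rewrite big_nat; apply: ideal_sum => s hs; apply: JD.
  by apply/JM/IH; lia.
by rewrite mulrC -mulNr; apply/JM/gP; lia.
Qed.

(** At q = d the correction carries the factor v_d - z_d and drops out, so each step merely splits
    off v_{p+1}^2 g_{p+1}, down to a block of length 1, where P is 1. *)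
Lemma K_prod p : (p < d)%N -> J (K p d - \prod_(p.+1 <= j < d) (v j ^+ 2 * g j)).
Proof.
move=> pd; have [n e] : exists n, d = (p + n).+1 by exists (d - p.+1)%N; lia.
elim: n p pd e => [|n IH] p pd e.
  case: fam => f1 _ _.
  rewrite KE // !big_geq ?addr0; try lia.
  have -> : (d - p = 1)%N by lia.
  rewrite f1 hornerC subrr.
  by move: (JM 0 vd); rewrite mul0r.
rewrite big_ltn; last by lia.
have h1 := @K_step p d ltac:(lia).
have h2 := IH p.+1 ltac:(lia) ltac:(lia).
set X := \prod_(_ <= _ < _) _ in h2 *.
set T := (De p (d - p)).[(v p.+1)%:P].[v p] in h1.
have -> : K p d - v p.+1 ^+ 2 * g p.+1 * X =
  (K p d - (v p.+1 ^+ 2 * g p.+1 * K p.+1 d - (v d - z d) * T)) +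
  ((v p.+1 ^+ 2 * g p.+1) * (K p.+1 d - X) + (- T) * (v d - z d)) by ring.
by apply: JD => //; apply: JD; apply: JM.
Qed.

End PartialFractions.

Import numFieldNormedType.Exports.
Local Open Scope complex_scope.

(** * Circle integrals *)

Section Circle.
Variable R : realType.
Local Notation C := R[i].

Definition cis (t : R) : C := cos t +i* sin t.

Lemma cisD s t : cis (s + t) = cis s * cis t.
Proof. by rewrite /cis sinD cosD; simpc; congr (_ +i* _); rewrite addrC. Qed.

Lemma cis0 : cis 0 = 1. Proof. by rewrite /cis sin0 cos0. Qed.

Lemma norm_cis t : `|cis t| = 1.
Proof. by rewrite normc_def /= cos2Dsin2 sqrtr1. Qed.

Lemma cis_neq0 t : cis t != 0.
Proof. by rewrite -normr_eq0 norm_cis oner_eq0. Qed.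

Lemma cis_exprz t (n : int) : cis t ^ n = cis (n%:~R * t).
Proof.
have pow (m : nat) : cis t ^+ m = cis (m%:R * t).
  elim: m => [|m IH]; first by rewrite expr0 mul0r cis0.
  by rewrite exprS IH -cisD -natr1 mulrDl mul1r addrC.
case: n => m; first by rewrite -exprnP pow.
rewrite NegzE -exprnN pow; apply: (mulfI (cis_neq0 (m.+1%:R * t))).
by rewrite mulfV ?cis_neq0 // -cisD intrN mulNr subrr cis0.
Qed.

(** Stated for two real functions because [circle_integral] consists of two real Lebesgue
    integrals. *)
Definition circle_continuous (r : R) (f : C -> C) : Prop :=
  continuous (fun t : R => complex.Re (f (r%:C * cis t))) /\
  continuous (fun t : R => complex.Im (f (r%:C * cis t))).

Lemma on_circle (r t : R) : 0 <= r -> `|r%:C * cis t| = r%:C.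
Proof.
by move=> r0; rewrite normrM norm_cis mulr1 ger0_norm // ler0c.
Qed.

Lemma continuous_ext (f g : R -> R) : f =1 g -> continuous f -> continuous g.
Proof. by move=> /funext ->. Qed.

Section Algebra.
Variables (r : R) (f g : C -> C).
Hypothesis r0 : 0 <= r.
Hypothesis cf : circle_continuous r f.
Hypothesis cg : circle_continuous r g.

Lemma circle_continuous_cst (c : C) : circle_continuous r (fun=> c).
Proof. by split; exact: cst_continuous. Qed.

Lemma circle_continuous_id : circle_continuous r id.
Proof.
split.
  apply: (continuous_ext (f := fun t => r * cos t)).
    by move=> t; rewrite /cis; simpc.
  by move=> t; apply: cvgM; [exact: cvg_cst|exact: continuous_cos].
apply: (continuous_ext (f := fun t => r * sin t)).
  by move=> t; rewrite /cis; simpc.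
by move=> t; apply: cvgM; [exact: cvg_cst|exact: continuous_sin].
Qed.

Lemma circle_continuousD : circle_continuous r (fun u => f u + g u).
Proof.
case: cf cg => f1 f2 [g1 g2]; split.
  apply: (continuous_ext (f := fun t => complex.Re (f (r%:C * cis t)) + complex.Re (g (r%:C * cis t)))).
    by move=> s; rewrite raddfD.
  by move=> s; apply: cvgD; [exact: f1|exact: g1].
apply: (continuous_ext (f := fun t => complex.Im (f (r%:C * cis t)) + complex.Im (g (r%:C * cis t)))).
  by move=> s; rewrite raddfD.
by move=> s; apply: cvgD; [exact: f2|exact: g2].
Qed.

Lemma circle_continuousM : circle_continuous r (fun u => f u * g u).
Proof.
case: cf cg => f1 f2 [g1 g2]; split.
  apply: (continuous_ext (f := fun t =>
    complex.Re (f (r%:C * cis t)) * complex.Re (g (r%:C * cis t)) -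
    complex.Im (f (r%:C * cis t)) * complex.Im (g (r%:C * cis t)))).
    by move=> s; case: (f _) => a b; case: (g _) => c d; simpc.
  move=> s; apply: cvgB; apply: cvgM.
  - exact: f1.
  - exact: g1.
  - exact: f2.
  - exact: g2.
apply: (continuous_ext (f := fun t =>
    complex.Re (f (r%:C * cis t)) * complex.Im (g (r%:C * cis t)) +
    complex.Im (f (r%:C * cis t)) * complex.Re (g (r%:C * cis t)))).
  by move=> s; case: (f _) => a b; case: (g _) => c d; simpc.
move=> s; apply: cvgD; apply: cvgM.
- exact: f1.
- exact: g2.
- exact: f2.
- exact: g1.
Qed.

Lemma circle_continuousV : (forall u, `|u| = r%:C -> f u != 0) ->
  circle_continuous r (fun u => (f u)^-1).
Proof.
case: cf => f1 f2 nz.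
pose D t := complex.Re (f (r%:C * cis t)) ^+ 2 + complex.Im (f (r%:C * cis t)) ^+ 2.
have D0 t : D t != 0.
  apply: contra (nz _ (on_circle t r0)); rewrite /D.
  rewrite paddr_eq0 ?sqr_ge0 // !sqrf_eq0 => /andP[/eqP e1 /eqP e2].
  by rewrite [f _]complexE e1 e2 mulr0 addr0.
have cD : continuous (fun t => (D t)^-1).
  move=> t; apply: continuousV => //.
  by apply: cvgD; apply: cvgM; (exact: f1 || exact: f2).
split.
  apply: (continuous_ext (f := fun t => complex.Re (f (r%:C * cis t)) * (D t)^-1)).
    by move=> s; rewrite /D; case: (f _) => a b.
  by move=> s; apply: cvgM; [exact: f1|exact: cD].
apply: (continuous_ext (f := fun t => - complex.Im (f (r%:C * cis t)) * (D t)^-1)).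
  by move=> s; rewrite /D; case: (f _) => a b /=; rewrite mulNr.
by move=> s; apply: cvgM; [apply: cvgN; exact: f2|exact: cD].
Qed.
End Algebra.

Lemma circle_integrable (h : R -> R) : continuous h ->
  (@lebesgue_measure R).-integrable `[0, 2 * pi]%classic (EFin \o h).
Proof.
move=> ch; apply: continuous_compact_integrable; first exact: segment_compact.
exact: continuous_subspaceT.
Qed.

Lemma cis_2pi (n : int) : cis (n%:~R * (2 * pi)) = 1.
Proof.
by rewrite -cis_exprz /cis mulr_natl sin2pi cos2pi exp1rz.
Qed.

Lemma Rintegral_derive (F f : R -> R) : (forall t : R, is_derive t (1 : R) F (f t)) ->
  continuous f ->
  \int[lebesgue_measure]_(t in `[0, 2 * pi]%classic) f t = F (2 * pi) - F 0.
Proof.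
move=> dF cf.
have pi0 : (0 : R) < 2 * pi by rewrite mulr_gt0 ?pi_gt0.
have cF : continuous F.
  by move=> t; apply/differentiable_continuous/derivable1_diffP; exact: (@ex_derive _ _ _ _ _ _ _ (dF t)).
rewrite /Rintegral (continuous_FTC2 pi0 (F := F)) //.
- exact: continuous_subspaceT.
- split.
  + by move=> t _; exact: (@ex_derive _ _ _ _ _ _ _ (dF t)).
  + exact/cvg_at_right_filter/cF.
  + exact/cvg_at_left_filter/cF.
- by move=> t _; rewrite derive1E (@derive_val _ _ _ _ _ _ _ (dF t)).
Qed.

Lemma Rintegral_cos_sin (n : int) : n != 0 ->
  \int[lebesgue_measure]_(t in `[0, 2 * pi]%classic) cos (n%:~R * t) = 0 :> R /\
  \int[lebesgue_measure]_(t in `[0, 2 * pi]%classic) sin (n%:~R * t) = 0 :> R.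
Proof.
move=> n0; have nR : n%:~R != 0 :> R by rewrite intr_eq0.
have cn : continuous (fun t : R => n%:~R * t).
  by move=> t; apply: cvgM; [exact: cvg_cst|exact: cvg_id].
have [c2 s2] : cos (n%:~R * (2 * pi)) = 1 :> R /\ sin (n%:~R * (2 * pi)) = 0 :> R.
  by have [] := cis_2pi n.
have dn (t : R) : is_derive t (1 : R) (fun t : R => n%:~R * t) n%:~R.
  have := @is_deriveZ _ _ _ (id : R -> R) n%:~R t 1 1 (is_derive_id t 1).
  by rewrite /GRing.scale /= mulr1.
have d1 (t : R) : is_derive t (1 : R) (fun t => n%:~R^-1 * sin (n%:~R * t)) (cos (n%:~R * t)).
  have := is_deriveZ n%:~R^-1 (is_derive1_comp (is_derive_sin (n%:~R * t)) (dn t)).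
  by rewrite /GRing.scale /= mulrC mulfK.
have d2 (t : R) : is_derive t (1 : R) (fun t => - n%:~R^-1 * cos (n%:~R * t)) (sin (n%:~R * t)).
  have := is_deriveZ (- n%:~R^-1) (is_derive1_comp (is_derive_cos (n%:~R * t)) (dn t)).
  by rewrite /GRing.scale /= mulNr mulNr mulrN opprK mulrC mulfK.
split.
- rewrite (Rintegral_derive d1).
  + by rewrite s2 !mulr0 sin0 mulr0 subrr.
  + by move=> t; apply: continuous_comp; [exact: cn|exact: continuous_cos].
- rewrite (Rintegral_derive d2).
  + by rewrite c2 mulr0 cos0 subrr.
  + by move=> t; apply: continuous_comp; [exact: cn|exact: continuous_sin].
Qed.

Local Notation I2pi := (`[0, 2 * pi]%classic : set R).

Definition cis_integral (r : R) (F : C -> C) : C :=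
  (\int[lebesgue_measure]_(t in I2pi) complex.Re (F (r%:C * cis t))) +i*
  (\int[lebesgue_measure]_(t in I2pi) complex.Im (F (r%:C * cis t))).

Lemma circle_integralE (r : R) (f : C -> C) :
  circle_integral r f = cis_integral r (fun u => f u * ('i%C * u)).
Proof.
by congr (_ +i* _); apply: eq_Rintegral => t _ /=; rewrite -mulrA.
Qed.

Lemma eq_circle_integral (r : R) (f g : C -> C) : 0 <= r ->
  (forall u, `|u| = r%:C -> f u = g u) -> circle_integral r f = circle_integral r g.
Proof.
by move=> r0 fg; rewrite !circle_integralE; congr (_ +i* _);
  apply: eq_Rintegral => t _ /=; rewrite fg // on_circle.
Qed.

Lemma circle_integralD (r : R) (f g : C -> C) :
  circle_continuous r f -> circle_continuous r g ->
  circle_integral r (fun u => f u + g u) = circle_integral r f + circle_integral r g.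
Proof.
move=> cf cg; rewrite !circle_integralE.
have ci : circle_continuous r (fun u => 'i%C * u).
  by apply: circle_continuousM; [exact: circle_continuous_cst|exact: circle_continuous_id].
have [f1 f2] := circle_continuousM cf ci.
have [g1 g2] := circle_continuousM cg ci.
rewrite /cis_integral; simpc; congr (_ +i* _).
  rewrite -RintegralD //; try exact: circle_integrable.
  by apply: eq_Rintegral => t _; rewrite mulrDl raddfD.
rewrite -RintegralD //; try exact: circle_integrable.
by apply: eq_Rintegral => t _; rewrite mulrDl raddfD.
Qed.

Lemma circle_integralZ (r : R) (c : C) (f : C -> C) :
  circle_continuous r f ->
  circle_integral r (fun u => c * f u) = c * circle_integral r f.
Proof.
move=> cf; rewrite !circle_integralE.
have ci : circle_continuous r (fun u => 'i%C * u).
  by apply: circle_continuousM; [exact: circle_continuous_cst|exact: circle_continuous_id].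
have [f1 f2] := circle_continuousM cf ci.
have cz (k : R) (h : R -> R) : continuous h -> continuous (fun t => k * h t).
  by move=> ch t; apply: cvgM; [exact: cvg_cst|exact: ch].
rewrite /cis_integral; case: c => a b; simpc; congr (_ +i* _).
  rewrite -!RintegralZl //; try exact: circle_integrable.
  rewrite -RintegralB; [|exact: measurable_itv|by apply: circle_integrable; exact: cz|by apply: circle_integrable; exact: cz].
  by apply: eq_Rintegral => t _; rewrite -[in LHS]mulrA; case: (f _ * _) => x y.
rewrite -!RintegralZl //; try exact: circle_integrable.
rewrite -RintegralD; [|exact: measurable_itv|by apply: circle_integrable; exact: cz|by apply: circle_integrable; exact: cz].
by apply: eq_Rintegral => t _; rewrite -[in LHS]mulrA; case: (f _ * _) => x y.
Qed.

Lemma Rintegral_2pi (M : R) :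
  \int[lebesgue_measure]_(t in I2pi) M = M * (2 * pi).
Proof.
rewrite Rintegral_cst //=; congr (_ * _).
by rewrite lebesgue_measure_itv /= lte_fin mulr_gt0 ?pi_gt0 // oppr0 addr0.
Qed.

Lemma Rintegral_bound (h : R -> R) (M : R) : continuous h ->
  (forall t, t \in I2pi -> `|h t| <= M) ->
  `|\int[lebesgue_measure]_(t in I2pi) h t| <= M * (2 * pi).
Proof.
move=> ch hM; apply: (le_trans (le_normr_Rintegral _ (circle_integrable ch))) => //.
rewrite -Rintegral_2pi.
apply: le_Rintegral => //.
- by apply: circle_integrable => t; apply: cvg_norm; exact: ch.
- by apply: circle_integrable; exact: cst_continuous.
- by move=> t tI; apply: hM; rewrite inE.
Qed.

Lemma normci : `|'i%C : C| = 1.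
Proof. by rewrite normc_def /= expr0n expr1n add0r sqrtr1. Qed.

Lemma normcR (k : R) : `|k%:C| = `|k|%:C.
Proof. by rewrite normc_def /= expr0n addr0 sqrtr_sqr. Qed.

Lemma norm_complex_le (x : C) : `|x| <= (`|complex.Re x| + `|complex.Im x|)%:C.
Proof.
case: x => a b; rewrite [X in `|X|]complexE; apply: (le_trans (ler_normD _ _)).
by rewrite normrM normci mul1r !normcR rmorphD.
Qed.

Lemma norm_Im_le (x : C) : `|complex.Im x|%:C <= `|x|.
Proof.
have := normc_ge_Re ('i%C * x).
by rewrite normrM normci mul1r; case: x => a b; simpc => /=; rewrite normrN.
Qed.

(** The factor 2 comes from bounding real and imaginary parts separately; it is harmless, as only
    the geometric decay of such bounds matters. *)
Lemma circle_integral_bound (r : R) (f : C -> C) (M : R) : 0 <= r ->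
  circle_continuous r f ->
  (forall t, t \in I2pi -> `|f (r%:C * cis t)| <= M%:C) ->
  `|circle_integral r f| <= (2 * (r * (2 * pi)) * M)%:C.
Proof.
move=> r0 cf fM.
have ci : circle_continuous r (fun u => 'i%C * u).
  by apply: circle_continuousM; [exact: circle_continuous_cst|exact: circle_continuous_id].
have [f1 f2] := circle_continuousM cf ci.
rewrite circle_integralE; apply: (le_trans (norm_complex_le _)); rewrite lecR /=.
have b t : t \in I2pi -> `|f (r%:C * cis t) * ('i%C * (r%:C * cis t))| <= (M * r)%:C.
  move=> tI; rewrite normrM normrM normci mul1r on_circle // rmorphM /=.
  by rewrite ler_wpM2r ?ler0c // fM.
have b1 := Rintegral_bound f1 (M := M * r).
have b2 := Rintegral_bound f2 (M := M * r).
have -> : 2 * (r * (2 * pi)) * M = M * r * (2 * pi) + M * r * (2 * pi) by ring.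
apply: lerD.
  by apply: b1 => t tI; rewrite -lecR; apply: le_trans (b t tI); exact: normc_ge_Re.
by apply: b2 => t tI; rewrite -lecR; apply: le_trans (b t tI); exact: norm_Im_le.
Qed.

(** On the circle the integrand is i r^(n+1) [cis] ((n+1) t), which runs through full periods unless
    n = -1. *)
Lemma circle_integral_exprz (r : R) (n : int) : 0 < r ->
  circle_integral r (fun u => u ^ n) = if n == -1 then 2 * pi%:C * 'i%C else 0.
Proof.
move=> r0; have rC : r%:C != 0 by rewrite fmorph_eq0 gt_eqF.
have E t : (r%:C * cis t) ^ n * ('i%C * (r%:C * cis t)) =
    ('i%C * (r ^ (n + 1))%:C) * cis ((n + 1)%:~R * t).
  set x := r%:C * cis t; have x0 : x != 0 by rewrite mulf_neq0 ?cis_neq0.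
  rewrite mulrCA -[X in _ ^ n * X]expr1z -expfzDr // exprzMl ?unitfE ?cis_neq0 //.
  by rewrite cis_exprz mulrA fmorphXz.
have [->|n1] := eqVneq n (-1).
  rewrite circle_integralE /cis_integral.
  have E1 t : (r%:C * cis t) ^ (-1) * ('i%C * (r%:C * cis t)) = 'i%C.
    by rewrite mulrCA mulVf ?mulr1 // mulf_neq0 ?cis_neq0.
  have -> : (fun t => complex.Re ((r%:C * cis t) ^ (-1) * ('i%C * (r%:C * cis t)))) = (fun=> 0).
    by apply/funext => t; rewrite E1.
  have -> : (fun t => complex.Im ((r%:C * cis t) ^ (-1) * ('i%C * (r%:C * cis t)))) = (fun=> 1).
    by apply/funext => t; rewrite E1.
  by rewrite !Rintegral_2pi mul0r mul1r -[2]/(2%:R) -(rmorph_nat (real_complex R)); simpc.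
have n2 : n + 1 != 0 by rewrite addr_eq0.
have [c s] := Rintegral_cos_sin n2.
rewrite circle_integralE /cis_integral.
have -> : (fun t => complex.Re ((r%:C * cis t) ^ n * ('i%C * (r%:C * cis t)))) =
  (fun t => - (r ^ (n + 1)) * sin ((n + 1)%:~R * t)).
  by apply/funext => t; rewrite E /cis; simpc.
have -> : (fun t => complex.Im ((r%:C * cis t) ^ n * ('i%C * (r%:C * cis t)))) =
  (fun t => r ^ (n + 1) * cos ((n + 1)%:~R * t)).
  by apply/funext => t; rewrite E /cis; simpc.
have cn : continuous (fun t : R => (n + 1)%:~R * t).
  by move=> t; apply: cvgM; [exact: cvg_cst|exact: cvg_id].
rewrite !RintegralZl //.
- by rewrite c s !mulr0.
- apply: circle_integrable => t.
  by apply: continuous_comp; [exact: cn|exact: continuous_cos].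
- apply: circle_integrable => t.
  by apply: continuous_comp; [exact: cn|exact: continuous_sin].
Qed.

Lemma circle_bounded (r : R) (f : C -> C) : circle_continuous r f ->
  exists M : R, forall t, t \in I2pi -> `|f (r%:C * cis t)| <= M%:C.
Proof.
move=> [f1 f2].
have pi0 : (0 : R) <= 2 * pi by rewrite mulr_ge0 ?pi_ge0.
have bd (h : R -> R) : continuous h -> exists M, forall t, t \in I2pi -> `|h t| <= M.
  move=> ch; have cn : {within `[0, 2 * pi], continuous (fun t => `|h t|)}%classic.
    by apply: continuous_subspaceT => t; apply: cvg_norm; exact: ch.
  have [c _ hc] := EVT_max pi0 cn.
  by exists `|h c| => t; rewrite inE /= => tI; exact: hc.
have [M1 h1] := bd _ f1; have [M2 h2] := bd _ f2.
exists (M1 + M2) => t tI; apply: (le_trans (norm_complex_le _)).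
by rewrite lecR lerD ?h1 ?h2.
Qed.

(** Used where Cauchy's theorem would be expected: vanishing of contour integrals follows from
    linear relations between moments and crude bounds, without holomorphy. *)
Lemma geometric_eq0 (x : C) (M q : R) : 0 <= q -> q < 1 ->
  (forall n, `|x| <= (M * q ^+ n)%:C) -> x = 0.
Proof.
move=> q0 q1 h; apply/eqP; rewrite -normr_eq0 normc_def.
have E : (complex.Re `|x|)%:C = `|x| by rewrite normc_def.
rewrite -normc_def -E fmorph_eq0; apply/eqP/le_anti/andP; split; last first.
  by rewrite -lecR E normr_ge0.
have cv : (M * q ^+ n @[n --> \oo] --> (M * 0 : R))%classic.
  by apply: cvgM; [exact: cvg_cst|apply: cvg_expr; rewrite ger0_norm].
rewrite -(mulr0 M) -(cvg_lim _ cv) //; apply: limr_ge; first exact: cvgP cv.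
by apply: nearW => n; rewrite -lecR E.
Qed.

End Circle.

(** * Normalised contour integrals and their vanishing by geometric decay *)

Section Contour.
Variable R : realType.
Local Notation C := R[i].
Variable r : R.
Hypothesis r0 : 0 < r.
Let r0' : 0 <= r := ltW r0.

Definition contour (f : C -> C) : C := circle_integral r f / (2 * pi%:C * 'i%C).

Local Notation cc := (circle_continuous r).

Lemma ltr0C (k : R) : (0 < k%:C) = (0 < k).
Proof. by rewrite -[0 in LHS]/(0%:C) ltcR. Qed.

Lemma two_pi_i_neq0 : 2 * pi%:C * 'i%C != 0 :> C.
Proof.
rewrite !mulf_neq0 ?pnatr_eq0 //; first by rewrite fmorph_eq0 gt_eqF ?pi_gt0.
by rewrite -normr_eq0 normci oner_eq0.
Qed.

Lemma circle_continuous_exprz (n : int) : cc (fun u => u ^ n).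
Proof.
have pow (m : nat) : cc (fun u => u ^+ m).
  elim: m => [|m IH]; first exact: circle_continuous_cst.
  have -> : (fun u : C => u ^+ m.+1) = (fun u => u * u ^+ m).
    by apply/funext => u; rewrite exprS.
  by apply: circle_continuousM; [exact: circle_continuous_id|].
case: n => m; first exact: pow.
rewrite NegzE; have -> : (fun u : C => u ^ (- m.+1%:Z)) = (fun u => (u ^+ m.+1)^-1).
  by apply/funext => u; rewrite -exprnN.
apply: circle_continuousV => // u hu; rewrite expf_neq0 // -normr_eq0 hu.
by rewrite fmorph_eq0 gt_eqF.
Qed.

Lemma circle_continuous_sum (I : eqType) (s : seq I) (F : I -> C -> C) :
  {in s, forall i, cc (F i)} -> cc (fun u => \sum_(i <- s) F i u).
Proof.
elim: s => [|i s IH] h.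
  have -> : (fun u => \sum_(i <- [::]) F i u) = (fun=> 0).
    by apply/funext => u; rewrite big_nil.
  exact: circle_continuous_cst.
have -> : (fun u => \sum_(j <- i :: s) F j u) = (fun u => F i u + \sum_(j <- s) F j u).
  by apply/funext => u; rewrite big_cons.
apply: circle_continuousD; first by apply: h; rewrite mem_head.
by apply: IH => j js; apply: h; rewrite in_cons js orbT.
Qed.

Lemma circle_continuous_poly (p : {poly C}) : cc (horner p).
Proof.
have -> : horner p = (fun u => \sum_(i < size p) p`_i * u ^ i%:Z).
  by apply/funext => u; rewrite horner_coef.
apply: circle_continuous_sum => i _; apply: circle_continuousM; first exact: circle_continuous_cst.
exact: circle_continuous_exprz.
Qed.

Lemma contour_ext (f g : C -> C) :
  (forall u, `|u| = r%:C -> f u = g u) -> contour f = contour g.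
Proof. by move=> h; rewrite /contour (eq_circle_integral r0' h). Qed.

Lemma contourD (f g : C -> C) : cc f -> cc g ->
  contour (fun u => f u + g u) = contour f + contour g.
Proof. by move=> cf cg; rewrite /contour circle_integralD // mulrDl. Qed.

Lemma contourZ (c : C) (f : C -> C) : cc f ->
  contour (fun u => c * f u) = c * contour f.
Proof. by move=> cf; rewrite /contour circle_integralZ // mulrA. Qed.

Lemma contour_sum (I : eqType) (s : seq I) (c : I -> C) (F : I -> C -> C) :
  {in s, forall i, cc (F i)} ->
  contour (fun u => \sum_(i <- s) c i * F i u) = \sum_(i <- s) c i * contour (F i).
Proof.
elim: s => [|i s IH] h.
  rewrite big_nil; transitivity (contour (fun=> 0 * 0)).
    by apply: contour_ext => u _; rewrite big_nil mul0r.
  by rewrite contourZ ?mul0r //; exact: circle_continuous_cst.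
have ci : cc (F i) by apply: h; rewrite mem_head.
have cs : {in s, forall j, cc (F j)} by move=> j js; apply: h; rewrite in_cons js orbT.
transitivity (contour (fun u => c i * F i u + \sum_(j <- s) c j * F j u)).
  by apply: contour_ext => u _; rewrite big_cons.
rewrite contourD.
- by rewrite contourZ // IH // big_cons.
- by apply: circle_continuousM => //; exact: circle_continuous_cst.
- apply: circle_continuous_sum => j js; apply: circle_continuousM; last exact: cs.
  exact: circle_continuous_cst.
Qed.

Lemma contour_exprz (n : int) : contour (fun u => u ^ n) = (n == -1)%:R.
Proof.
rewrite /contour circle_integral_exprz //; case: eqP => _; last by rewrite mul0r.
by rewrite divff // two_pi_i_neq0.
Qed.

Lemma norm_exprz (x : C) (n : int) : `|x ^ n| = `|x| ^ n.
Proof. by case: n => m; rewrite ?NegzE -?exprnP -?exprnN ?normfV normrX. Qed.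

Lemma contour_exprz_bound (f : C -> C) : cc f ->
  exists M : R, forall n : int, `|contour (fun u => u ^ n * f u)| <= (M * r ^ n)%:C.
Proof.
move=> cf; have [M hM] := circle_bounded cf.
have nE : `|2 * pi%:C * 'i%C : C| = (2 * pi)%:C.
  have -> : 2 * pi%:C = (2 * pi)%:C :> C by rewrite rmorphM rmorph_nat.
  by rewrite normrM normci mulr1 normcR ger0_norm // mulr_ge0 ?pi_ge0.
exists (2 * r * M) => n; rewrite /contour normf_div nE.
have pi2 : 0 < (2 * pi)%:C :> C by rewrite ltr0C mulr_gt0 ?pi_gt0.
rewrite ler_pdivrMr //.
have -> : (2 * r * M * r ^ n)%:C * (2 * pi)%:C = (2 * (r * (2 * pi)) * (r ^ n * M))%:C.
  by rewrite -rmorphM /=; congr (_%:C); ring.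
apply: circle_integral_bound => //.
  by apply: circle_continuousM => //; exact: circle_continuous_exprz.
move=> t tI; rewrite normrM norm_exprz on_circle // rmorphM /= fmorphXz.
by rewrite ler_wpM2l ?hM // exprz_ge0 // ler0c.
Qed.

(* Iterating the relation towards n = -oo makes the integral decay
   geometrically compared with its trivial bound. *)
Lemma contour_low_eq0 (f : C -> C) (v : C) (n0 : int) : cc f -> `|v| < r%:C ->
  (forall n : int, n < n0 -> contour (fun u => u ^ (n + 1) * f u) =
                             v * contour (fun u => u ^ n * f u)) ->
  contour (fun u => u ^ n0 * f u) = 0.
Proof.
move=> cf vr h; have [M hM] := contour_exprz_bound cf.
have [v' v'E] : exists v', `|v| = v'%:C by exists (complex.Re `|v|); rewrite normc_def.
have v'0 : 0 <= v' by rewrite -ler0c -v'E.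
apply: (@geometric_eq0 _ _ (M * r ^ n0) (v' / r)).
- by rewrite divr_ge0.
- by rewrite ltr_pdivrMr // mul1r -ltcR -v'E.
move=> k.
have -> : contour (fun u => u ^ n0 * f u) = v ^+ k * contour (fun u => u ^ (n0 - k%:Z) * f u).
  elim: k => [|k ->]; first by rewrite mul1r subr0.
  rewrite exprSr -mulrA -h; last by lia.
  by have -> : n0 - k.+1%:Z + 1 = n0 - k%:Z by lia.
have -> : M * r ^ n0 * (v' / r) ^+ k = v' ^+ k * (M * r ^ (n0 - k%:Z)).
  by rewrite expfzDr ?gt_eqF // -exprnN expr_div_n; ring.
rewrite normrM normrX v'E -rmorphXn [(_ * (M * _))%:C]rmorphM /=.
by rewrite ler_wpM2l ?hM // ler0c exprn_ge0.
Qed.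

(** Now the pole t lies outside: iterating towards +oo multiplies the integral by t, while the
    trivial bound grows only by r. *)
Lemma contour_high_eq0 (f : C -> C) (t : C) (n0 : int) : cc f -> r%:C < `|t| ->
  (forall n : int, n0 <= n -> contour (fun u => u ^ (n + 1) * f u) =
                             t * contour (fun u => u ^ n * f u)) ->
  contour (fun u => u ^ n0 * f u) = 0.
Proof.
move=> cf rt h; have [M hM] := contour_exprz_bound cf.
have [t' t'E] : exists t', `|t| = t'%:C by exists (complex.Re `|t|); rewrite normc_def.
have rt' : r < t' by rewrite -ltcR -t'E.
have t'0 : 0 < t' := lt_trans r0 rt'.
apply: (@geometric_eq0 _ _ (M * r ^ n0) (r / t')).
- by rewrite divr_ge0 // ltW.
- by rewrite ltr_pdivrMr // mul1r.
move=> k.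
have : contour (fun u => u ^ (n0 + k%:Z) * f u) = t ^+ k * contour (fun u => u ^ n0 * f u).
  elim: k => [|k IH]; first by rewrite mul1r addr0.
  rewrite exprS -mulrA -IH -h; last by lia.
  by have -> : n0 + k%:Z + 1 = n0 + k.+1%:Z by lia.
move=> /(congr1 Num.norm); rewrite [RHS]normrM normrX t'E => e.
have := hM (n0 + k%:Z); rewrite e => b.
have tk : 0 < t'%:C ^+ k by rewrite exprn_gt0 // ltr0C.
rewrite -(ler_pM2l tk); apply: (le_trans b).
have -> : M * r ^ (n0 + k%:Z) = t' ^+ k * (M * r ^ n0 * (r / t') ^+ k).
  rewrite expfzDr ?gt_eqF // expr_div_n -exprnP.
  have : t' ^+ k != 0 by rewrite expf_neq0 // gt_eqF.
  by move: (t' ^+ k) (r ^+ k) (r ^ n0) => x y w x0; field.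
by rewrite rmorphM rmorphXn.
Qed.

End Contour.

Lemma circle_continuous_eq (R : realType) (r : R) (f g : R[i] -> R[i]) : 0 < r ->
  (forall u, `|u| = r%:C -> g u = f u) -> circle_continuous r f ->
  circle_continuous r g.
Proof.
move=> r0 fg [f1 f2].
have e t : g (r%:C * cis t) = f (r%:C * cis t) by rewrite fg // on_circle // ltW.
by split; [apply: continuous_ext f1|apply: continuous_ext f2] => t; rewrite e.
Qed.

(** * Residue computation of the iterated integral *)

Section Resolvent.
Variable R : realType.
Local Notation C := R[i].
Variables (d : nat) (z : nat -> C).
Variables (P Q : nat -> nat -> {poly C}) (De : nat -> nat -> {poly {poly C}}).
Hypothesis fam : poly_family d z P Q De.

Definition den (p m : nat) (t x : C) : C := m%:R * t - m.-1%:R * x - z (p + m)%N.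

(* Up to factors in the remaining variables, W p m t x is the integral of the
   integrand over u_{p+1}, ..., u_{p+m-1} with x = u_p and t = 2 u_p - u_{p-1},
   divided by (2 pi i)^{m-1} (iterated_integral_W). *)
Variable W : nat -> nat -> C -> C -> C.
Hypothesis WE : forall p m t x, (0 < m)%N -> W p m t x =
  ((P p m).[x] + \sum_(1 <= i < m) z (p + i)%N ^+ 2 *
     (P (p + i)%N (m - i)%N).[z (p + i)%N] * W p i t x) / den p m t x.

Lemma W_1 p t x : W p 1%N t x = (t - z p.+1)^-1.
Proof.
case: fam => f1 _ _.
by rewrite WE // big_geq // f1 hornerC addr0 /den mul1r mul0r subr0 addn1 mul1r.
Qed.

Section OnCircle.
Variables (r : R) (p M : nat) (x : C).
Hypothesis r0 : 0 < r.
Hypothesis hz : forall i, (0 < i <= M)%N ->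
  `|i.-1%:R * x + z (p + i)%N| < (i%:R * r)%:C.
Let r0' : 0 <= r := ltW r0.
Local Notation cc := (circle_continuous r).
Local Notation contour := (contour r).

(** By [hz] the zero ((m - 1) x + z_{p+m}) / m of the denominator lies inside the circle, so [W] has
    no pole on or outside it. *)
Lemma den_neq0 m u : (0 < m <= M)%N -> r%:C <= `|u| -> den p m u x != 0.
Proof.
move=> hm hu; apply/eqP => /eqP; rewrite /den -addrA -opprD subr_eq0 => /eqP e.
have := hz hm; rewrite -e normrM normr_nat rmorphM rmorph_nat /= ltr_pM2l; last first.
  by rewrite ltr0n; lia.
by move=> /lt_geF; rewrite hu.
Qed.

Let v m : C := (m.-1%:R * x + z (p + m)%N) / m%:R.

Lemma denE m u : (0 < m)%N -> den p m u x = m%:R * (u - v m).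
Proof.
by move=> m0; rewrite /den /v; field; rewrite pnatr_eq0; lia.
Qed.

Lemma norm_v m : (0 < m <= M)%N -> `|v m| < r%:C.
Proof.
move=> hm; rewrite /v normf_div normr_nat ltr_pdivrMr; last by rewrite ltr0n; lia.
by have := hz hm; rewrite rmorphM rmorph_nat [m%:R * r%:C]mulrC.
Qed.

Let c m i : C := z (p + i)%N ^+ 2 * (P (p + i)%N (m - i)%N).[z (p + i)%N].

Lemma W_rec m u : (0 < m <= M)%N -> r%:C <= `|u| ->
  (u - v m) * W p m u x =
  m%:R^-1 * ((P p m).[x] + \sum_(1 <= i < m) c m i * W p i u x).
Proof.
move=> hm hu; have m0 : m%:R != 0 :> C by rewrite pnatr_eq0; lia.
have dn := den_neq0 hm hu.
have d0 : u - v m != 0.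
  by apply: contraNneq dn => e; rewrite denE ?e ?mulr0 //; lia.
rewrite WE; last by lia.
rewrite denE; last by lia.
by rewrite /c; field; rewrite d0 m0.
Qed.

Lemma cc_W m : (0 < m <= M)%N -> cc (fun u => W p m u x).
Proof.
elim/ltn_ind: m => m IH hm.
have -> : (fun u => W p m u x) = (fun u => ((P p m).[x] +
   \sum_(i <- index_iota 1 m) c m i * W p i u x) * (den p m u x)^-1).
  by apply/funext => u; rewrite WE //; lia.
apply: circle_continuousM.
  apply: circle_continuousD; first exact: circle_continuous_cst.
  apply: circle_continuous_sum => // i; rewrite mem_index_iota => hi.
  by apply: circle_continuousM; [exact: circle_continuous_cst|apply: IH; lia].
apply: circle_continuousV => //; last by move=> u hu; apply: den_neq0 => //; rewrite hu.
have -> : (fun u => den p m u x) = horner (m%:R *: 'X - (m.-1%:R * x + z (p + m)%N)%:P).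
  by apply/funext => u; rewrite /den !hornerE opprD addrA.
exact: circle_continuous_poly.
Qed.

Lemma cc_exprz_W n m : (0 < m <= M)%N -> cc (fun u => u ^ n * W p m u x).
Proof. by move=> hm; apply: circle_continuousM; [exact: circle_continuous_exprz|exact: cc_W]. Qed.

Lemma unorm_neq0 (u : C) : `|u| = r%:C -> u != 0.
Proof. by move=> hu; rewrite -normr_eq0 hu fmorph_eq0 gt_eqF. Qed.

(** [W_rec] integrated against u^n: a relation between consecutive moments of W, as the decay
    argument requires. *)
Lemma contour_W_step n m : (0 < m <= M)%N ->
  contour (fun u => u ^ (n + 1) * W p m u x) =
  v m * contour (fun u => u ^ n * W p m u x) + m%:R^-1 * ((P p m).[x] * (n == -1)%:R +
    \sum_(1 <= i < m) c m i * contour (fun u => u ^ n * W p i u x)).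
Proof.
move=> hm.
have cI : {in index_iota 1 m, forall i, cc (fun u => u ^ n * W p i u x)}.
  by move=> i; rewrite mem_index_iota => hi; apply: cc_exprz_W; lia.
transitivity (contour (fun u => v m * (u ^ n * W p m u x) + m%:R^-1 *
  ((P p m).[x] * u ^ n + \sum_(i <- index_iota 1 m) c m i * (u ^ n * W p i u x)))).
  apply: contour_ext => // u hu.
  have e := W_rec hm (u := u); rewrite hu in e; move: (e (lexx _)) => {}e.
  have -> : \sum_(i <- index_iota 1 m) c m i * (u ^ n * W p i u x) =
    u ^ n * \sum_(1 <= i < m) c m i * W p i u x.
    by rewrite mulr_sumr; apply: eq_bigr => i _; rewrite mulrCA.
  rewrite expfzDr ?unorm_neq0 // expr1z.
  have -> : m%:R^-1 * ((P p m).[x] * u ^ n + u ^ n * (\sum_(1 <= i < m) c m i * W p i u x)) =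
    u ^ n * (m%:R^-1 * ((P p m).[x] + \sum_(1 <= i < m) c m i * W p i u x)) by ring.
  by rewrite -e; ring.
have cs : cc (fun u => (P p m).[x] * u ^ n + \sum_(i <- index_iota 1 m) c m i * (u ^ n * W p i u x)).
  apply: circle_continuousD.
    by apply: circle_continuousM; [exact: circle_continuous_cst|exact: circle_continuous_exprz].
  apply: circle_continuous_sum => // i hi; apply: circle_continuousM; last exact: cI.
  exact: circle_continuous_cst.
rewrite contourD //; last first.
- by apply: circle_continuousM => //; exact: circle_continuous_cst.
- by apply: circle_continuousM; [exact: circle_continuous_cst|exact: cc_exprz_W].
rewrite contourZ ?contourZ //; last exact: cc_exprz_W.
congr (_ + _ * _); rewrite contourD.
- by rewrite contour_sum // contourZ ?contour_exprz //; exact: circle_continuous_exprz.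
- by apply: circle_continuousM; [exact: circle_continuous_cst|exact: circle_continuous_exprz].
- apply: circle_continuous_sum => // i hi; apply: circle_continuousM; last exact: cI.
  exact: circle_continuous_cst.
Qed.

(** All poles of W are inside and W is O(1/u) at infinity, so u^n W is O(u^-2) there. Formally,
    induction on m reduces the moment relation to the one of [contour_low_eq0], with ratio [v m]. *)
Lemma contour_W_low n m : (0 < m <= M)%N -> n < 0 ->
  contour (fun u => u ^ n * W p m u x) = 0.
Proof.
elim/ltn_ind: m n => m IH n hm n0.
apply: (@contour_low_eq0 _ _ r0 _ (v m)); [exact: cc_W|exact: norm_v|].
move=> k kn; rewrite contour_W_step // lt_eqF; last by lia.
rewrite mulr0 add0r big_nat big1 ?mulr0 ?addr0 // => i hi.
by rewrite IH ?mulr0 //; lia.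
Qed.

(** The coefficient of 1/u in the expansion of W at infinity. The moment relation at n = -1 gives
    it, since all the other moments occurring there have a negative exponent. *)
Lemma contour_W m : (0 < m <= M)%N ->
  contour (fun u => W p m u x) = (P p m).[x] / m%:R.
Proof.
move=> hm; have := contour_W_step (-1) hm.
rewrite (contour_W_low hm (n := -1)) // eqxx mulr1 mulr0 add0r big_nat big1 => [|i hi]; last first.
  by rewrite contour_W_low ?mulr0 //; lia.
rewrite addr0 mulrC => <-; apply: contour_ext => // u _.
by rewrite addNr expr0z mul1r.
Qed.

Lemma cc_subr_inv (t : C) : r%:C < `|t| -> cc (fun u => (t - u)^-1).
Proof.
move=> rt; apply: circle_continuousV => // [|u hu].
  have -> : (fun u => t - u) = horner (t%:P - 'X).
    by apply/funext => u; rewrite !hornerE.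
  exact: circle_continuous_poly.
by rewrite subr_eq0; apply: contraTneq rt => ->; rewrite hu ltxx.
Qed.

Lemma subr_circle_neq0 (t u : C) : r%:C < `|t| -> `|u| = r%:C -> t - u != 0.
Proof.
by move=> rt hu; rewrite subr_eq0; apply: contraTneq rt => ->; rewrite hu ltxx.
Qed.

Lemma contour_exprz_subr_inv (t : C) (n : int) : r%:C < `|t| -> 0 <= n ->
  contour (fun u => u ^ n * (t - u)^-1) = 0.
Proof.
move=> rt n0; apply: (@contour_high_eq0 _ _ r0 _ t) => //; first exact: cc_subr_inv.
move=> k nk.
have ck : cc (fun u => u ^ k * (t - u)^-1).
  by apply: circle_continuousM; [exact: circle_continuous_exprz|exact: cc_subr_inv].
transitivity (contour (fun u => t * (u ^ k * (t - u)^-1) + (-1) * u ^ k)).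
  apply: contour_ext => // u hu.
  rewrite expfzDr ?unorm_neq0 // expr1z; field; exact: subr_circle_neq0.
rewrite contourD //.
- rewrite contourZ // contourZ ?contour_exprz //; last exact: circle_continuous_exprz.
  by rewrite gt_eqF ?mulr0 ?addr0 //; lia.
- by apply: circle_continuousM; [exact: circle_continuous_cst|].
- by apply: circle_continuousM; [exact: circle_continuous_cst|exact: circle_continuous_exprz].
Qed.

Lemma contour_poly (p0 : {poly C}) : contour (horner p0) = 0.
Proof.
transitivity (contour (fun u => \sum_(i <- index_iota 0 (size p0)) p0`_i * u ^ i%:Z)).
  by apply: contour_ext => // u _; rewrite horner_coef big_mkord.
rewrite contour_sum // => [|i _]; last exact: circle_continuous_exprz.
by rewrite big1 // => i _; rewrite contour_exprz // mulr0.
Qed.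

Lemma contour_poly_subr_inv (t : C) (p0 : {poly C}) : r%:C < `|t| ->
  contour (fun u => p0.[u] * (t - u)^-1) = 0.
Proof.
move=> rt; transitivity (contour (fun u => \sum_(i <- index_iota 0 (size p0))
    p0`_i * (u ^ i%:Z * (t - u)^-1))).
  apply: contour_ext => // u _; rewrite horner_coef big_mkord mulr_suml.
  by apply: eq_bigr => i _; rewrite mulrA.
rewrite contour_sum // => [|i _].
  by rewrite big1 // => i _; rewrite contour_exprz_subr_inv ?mulr0.
by apply: circle_continuousM; [exact: circle_continuous_exprz|exact: cc_subr_inv].
Qed.

(** Cauchy's formula for the exterior of the circle, where t is the single pole and the integrand
    decays like u^-2. Multiplying by t - [v m] reduces it to smaller m through [W_rec]. *)
Lemma contour_W_subr_inv m t : (0 < m <= M)%N -> r%:C < `|t| ->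
  contour (fun u => W p m u x * (t - u)^-1) = W p m t x.
Proof.
move=> + rt; elim/ltn_ind: m => m IH hm.
have m0 : m%:R != 0 :> C by rewrite pnatr_eq0; lia.
have cW i : (0 < i <= M)%N -> cc (fun u => W p i u x * (t - u)^-1).
  by move=> hi; apply: circle_continuousM; [exact: cc_W|exact: cc_subr_inv].
have tv : t - v m != 0.
  rewrite subr_eq0; apply/eqP => e; have := norm_v hm.
  by rewrite -e => /(lt_trans rt); rewrite ltxx.
apply: (mulfI tv); rewrite W_rec ?(ltW rt) //.
have cI : {in index_iota 1 m, forall i, cc (fun u => W p i u x * (t - u)^-1)}.
  by move=> i; rewrite mem_index_iota => hi; apply: cW; lia.
rewrite -contourZ; last exact: cW.
transitivity (contour (fun u => W p m u x + m%:R^-1 * ((P p m).[x] * (t - u)^-1 +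
   \sum_(i <- index_iota 1 m) c m i * (W p i u x * (t - u)^-1)))).
  apply: contour_ext => // u hu.
  have e := W_rec hm (u := u); rewrite hu in e; move: (e (lexx _)) => {}e.
  have -> : \sum_(i <- index_iota 1 m) c m i * (W p i u x * (t - u)^-1) =
    (\sum_(1 <= i < m) c m i * W p i u x) * (t - u)^-1.
    by rewrite mulr_suml; apply: eq_bigr => i _; rewrite mulrA.
  rewrite -mulrDl [m%:R^-1 * _]mulrA -e.
  by field; exact: subr_circle_neq0.
have cs : cc (fun u => \sum_(i <- index_iota 1 m) c m i * (W p i u x * (t - u)^-1)).
  apply: circle_continuous_sum => // i hi; apply: circle_continuousM; last exact: cI.
  exact: circle_continuous_cst.
have ct : cc (fun u => (P p m).[x] * (t - u)^-1).
  by apply: circle_continuousM; [exact: circle_continuous_cst|exact: cc_subr_inv].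
rewrite contourD //; last first.
- apply: circle_continuousM; first exact: circle_continuous_cst.
  exact: circle_continuousD.
- exact: cc_W.
rewrite contourZ; last exact: circle_continuousD.
rewrite contourD // contour_sum // contourZ; last exact: cc_subr_inv.
have -> : contour (fun u => (t - u)^-1) = 0.
  rewrite -(@contour_exprz_subr_inv t 0) //; apply: contour_ext => // u _.
  by rewrite mul1r.
rewrite contour_W // mulr0 add0r mulrDr [m%:R^-1 * _]mulrC; congr (_ + _ * _).
rewrite !big_nat; apply: eq_bigr => i hi; congr (_ * _); apply: IH; lia.
Qed.

End OnCircle.

Section Step.
Variables (r : R) (p M : nat) (x : C).
Hypothesis r0 : 0 < r.
Hypothesis hz : forall i, (0 < i <= M)%N ->
  `|i.-1%:R * x + z (p + i)%N| < (i%:R * r)%:C.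
Hypothesis Md : (M <= d)%N.

(** The heart of the residue computation. At t = 2u - x both resolvents obey recursions with the
    same denominators, Q splits off the pole u = z_{p+1}, and the difference is De, a polynomial in
    u, which a contour integral does not see. *)
Lemma W_shift m (u : C) : (1 < m <= M)%N -> r%:C <= `|u| ->
  u ^+ 2 / (u - z p.+1) * W p.+1 m.-1 (2 * u - x) u =
  W p m u x + (De p m).[u%:P].[x].
Proof.
elim/ltn_ind: m => m IH hm hu.
have hm' : (1 < m <= d)%N by lia.
have m0 : m%:R != 0 :> C by rewrite pnatr_eq0; lia.
have uz : u - z p.+1 != 0.
  have := @den_neq0 r p M x r0 hz 1%N u; rewrite /den mul1r mul0r subr0 addn1.
  by apply=> //; lia.
have dn := @den_neq0 r p M x r0 hz m u ltac:(lia) hu.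
(* Because (i - 1) (2u - x) - (i - 2) u = i u - (i - 1) x. *)
have denS i : (1 < i)%N -> den p.+1 i.-1 (2 * u - x) u = den p i u x.
  case: i => [|[|i]] // _; rewrite /den /= addSnnS.
  by rewrite -!natr1; ring.
have Deq : den p m u x * (De p m).[u%:P].[x] = (Q p m).[u] - (P p m).[x] +
    \sum_(2 <= i < m) z (p + i)%N ^+ 2 * (P (p + i)%N (m - i)%N).[z (p + i)%N] *
      (De p i).[u%:P].[x].
  exact: (poly_family_hornerD fam).
have Qeq : (u - z p.+1) * (Q p m).[u] =
    u ^+ 2 * (P p.+1 m.-1).[u] - z p.+1 ^+ 2 * (P p.+1 m.-1).[z p.+1].
  exact: (poly_family_hornerQ fam).
apply: (mulfI dn); rewrite mulrDr Deq.
rewrite WE; last by lia.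
rewrite WE; last by lia.
rewrite denS; last by lia.
rewrite [in X in _ = X + _]mulrC divfK //.
rewrite [in RHS]big_ltn; last by lia.
rewrite W_1 addn1.
have -> : den p m u x * (u ^+ 2 / (u - z p.+1) * (((P p.+1 m.-1).[u] +
   \sum_(1 <= i < m.-1) z (p.+1 + i)%N ^+ 2 * (P (p.+1 + i)%N (m.-1 - i)%N).[z (p.+1 + i)%N] *
     W p.+1 i (2 * u - x) u) / den p m u x)) =
   u ^+ 2 * (P p.+1 m.-1).[u] / (u - z p.+1) +
   \sum_(2 <= i < m) z (p + i)%N ^+ 2 * (P (p + i)%N (m - i)%N).[z (p + i)%N] *
      (u ^+ 2 / (u - z p.+1) * W p.+1 i.-1 (2 * u - x) u).
  rewrite mulrCA [den _ _ _ _ * _]mulrC divfK // mulrDr [u ^+ 2 / _ * _]mulrAC.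
  congr (_ + _); rewrite mulr_sumr.
  rewrite [RHS]big_add1; apply: eq_big_nat => i hi.
  have -> : (m.-1 - i = m - i.+1)%N by lia.
  by rewrite -addSnnS; ring.
have -> : \sum_(2 <= i < m) z (p + i)%N ^+ 2 * (P (p + i)%N (m - i)%N).[z (p + i)%N] *
      (u ^+ 2 / (u - z p.+1) * W p.+1 i.-1 (2 * u - x) u) =
  \sum_(2 <= i < m) z (p + i)%N ^+ 2 * (P (p + i)%N (m - i)%N).[z (p + i)%N] * W p i u x +
  \sum_(2 <= i < m) z (p + i)%N ^+ 2 * (P (p + i)%N (m - i)%N).[z (p + i)%N] *
      (De p i).[u%:P].[x].
  rewrite -big_split; apply: eq_big_nat => i hi.
  by rewrite IH ?mulrDr //; lia.
have -> : u ^+ 2 * (P p.+1 m.-1).[u] / (u - z p.+1) = (Q p m).[u] +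
   z p.+1 ^+ 2 * (P p.+1 m.-1).[z p.+1] / (u - z p.+1).
  apply: (mulIf uz); rewrite mulrDl !divfK // [(Q p m).[u] * _]mulrC Qeq; ring.
by rewrite subn1; ring.
Qed.

Lemma horner2_poly (q : {poly {poly C}}) :
  exists q', forall u, q.[u%:P].[x] = q'.[u].
Proof.
exists (map_poly (horner_eval x) q) => u.
have -> : u = horner_eval x u%:P by rewrite /horner_eval hornerC.
by rewrite horner_map /horner_eval hornerC.
Qed.

Lemma cc_step m : (1 < m <= M)%N ->
  circle_continuous r (fun u => u ^+ 2 / (u - z p.+1) * W p.+1 m.-1 (2 * u - x) u).
Proof.
move=> hm; have [q qE] := horner2_poly (De p m).
have hm' : (0 < m <= M)%N by lia.
apply: (@circle_continuous_eq _ r (fun u => W p m u x + q.[u])) => //.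
  by move=> u hu; rewrite W_shift ?qE // hu.
by apply: circle_continuousD; [exact: (cc_W r0 hz hm')|exact: circle_continuous_poly].
Qed.

(** Meant for the outermost variable u_1: no link leads further out, so the coefficient of 1/u
    survives alone. *)
Lemma contour_step m : (1 < m <= M)%N ->
  contour r (fun u => u ^+ 2 / (u - z p.+1) * W p.+1 m.-1 (2 * u - x) u) =
  (P p m).[x] / m%:R.
Proof.
move=> hm; have [q qE] := horner2_poly (De p m).
have hm' : (0 < m <= M)%N by lia.
rewrite -(contour_W r0 hz hm') -[RHS]addr0 -(contour_poly r0 q) -contourD //.
- by apply: contour_ext => // u hu; rewrite W_shift ?qE // hu.
- exact: (cc_W r0 hz hm').
- exact: circle_continuous_poly.
Qed.

(** Meant for the inner variables: the link 1 / (2 u_{j-1} - u_{j-2} - u_j) is 1 / (t - u) with t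
    outside the circle. *)
Lemma contour_step_subr_inv m t : (1 < m <= M)%N -> r%:C < `|t| ->
  contour r (fun u => u ^+ 2 / (u - z p.+1) * W p.+1 m.-1 (2 * u - x) u * (t - u)^-1) =
  W p m t x.
Proof.
move=> hm rt; have [q qE] := horner2_poly (De p m).
have hm' : (0 < m <= M)%N by lia.
rewrite -(contour_W_subr_inv r0 hz hm' rt) -[RHS]addr0.
rewrite -(contour_poly_subr_inv r0 q rt) -contourD //.
- by apply: contour_ext => // u hu; rewrite W_shift ?qE ?mulrDl // hu.
- by apply: circle_continuousM; [exact: (cc_W r0 hz hm')|exact: cc_subr_inv].
- by apply: circle_continuousM; [exact: circle_continuous_poly|exact: cc_subr_inv].
Qed.

End Step.

Section Iterated.
Variable rad : nat -> R.
Hypothesis rad0 : (rad 0%N)%:C = `|z 0%N|.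
Hypothesis radd : (rad d)%:C = `|z d|.
Hypothesis radP : forall j, (0 < j < d)%N ->
  `|z j| < (rad j)%:C /\ rad j.-1 + rad j.+1 < 2 * rad j.

Lemma rad_gt0 j : (0 < j < d)%N -> 0 < rad j.
Proof.
by move=> /radP[h _]; rewrite -ltr0C; apply: le_lt_trans h.
Qed.

Lemma rad_concave p i : (0 < i)%N -> (p + i <= d)%N ->
  rad (p + i)%N - rad (p + i).-1 <= rad p.+1 - rad p.
Proof.
case: i => // i _; elim: i => [|i IH] h; first by rewrite addn1.
apply: le_trans (IH _); last by lia.
have [|_] := @radP (p + i.+1); first by lia.
by rewrite !addnS /=; lra.
Qed.

(** The condition on the radii is concavity in the index. Adding up increments gives (i - 1) R_p +
    R_{p+i} < i R_{p+1}, which puts every pole of W inside the circle of radius R_{p+1}. *)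
Lemma block_bound p x i : (p.+1 < d)%N -> `|x| = (rad p)%:C ->
  (0 < i)%N -> (p + i <= d)%N ->
  `|i.-1%:R * x + z (p + i)%N| < (i%:R * rad p.+1)%:C.
Proof.
move=> pd xr i0 id.
have [i1|i1] := leqP i 1.
  have -> : i = 1%N by lia.
  by rewrite mul0r add0r addn1 mul1r; case: (@radP p.+1) => //; lia.
apply: (le_lt_trans (ler_normD _ _)); rewrite normrM normr_nat xr.
have zr : `|z (p + i)%N| <= (rad (p + i))%:C.
  have [e|e] := eqVneq (p + i)%N d; first by rewrite e radd.
  by apply: ltW; case: (@radP (p + i)) => //; lia.
apply: (le_lt_trans (lerD (lexx _) zr)).
rewrite -(rmorph_nat (real_complex R)) -rmorphM -rmorphD ltcR /=.
have [n iE] : exists n, i = n.+2 by exists i.-2; lia.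
move: (id); rewrite iE.
elim: n {i i0 id i1 zr iE} => [|n IH] h.
  have [|_] := @radP p.+1; first by lia.
  by rewrite addn2 /= mul1r; lra.
have e1 := IH ltac:(lia); have e2 := @rad_concave p n.+3 isT h.
rewrite /= !addnS /= in e1 e2 *; rewrite -!natr1 in e1 *.
nra.
Qed.

Let f (u : nat -> C) : C := \prod_(1 <= j < d)
         (u j ^+ 2 / ((2 * u j - u j.-1 - u j.+1) * (u j - z j))).

Lemma circle_integral_contour r (g : C -> C) :
  circle_integral r g = 2 * pi%:C * 'i%C * contour r g.
Proof. by rewrite /contour mulrC divfK // two_pi_i_neq0. Qed.

(** The induction peels off the outermost remaining integral: the inner ones are already gathered in
    a W, and [contour_step_subr_inv] absorbs one more variable into it. *)
Lemma iterated_integral_W n j (u : nat -> C) : (1 < j)%N -> (j + n = d)%N ->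
  (forall i, (i < j)%N -> `|u i| = (rad i)%:C) -> u d = z d ->
  iterated_integral rad j n f u = (2 * pi%:C * 'i%C) ^+ n *
    (\prod_(1 <= i < j) (u i ^+ 2 / (u i - z i)) *
     \prod_(1 <= i < j.-1) (2 * u i - u i.-1 - u i.+1)^-1) *
    W j.-1 n.+1 (2 * u j.-1 - u j.-2) (u j.-1).
Proof.
elim: n j u => [|n IH] j u j1 jd hu ud.
  rewrite addn0 in jd; rewrite /= /f mul1r jd.
  (* The last link 1 / (2 u_{d-1} - u_{d-2} - u_d) is W at length 1, because u_d = z_d. *)
  rewrite W_1.
  have [k dE] : exists k, d = k.+2 by exists d.-2; lia.
  rewrite dE /= -/(index_iota _ _) -mulrA.
  have -> : 2 * u k.+1 - u k - z k.+2 = 2 * u k.+1 - u k.+1.-1 - u k.+2.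
    by rewrite -dE -ud dE.
  rewrite -big_nat_recr //= -big_split; apply: eq_bigr => i _ /=.
  by rewrite invfM [_^-1 * (u i - z i)^-1]mulrC mulrA.
have jd' : (j < d)%N by lia.
have [k jE] : exists k, j = k.+2 by exists j.-2; lia.
rewrite /= circle_integral_contour exprS.
set A := \prod_(1 <= i < j) _; set B := \prod_(1 <= i < j.-1) _.
pose x := u j.-1; pose t := 2 * u j.-1 - u j.-2.
have ux : `|x| = (rad j.-1)%:C by apply: hu; lia.
have hj1 : (j.-1.+1 < d)%N by lia.
(* The absolute value of 2 u_{j-1} - u_{j-2} is at least 2 R_{j-1} - R_{j-2}, which exceeds R_j. *)
have rt : (rad j.-1.+1)%:C < `|t|.
  have [|_ h] := @radP j.-1; first by lia.
  apply: lt_le_trans (lerB_dist _ _).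
  rewrite normrM normr_nat ux hu; last by lia.
  by rewrite -(rmorph_nat (real_complex R)) -rmorphM -rmorphB ltcR /= ltrBrDl.
have bb i : (0 < i <= n.+2)%N -> `|i.-1%:R * x + z (j.-1 + i)%N| < (i%:R * rad j.-1.+1)%:C.
  by move=> hi; apply: block_bound => //; lia.
have r0 : 0 < rad j.-1.+1 by apply: rad_gt0; lia.
have nd : (n.+2 <= d)%N by lia.
have hn : (1 < n.+2 <= n.+2)%N by lia.
have cW := cc_step r0 bb nd hn.
have := contour_step_subr_inv r0 bb nd hn rt.
have jj : (j.-1.+1 = j)%N by lia.
rewrite jj in r0 rt cW * => <-.
have cWt := circle_continuousM cW (cc_subr_inv r0 rt).
set T := 2 * pi%:C * 'i%C in IH *.
rewrite -[T * T ^+ n * _]mulrA -[RHS]mulrA -[in RHS]contourZ //; congr (T * _).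
apply: contour_ext => // w hw.
rewrite (IH j.+1) //=; last 4 first.
- by lia.
- by lia.
- move=> i ij; case: eqP => [->|ne] //; apply: hu; lia.
- by case: eqP => // e; lia.
have e i : (i < j)%N -> (if i == j then w else u i) = u i.
  by move=> ij; case: eqP => // ie; lia.
rewrite eqxx -[in RHS]mulrA big_nat_recr /=; last by lia.
have -> : \prod_(1 <= i < j) ((if i == j then w else u i) ^+ 2 / ((if i == j then w else u i) - z i)) = A.
  by apply: eq_big_nat => i hi; rewrite e //; lia.
rewrite eqxx e; last by lia.
have -> : \prod_(1 <= i < j) (2 * (if i == j then w else u i) -
     (if i.-1 == j then w else u i.-1) - (if i.+1 == j then w else u i.+1))^-1 =
  B * (t - w)^-1.
  rewrite -[in LHS]jj big_nat_recr /=; last by lia.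
  congr (_ * _).
    by apply: eq_big_nat => i hi; rewrite jj !e //; lia.
  by rewrite jj eqxx !e //; lia.
by rewrite -/x; ring.
Qed.

(** The last integration, over u_1, leaves P / d; the factor d in the definition of [Poly_d]
    compensates the denominator. *)
Lemma iterated_integral_family : (0 < d)%N ->
  d%:R / (2 * pi%:C * 'i%C) ^+ d.-1 * iterated_integral rad 1 d.-1 f z =
  (P 0%N d).[z 0%N].
Proof.
case: fam => f1 _ _ d0.
have [d1|d1] := leqP d 1.
  have -> : d = 1%N by lia.
  by rewrite f1 hornerC /= divr1 mul1r /f big_geq.
have dn : d%:R != 0 :> C by rewrite pnatr_eq0; lia.
have [n dE] : exists n, d = n.+2 by exists d.-2; lia.
have bb i : (0 < i <= d)%N -> `|i.-1%:R * z 0%N + z (0 + i)%N| < (i%:R * rad 1)%:C.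
  by move=> hi; apply: block_bound => //; lia.
have r0 : 0 < rad 1 by apply: rad_gt0; lia.
have hd : (1 < d <= d)%N by lia.
have := contour_step r0 bb (leqnn d) hd.
have cW := cc_step r0 bb (leqnn d) hd.
move=> /(congr1 (fun y => d%:R * y)); rewrite [RHS]mulrC divfK // => <-.
rewrite {2 3}dE /= circle_integral_contour -mulrA; congr (_ * _).
have T0 : 2 * pi%:C * 'i%C != 0 :> C := two_pi_i_neq0 _.
have -> : contour (rad 1) (fun w => iterated_integral rad 2 n f [eta z with 1%N |-> w]) =
   (2 * pi%:C * 'i%C) ^+ n *
   contour (rad 1) (fun u => u ^+ 2 / (u - z 1%N) * W 1 d.-1 (2 * u - z 0%N) u).
  rewrite -contourZ //; apply: contour_ext => // w hw.
  rewrite (iterated_integral_W (j := 2)) //=.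
  - by rewrite big_nat1 big_geq // eqxx mulr1 dE -mulrA.
  - by case=> [_|[_|//]] /=; rewrite ?rad0.
  - by case: eqP => // e; lia.
set T := 2 * pi%:C * 'i%C in T0 *.
by rewrite exprS; field; rewrite T0 expf_neq0.
Qed.

End Iterated.

End Resolvent.

(** * Polynomials determined by their values, and homogeneity of the recursion *)

Lemma poly_horner_nat_eq0 (K : numDomainType) (p : {poly K}) :
  (forall n : nat, p.[n%:R] = 0) -> p = 0.
Proof.
move=> h; apply/eqP; apply: contraT => p0.
have := @max_poly_roots _ p [seq i%:R | i <- iota 0 (size p)] p0 _ _.
rewrite size_map size_iota ltnn => -> //.
  by apply/allP => _ /mapP[i _ ->]; rewrite /root h.
rewrite map_inj_uniq ?iota_uniq // => i j /eqP.
by rewrite eqr_nat => /eqP.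
Qed.

Lemma radix_inj (B n : nat) (f g : nat -> nat) :
  (forall i, (i < n)%N -> (f i < B)%N /\ (g i < B)%N) ->
  (\sum_(i < n) f i * B ^ i = \sum_(i < n) g i * B ^ i)%N ->
  forall i, (i < n)%N -> f i = g i.
Proof.
elim: n f g => // n IH f g fg e i.
have [f0 g0] := fg 0%N isT.
have B0 : (0 < B)%N by apply: leq_ltn_trans f0.
have shift (h : nat -> nat) : (\sum_(i < n.+1) h i * B ^ i = (\sum_(i < n) h i.+1 * B ^ i) * B + h 0)%N.
  rewrite big_ord_recl expn0 muln1 addnC; congr (_ + _)%N.
  rewrite big_distrl; apply: eq_bigr => j _ /=.
  by rewrite /bump /= add1n expnSr mulnA.
rewrite !shift in e.
have e0 : f 0%N = g 0%N.
  by have := congr1 (modn^~ B) e; rewrite !modnMDl !modn_small.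
case: i => [//|i] iN; apply: (IH (fun i => f i.+1) (fun i => g i.+1)) => //.
  by move=> j jn; apply: fg.
by move/eqP: e; rewrite e0 eqn_add2r eqn_pmul2r // => /eqP.
Qed.

(** [is_Poly_d] prescribes values at complex points only; this turns agreement there into equality
    of rational polynomials. *)
Lemma mpoly_meval_inj (K : numFieldType) (n : nat) (p q : mpoly n rat) :
  (forall v : nat -> K, meval (fun i : 'I_n => v i) (map_mpoly ratr p) =
                        meval (fun i : 'I_n => v i) (map_mpoly ratr q)) ->
  p = q.
Proof.
move=> h; apply/eqP; rewrite -subr_eq0; apply/eqP.
set r := p - q.
have {}h (v : nat -> K) : meval (fun i : 'I_n => v i) (map_mpoly ratr r : mpoly n K) = 0.
  by rewrite /r !rmorphB /= h subrr.
(* Kronecker substitution: evaluating at the x^(B^i), where B exceeds all the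
   exponents, separates the monomials. *)
pose B := (\sum_(m <- msupp r) \sum_(i < n) m i).+1.
have mB m i : m \in msupp r -> (m i < B)%N.
  move=> ms; rewrite ltnS (big_rem m) //= (bigD1 i) //= -!addnA; lia.
pose e (m : multinom n) := (\sum_(i < n) m i * B ^ i)%N.
have e_inj : {in msupp r &, injective e}.
  move=> m m' ms ms' em; apply/mnmP => i.
  pose f (m : multinom n) (i : nat) := if insub i is Some j then m j else 0%N.
  have fE m0 (j : 'I_n) : f m0 j = m0 j by rewrite /f valK.
  rewrite -!fE; apply: (@radix_inj B n (f m) (f m')) => //.
    by move=> j jn; rewrite -[j]/(val (Ordinal jn)) !fE; split; apply: mB.
  by under eq_bigr do rewrite fE; under [RHS]eq_bigr do rewrite fE.
pose Z := \sum_(m <- msupp r) (ratr (mcoeff m r) : K) *: 'X^(e m).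
have Z0 : Z = 0.
  apply: poly_horner_nat_eq0 => x.
  rewrite -[RHS](h (fun i => x%:R ^+ (B ^ i)%N)) mevalE.
  rewrite (perm_big _ (msupp_map_mpoly _ (fmorph_inj _))) /=.
  rewrite horner_sum; apply: eq_bigr => m _.
  rewrite hornerZ hornerXn mcoeff_map_mpoly; congr (_ * _).
  rewrite /e expr_sum; apply: eq_bigr => i _.
  by rewrite mulnC exprM.
apply/mpolyP => m; rewrite mcoeff0; apply/eqP; apply: contraT => m0.
have ms : m \in msupp r by rewrite mcoeff_msupp.
have := congr1 (fun s : {poly K} => s`_(e m)) Z0.
rewrite coef0 /Z coef_sum (big_rem m) //= coefZ coefXn eqxx mulr1 big_seq big1.
  by rewrite addr0 => /eqP; rewrite fmorph_eq0 (negPf m0).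
move=> m' m's; rewrite coefZ coefXn.
have uq := msupp_uniq r.
case: eqP => [ee|]; last by rewrite mulr0.
have mm : m = m' by apply: e_inj => //; exact: mem_rem m's.
by move: m's; rewrite -mm mem_rem_uniq // inE eqxx.
Qed.

(* G n a reads: a is homogeneous of degree n. *)
Definition grading (A : comNzRingType) (G : nat -> A -> Prop) : Prop :=
  [/\ forall n, G n 0, forall n a b, G n a -> G n b -> G n (a - b),
      forall n m a b, G n a -> G m b -> G (n + m)%N (a * b) & G 0%N 1].

(** Total degree, with 'X of weight 1. Applied twice it grades the polynomials in t and x, as needed
    for De. *)
Definition poly_grading (A : comNzRingType) (G : nat -> A -> Prop) (n : nat)
    (p : {poly A}) : Prop :=
  forall e, if (e <= n)%N then G (n - e)%N p`_e else p`_e = 0.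

Section Grading.
Variables (A : comNzRingType) (G : nat -> A -> Prop).
Hypothesis gG : grading G.

Lemma gradingN n a : G n a -> G n (- a).
Proof. by case: gG => g0 gB _ _ ga; rewrite -sub0r; apply: gB. Qed.

Lemma gradingD n a b : G n a -> G n b -> G n (a + b).
Proof.
by move=> ga gb; rewrite -[b]opprK; case: gG => _ gB _ _; apply/gB/gradingN.
Qed.

Lemma grading_sum (I : eqType) n (s : seq I) (F : I -> A) :
  {in s, forall i, G n (F i)} -> G n (\sum_(i <- s) F i).
Proof.
move=> h; rewrite big_seq; apply: (big_ind (G n)) => //; last exact: gradingD.
by case: gG.
Qed.

Lemma gradingX n k a : G n a -> G (n * k)%N (a ^+ k).
Proof.
case: gG => _ _ gM g1 ga; elim: k => [|k IH]; first by rewrite muln0.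
by rewrite exprS mulnS; apply: gM.
Qed.

Lemma grading_nat k : G 0%N k%:R.
Proof.
elim: k => [|k IH]; first by case: gG.
by rewrite -natr1; apply: gradingD => //; case: gG.
Qed.

Lemma poly_gradingP : grading (poly_grading G).
Proof.
case: gG => g0 gB gM g1; split.
- by move=> n e; rewrite coef0; case: ifP.
- move=> n a b ga gb e; rewrite coefB; have := ga e; have := gb e.
  by case: ifP => _; [move=> h1 h2; apply: gB|move=> -> ->; rewrite subrr].
- move=> n m a b ga gb e; rewrite coefM.
  case: ifP => he.
    apply: grading_sum => i _; have := ga i; have := gb (e - i)%N.
    case: ifP => hi; case: ifP => hj h1 h2; rewrite ?h1 ?h2 ?mul0r ?mulr0 //.
    have il := ltn_ord i.
    by have -> : (n + m - e = (n - i) + (m - (e - i)))%N; [lia|apply: gM].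
  rewrite big1 // => i _; have := ga i; have := gb (e - i)%N.
  case: ifP => hi; case: ifP => hj h1 h2; rewrite ?h1 ?h2 ?mul0r ?mulr0 //.
  by move: (ltn_ord i); lia.
- by move=> e; rewrite coef1; case: e.
Qed.

Lemma poly_gradingC n a : G n a -> poly_grading G n a%:P.
Proof.
move=> ga e; rewrite coefC; case: e => [|e]; first by rewrite subn0.
by case: ifP => _ //; case: gG.
Qed.

Lemma poly_grading_polyX : poly_grading G 1 'X.
Proof.
move=> [|[|e]]; rewrite coefX //=; by case: gG.
Qed.

Lemma grading_horner n p a : poly_grading G n p -> G 1%N a -> G n p.[a].
Proof.
move=> gp ga; rewrite horner_coef.
have sp : (size p <= n.+1)%N.
  by apply/leq_sizeP => e he; have := gp e; rewrite leqNgt he.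
apply: grading_sum => i _; have := gp i; case: ifP => hi gi.
  have -> : n = (n - i + 1 * i)%N by lia.
  by case: gG => _ _ gM _; apply: gM => //; apply: gradingX.
by rewrite gi mul0r; case: gG.
Qed.

(** The coefficients of the quotient are recovered downwards: p_e is the coefficient e + 1 of ('X -
    a) p, plus a p_{e+1}. *)
Lemma poly_grading_div n (p : {poly A}) a : G 1%N a ->
  poly_grading G n.+1 (('X - a%:P) * p) -> poly_grading G n p.
Proof.
move=> ga gp.
have rec e : p`_e = (('X - a%:P) * p)`_e.+1 + a * p`_e.+1.
  by rewrite mulrBl coefB coefXM coefCM /= subrK.
suff h k e : (size p - e <= k)%N -> if (e <= n)%N then G (n - e)%N p`_e else p`_e = 0.
  by move=> e; apply: (h (size p - e)%N).
case: gG => g0 gB gM g1.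
elim: k e => [|k IH] e he.
  have -> : p`_e = 0 by rewrite nth_default // -subn_eq0 -leqn0.
  by case: ifP.
have [se|se] := leqP (size p) e.
  have -> : p`_e = 0 by rewrite nth_default.
  by case: ifP.
have he' : (size p - e.+1 <= k)%N by rewrite subnS; case: (size p - e)%N he.
have := IH e.+1 he'; rewrite (rec e); have := gp e.+1.
have -> : (e.+1 <= n.+1)%N = (e <= n)%N by lia.
case: ifP => [en|en ->]; last first.
  by case: ifP => [en'|_ ->]; [lia|rewrite mulr0 addr0].
rewrite subSS => g; case: ifP => [en' h|en' ->]; last by rewrite mulr0 addr0.
apply: gradingD => //.
by have -> : (n - e = 1 + (n - e.+1))%N; [lia|apply: gM].
Qed.

Lemma poly_grading_map n p : poly_grading G n p ->
  poly_grading (poly_grading G) n (map_poly polyC p).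
Proof.
move=> gp e; rewrite coef_map /=; have := gp e; case: ifP => [_ h|_ -> //].
exact: poly_gradingC.
Qed.
End Grading.

(** The relations force P to be [S] at the degree-one polynomial [mid], and De to be a quotient by
    'X - [mid], so the degrees m - 1 and m - 2 propagate together; this holds for any solution,
    however it was obtained. *)
Lemma poly_family_graded (A : comNzRingType) (G : nat -> A -> Prop) inv d z P Q De :
  (forall m, (0 < m)%N -> m%:R * inv m = 1 :> A) ->
  grading G -> (forall m, G 0%N (inv m)) -> (forall j, G 1%N (z j)) ->
  poly_family d z P Q De ->
  forall m p, (0 < m <= d)%N -> poly_grading G m.-1 (P p m).
Proof.
move=> invP gG ginv gz [f1 f2 f3].
have gP := poly_gradingP gG; have gPP := poly_gradingP gP.
suff h m : forall p, (0 < m <= d)%N -> poly_grading G m.-1 (P p m) /\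
    ((1 < m)%N -> poly_grading (poly_grading G) m.-2 (De p m)).
  by move=> m p hm; have [] := h m p hm.
elim/ltn_ind: m => m IH p hm.
have [m1|m1] := leqP m 1.
  have -> : m = 1%N by lia.
  by rewrite f1; split=> //; case: gP.
have hm2 : (1 < m <= d)%N by lia.
have gQ : poly_grading G m.-1 (Q p m).
  have e1 : (m.-1.+1 = 2 + m.-2)%N by lia.
  have g2 : poly_grading G m.-2 (P p.+1 m.-1) by have [] := IH m.-1 ltac:(lia) p.+1 ltac:(lia).
  apply: (poly_grading_div gG (gz p.+1)); rewrite f2 // e1.
  case: (gP) => _ gB gM _; apply: gB.
    by apply: gM => //; have := gradingX gP 2 (poly_grading_polyX gG).
  apply: poly_gradingC => //; case: (gG) => _ _ gM' _; apply: gM'.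
    by have := gradingX gG 2 (gz p.+1).
  exact: grading_horner.
pose S := map_poly polyC (Q p m) + \sum_(2 <= i < m)
   (z (p + i)%N ^+ 2 * (P (p + i)%N (m - i)%N).[z (p + i)%N])%:P%:P * De p i.
have gS : poly_grading (poly_grading G) m.-1 S.
  apply: (gradingD gPP); first exact: poly_grading_map.
  apply: (grading_sum gPP) => i; rewrite mem_index_iota => hi.
  have -> : (m.-1 = (1 * 2 + (m - i).-1) + i.-2)%N by lia.
  case: (gPP) => _ _ gM _; apply: gM; last by have [_] := IH i ltac:(lia) p ltac:(lia); apply; lia.
  apply: (poly_gradingC gP); apply: (poly_gradingC gG).
  case: (gG) => _ _ gM' _; apply: gM'; first exact: gradingX.
  by apply: grading_horner => //; have [] := IH (m - i)%N ltac:(lia) (p + i)%N ltac:(lia).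
pose mid := (inv m * m.-1%:R) *: 'X + (inv m * z (p + m)%N)%:P : {poly A}.
have gmid : poly_grading G 1 mid.
  apply: (gradingD gP).
    rewrite -mul_polyC; case: (gP) => _ _ gM _; apply: (gM 0%N 1%N); last exact: poly_grading_polyX.
    apply: poly_gradingC => //; case: (gG) => _ _ gM' _; apply: (gM' 0%N 0%N) => //.
    exact: grading_nat.
  by apply: poly_gradingC => //; case: (gG) => _ _ gM' _; apply: (gM' 0%N 1%N).
have fE : 'X - mid%:P = (inv m)%:P%:P * (m%:R *: 'X - (m.-1%:R *: 'X + (z (p + m)%N)%:P)%:P).
  have e : (inv m)%:P * m%:R = 1 :> {poly A}.
    by rewrite -(rmorph_nat polyC) -polyCM mulrC invP //; lia.
  rewrite mulrBr; congr (_ - _).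
    by rewrite -mul_polyC mulrA -rmorphM /= e mul1r.
  by rewrite -rmorphM /= mulrDr -polyCM mul_polyC scalerA.
have SE : ('X - mid%:P) * De p m = (inv m)%:P%:P * (S - (P p m)%:P).
  by rewrite fE -mulrA f3 // /S; congr (_ * _); ring.
have PE : P p m = S.[mid].
  have := congr1 (horner^~ mid) SE; rewrite hornerM !hornerE subrr mul0r.
  move=> /(congr1 (fun y => m%:R * y)); rewrite mulr0 mulrA.
  rewrite -(rmorph_nat polyC) -polyCM invP; last by lia.
  by rewrite mul1r => /esym/eqP; rewrite subr_eq0 => /eqP ->.
have gPm : poly_grading G m.-1 (P p m) by rewrite PE; exact: (grading_horner gP gS).
split=> // _; apply: (poly_grading_div gP gmid); rewrite SE.
have -> : (m.-2.+1 = 0 + m.-1)%N by lia.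
case: (gPP) => _ gB gM _; apply: gM.
  by apply: (poly_gradingC gP); apply: (poly_gradingC gG).
by apply: gB => //; apply: (poly_gradingC gP).
Qed.

Lemma mpoly_grading (n : nat) (K : comNzRingType) :
  grading (fun k (p : mpoly n K) => p \is ishomog1 k (@mdeg n)).
Proof.
split.
- by move=> k; apply: dhomog0.
- by move=> k a b ha hb; apply: dhomogD => //; rewrite dhomogN.
- by move=> k l a b ha hb; apply: dhomogM.
- exact: dhomog1.
Qed.

(** Free of divisions, the relations survive any ring morphism, so that one generic family serves
    complex points and formal variables alike. *)
Lemma poly_family_map (A B : comNzRingType) (f : {rmorphism A -> B}) d z P Q De :
  poly_family d z P Q De ->
  poly_family d (f \o z) (fun p m => map_poly f (P p m))
    (fun p m => map_poly f (Q p m)) (fun p m => map_poly (map_poly f) (De p m)).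
Proof.
case=> f1 f2 f3; split=> [p|p m hm|p m hm].
- by rewrite f1 rmorph1.
- have := congr1 (map_poly f) (f2 p m hm).
  rewrite rmorphM !rmorphB rmorphM rmorphXn /= !map_polyX !map_polyC /= => ->.
  by rewrite rmorphM rmorphXn /= -horner_map.
- have := congr1 (map_poly (map_poly f)) (f3 p m hm).
  rewrite rmorphM [in RHS]rmorphD [in LHS]rmorphB [in RHS]rmorphB raddf_sum /=.
  rewrite linearZ_LR /= !map_polyC /= map_polyX raddfD /= linearZ_LR /= map_polyX map_polyC /=.
  rewrite !rmorph_nat => ->.
  congr (_ - _ + _).
    by rewrite -!map_poly_comp; apply: eq_map_poly => x /=; rewrite map_polyC.
  apply: eq_bigr => i _.
  by rewrite rmorphM /= !map_polyC /= map_polyC /= rmorphM rmorphXn -horner_map.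
Qed.

Lemma poly_family_shift (A : comNzRingType) d (z : nat -> A) P Q De k :
  poly_family d z P Q De ->
  poly_family d (fun j => z (k + j)%N) (fun p => P (k + p)%N) (fun p => Q (k + p)%N)
    (fun p => De (k + p)%N).
Proof.
case=> f1 f2 f3; split=> [p|p m hm|p m hm]; first exact: f1.
  by rewrite addnS f2.
by rewrite addnA f3 //; congr (_ + _); apply: eq_bigr => i _; rewrite addnA.
Qed.

Lemma poly_family_le (A : comNzRingType) d d' (z : nat -> A) P Q De :
  (d' <= d)%N -> poly_family d z P Q De -> poly_family d' z P Q De.
Proof.
move=> le [f1 f2 f3]; split=> // p m hm; [apply: f2|apply: f3]; lia.
Qed.

(** * [Poly_d] over an arbitrary commutative ring *)

Section PolyD.
Variable R : realType.
Local Notation C := R[i].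

Lemma iterated_integral_ext d (rad : nat -> R) j n (f g : (nat -> C) -> C) u u' :
  (forall w w', (forall i, (i <= d)%N -> w i = w' i) -> f w = g w') ->
  (forall i, (i <= d)%N -> u i = u' i) ->
  iterated_integral rad j n f u = iterated_integral rad j n g u'.
Proof.
move=> fg; elim: n j u u' => [|n IH] j u u' uu /=; first exact: fg.
congr circle_integral; apply/funext => w; apply: IH => i id /=.
by case: ifP => // _; apply: uu.
Qed.

Definition residue_integrand (d : nat) (v u : nat -> C) : C :=
  \prod_(1 <= j < d) (u j ^+ 2 / ((2 * u j - u j.-1 - u j.+1) * (u j - v j))).

Definition radii (d : nat) (v : nat -> C) (rad : nat -> R) : Prop :=
  [/\ (rad 0%N)%:C = `|v 0%N|, (rad d)%:C = `|v d| &
    forall j, (0 < j < d)%N ->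
      `|v j| < (rad j)%:C /\ rad j.-1 + rad j.+1 < 2 * rad j].

(** Makes the integral representation available at every complex point, so that the values of
    [Poly_d] are prescribed everywhere. *)
Lemma radii_exist d (v : nat -> C) : (0 < d)%N -> exists rad, radii d v rad.
Proof.
move=> d0; pose a j := complex.Re `|v j|.
have aE j : (a j)%:C = `|v j| by rewrite /a normc_def.
have a0 j : 0 <= a j by rewrite -ler0c aE.
(* Since j (d - j) >= 1 for 0 < j < d, the term M j (d - j) of [rad] alone exceeds every inner |v
   j|; the linear part is nonnegative. *)
pose M := \sum_(0 <= j < d) a j + 1.
have M1 : 1 <= M by rewrite lerDr; apply: sumr_ge0.
have aM j : (j < d)%N -> a j < M.
  move=> jd; rewrite /M big_mkord (bigD1 (Ordinal jd)) //= -addrA ltrDl.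
  by rewrite ltr_wpDl // sumr_ge0.
have d1 : d%:R != 0 :> R by rewrite pnatr_eq0; lia.
(* a steep concave parabola through the two prescribed end values *)
pose rad (j : nat) : R := a 0%N + (a d - a 0%N) / d%:R * j%:R + M * (j%:R * (d%:R - j%:R)).
exists rad; split.
- by rewrite /rad mulr0 mul0r mulr0 !addr0.
- by rewrite /rad subrr !mulr0 addr0 divfK // addrC subrK.
move=> j /andP[j0 jd]; split.
  rewrite -aE ltcR; apply: lt_le_trans (aM _ jd) _.
  have jdR : (j%:R : R) <= d%:R by rewrite ler_nat ltnW.
  have lin : 0 <= a 0%N + (a d - a 0%N) / d%:R * j%:R.
    have -> : a 0%N + (a d - a 0%N) / d%:R * j%:R =
      (a 0%N * (d%:R - j%:R) + a d * j%:R) / d%:R by field.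
    by rewrite divr_ge0 // addr_ge0 // mulr_ge0 // subr_ge0.
  have q : 1 <= j%:R * (d%:R - j%:R) :> R.
    rewrite -natrB ?(ltnW jd) // -natrM ler1n muln_gt0 j0 /=; lia.
  rewrite /rad -[leLHS]add0r lerD // -[leLHS]mulr1 ler_wpM2l //.
  exact: le_trans M1.
have [i ->] : exists i, j = i.+1 by exists j.-1; lia.
rewrite -subr_gt0.
have -> : 2 * rad i.+1 - (rad i.+1.-1 + rad i.+2) = 2 * M.
  by rewrite /rad /= -!natr1; ring.
by rewrite mulr_gt0 // (lt_le_trans ltr01).
Qed.

Lemma poly_family_integral d (z : nat -> C) P Q De rad :
  poly_family d z P Q De -> (0 < d)%N -> radii d z rad ->
  d%:R / (2 * pi%:C * 'i%C) ^+ d.-1 *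
    iterated_integral rad 1 d.-1 (residue_integrand d z) z = (P 0%N d).[z 0%N].
Proof.
move=> fam d0 [r0 rd rP].
pose F p m (w : nat -> C -> C -> C) t x :=
  ((P p m).[x] + \sum_(1 <= i < m) z (p + i)%N ^+ 2 *
     (P (p + i)%N (m - i)%N).[z (p + i)%N] * w i t x) / den z p m t x.
pose W p := strong_rec (fun _ _ => 0) (F p).
have WE p m : W p m = F p m (W p).
  apply: strong_recE => {}m f g fg; apply/funext => t; apply/funext => x.
  congr ((_ + _) / _); rewrite !big_nat; apply: eq_bigr => i hi.
  by rewrite fg //; lia.
have WE' p m t x : (0 < m)%N -> W p m t x =
  ((P p m).[x] + \sum_(1 <= i < m) z (p + i)%N ^+ 2 *
     (P (p + i)%N (m - i)%N).[z (p + i)%N] * W p i t x) / den z p m t x.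
  by move=> _; rewrite [LHS](congr1 (fun w => w t x) (WE p m)).
exact: (iterated_integral_family fam WE' r0 rd rP d0).
Qed.

(** Zero beyond d because [poly_family] takes a sequence indexed by all naturals. *)
Definition block_var (d j : nat) : mpoly d.+1 rat :=
  if (j <= d)%N then mpolyX rat (mnm1 (inord j)) else 0.

Definition mpoly_ev d (v : nat -> C) : mpoly d.+1 rat -> C :=
  meval (fun i : 'I_d.+1 => v i) \o map_mpoly ratr.

HB.instance Definition _ d v := GRing.RMorphism.on (@mpoly_ev d v).

Lemma mpoly_ev_var d v j : (j <= d)%N -> mpoly_ev v (block_var d j) = v j.
Proof.
move=> jd; rewrite /mpoly_ev /block_var jd /= map_mpolyX mevalXU.
by rewrite inordK.
Qed.

Lemma block_family d : exists P Q De,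
  poly_family d (block_var d) P Q De /\
  forall m p, (0 < m <= d)%N -> (P p m).[block_var d p] \is ishomog1 m.-1 (@mdeg d.+1).
Proof.
pose inv m : mpoly d.+1 rat := @mpolyC d.+1 rat m%:R^-1.
have invP m : (0 < m)%N -> m%:R * inv m = 1.
  move=> m0; rewrite -(rmorph_nat (@mpolyC d.+1 rat)) -rmorphM /= divff ?rmorph1 //.
  by rewrite pnatr_eq0; lia.
have [P [Q [De fam]]] := poly_family_exists d (block_var d) invP.
exists P, Q, De; split=> // m p hm.
have gX j : block_var d j \is ishomog1 1 (@mdeg d.+1).
  rewrite /block_var; case: ifP => _; last exact: dhomog0.
  by rewrite dhomogX /= mdeg1.
have gi m0 : inv m0 \is ishomog1 0 (@mdeg d.+1).
  by rewrite /inv -[mpolyC _ _]mulr1 mul_mpolyC; apply/dhomogZ/dhomog1.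
apply: (grading_horner (mpoly_grading d.+1 rat)) (gX p).
exact: (poly_family_graded invP (mpoly_grading d.+1 rat) gi gX fam).
Qed.
End PolyD.

Lemma rmorph_mmap (n : nat) (A B D : comNzRingType) (g : {rmorphism B -> D})
    (f : {rmorphism A -> B}) (h : 'I_n -> B) (p : mpoly n A) :
  g (mmap f h p) = mmap (g \o f) (g \o h) p.
Proof.
rewrite /mmap rmorph_sum; apply: eq_bigr => m _.
rewrite rmorphM /mmap1 rmorph_prod; congr (_ * _).
by apply: eq_bigr => i _; rewrite rmorphXn.
Qed.

Lemma meval_map_mpoly (n : nat) (A B : comNzRingType) (f : {rmorphism A -> B})
    (v : 'I_n -> B) (p : mpoly n A) :
  meval v (map_mpoly f p) = mmap f v p.
Proof.
rewrite /map_mpoly (rmorph_mmap (meval v)).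
rewrite /mmap; apply: eq_bigr => m _ /=; rewrite mevalC; congr (_ * _).
by apply: eq_bigr => i _ /=; rewrite mevalXU.
Qed.

Section PolyD.
Variable R : realType.
Local Notation C := R[i].

(** A window z_p, ..., z_{p+m} of a family starts a family of its own, and the integral for it
    involves this window only. *)
Lemma block_family_ev d P Q De (v : nat -> C) p m rad :
  poly_family d (block_var d) P Q De -> (0 < m)%N -> (p + m <= d)%N ->
  radii m (fun j => v (p + j)%N) rad ->
  mpoly_ev v (P p m).[block_var d p] =
  m%:R / (2 * pi%:C * 'i%C) ^+ m.-1 *
    iterated_integral rad 1 m.-1 (residue_integrand m (fun j => v (p + j)%N))
      (fun j => v (p + j)%N).
Proof.
move=> fam m0 pmd rP.
have vE j : (j <= m)%N -> mpoly_ev v (block_var d (p + j)) = v (p + j)%N.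
  by move=> jm; rewrite mpoly_ev_var //; lia.
have md : (m <= d)%N by lia.
have fam' := poly_family_le md (poly_family_shift p (poly_family_map (mpoly_ev v) fam)).
have rP' : radii m (fun j => (mpoly_ev v \o block_var d) (p + j)%N) rad.
  case: rP => r1 r2 r3; split=> [||j hj]; rewrite /= vE //; last by lia.
  exact: r3.
have := poly_family_integral fam' m0 rP'.
rewrite /= addn0 horner_map => <-; congr (_ * _).
have -> : residue_integrand m (fun j => mpoly_ev v (block_var d (p + j))) =
          residue_integrand m (fun j => v (p + j)%N).
  apply/funext => u; apply: eq_big_nat => j hj; rewrite vE //; lia.
apply: (@iterated_integral_ext _ m) => [w w' ww|i im]; last exact: vE.
by apply: eq_big_nat => j hj; rewrite !ww //; lia.
Qed.

Lemma is_Poly_d_exists d : (0 < d)%N -> exists P, @is_Poly_d R d P.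
Proof.
move=> d0; have [P [Q [De [fam hom]]]] := block_family d.
exists (P 0%N d).[block_var d 0]; split; first by apply: hom; lia.
move=> v rad r1 r2 r3.
rewrite -[LHS]/(mpoly_ev v _).
by rewrite (block_family_ev fam d0 _ (rad := rad)).
Qed.

Lemma Poly_dP d : (0 < d)%N -> @is_Poly_d R d (Poly_d R d).
Proof. by move=> /is_Poly_d_exists[P hP]; apply: (xgetPex 0); exists P. Qed.

(** Both sides take the same value at every complex point, namely the integral for the window. *)
Lemma block_family_Poly_d d P Q De p m :
  poly_family d (block_var d) P Q De -> (0 < m)%N -> (p + m <= d)%N ->
  (P p m).[block_var d p] =
  mmap (@mpolyC d.+1 rat) (fun i : 'I_m.+1 => block_var d (p + i)) (Poly_d R m).
Proof.
move=> fam m0 pmd; apply: (@mpoly_meval_inj C) => v.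
rewrite -![LHS]/(mpoly_ev v _) -![RHS]/(mpoly_ev v _).
have [rad rP] := radii_exist (fun j => v (p + j)%N) m0.
rewrite (block_family_ev fam m0 pmd rP).
have [_ h] := Poly_dP m0; case: rP => r1 r2 r3.
rewrite -(h _ rad r1 r2 r3) meval_map_mpoly rmorph_mmap /mmap.
apply: eq_bigr => k _; congr (_ * _).
  by rewrite /= /mpoly_ev /= meval_map_mpoly mmapC.
by apply: eq_bigr => i _; rewrite /= mpoly_ev_var //; have := ltn_ord i; lia.
Qed.

(** Besides homogeneity, all that the sequel uses of [Poly_d]: a single solution of the relations
    over B contains the values of all blocks at once. *)
Lemma Poly_d_family (B : comNzRingType) (iota : {rmorphism rat -> B}) d (z : nat -> B) :
  (forall j, (d < j)%N -> z j = 0) ->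
  exists P Q De, poly_family d z P Q De /\
    forall p m, (0 < m)%N -> (p + m <= d)%N ->
      (P p m).[z p] = mmap iota (fun i : 'I_m.+1 => z (p + i)%N) (Poly_d R m).
Proof.
move=> z0; have [P [Q [De [fam _]]]] := block_family d.
pose g : {rmorphism mpoly d.+1 rat -> B} := mmap iota (fun i : 'I_d.+1 => z i).
have gX j : g (block_var d j) = z j.
  rewrite /block_var; case: ifP => jd; last by rewrite rmorph0 z0 //; lia.
  by have := mmapX (fun i : 'I_d.+1 => z i) iota (mnm1 (inord j)); rewrite mmap1U inordK.
have fam' := poly_family_map g fam.
do 3!eexists; split.
  have -> : z = g \o block_var d by apply/funext => j; rewrite /= gX.
  exact: fam'.
move=> p m m0 pmd /=; rewrite -gX horner_map (block_family_Poly_d fam m0 pmd).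
rewrite (rmorph_mmap g) /mmap; apply: eq_bigr => k _; congr (_ * _).
  exact: mmapC.
by apply: eq_bigr => i _ /=; rewrite gX.
Qed.
End PolyD.

(** * Chains of constants and the passage from N + 1 to N *)

Section LinearExtension.
Variables (n : nat) (K : comNzRingType) (phi : multinom n -> K).

Definition mlinear (p : mpoly n K) : K := \sum_(m <- msupp p) mcoeff m p * phi m.

Lemma mlinearE (s : seq (multinom n)) p : uniq s -> {subset msupp p <= s} ->
  mlinear p = \sum_(m <- s) mcoeff m p * phi m.
Proof.
move=> us sub; rewrite (bigID (mem (msupp p))) /= [X in _ + X]big1 ?addr0.
  rewrite -big_filter; apply: perm_big; apply: uniq_perm; rewrite ?msupp_uniq ?filter_uniq //.
  by move=> m; rewrite mem_filter; case: (boolP (m \in msupp p)) => // /sub ->.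
by move=> m /memN_msupp_eq0 ->; rewrite mul0r.
Qed.

Lemma mlinear_is_zmod : zmod_morphism mlinear.
Proof.
move=> p q; pose s := undup (msupp p ++ msupp q).
have us : uniq s by rewrite undup_uniq.
have sp : {subset msupp p <= s} by move=> m mp; rewrite mem_undup mem_cat mp.
have sq : {subset msupp q <= s} by move=> m mp; rewrite mem_undup mem_cat mp orbT.
have spq : {subset msupp (p - q) <= s} by move=> m /msuppB_le; rewrite mem_undup.
rewrite (mlinearE us sp) (mlinearE us sq) (mlinearE us spq).
by rewrite -sumrB; apply: eq_bigr => m _; rewrite mcoeffB mulrBl.
Qed.

HB.instance Definition _ := GRing.isZmodMorphism.Build _ _ mlinear mlinear_is_zmod.

Lemma mlinearZ c p : mlinear (c *: p) = c * mlinear p.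
Proof.
rewrite (@mlinearE (msupp p)) ?msupp_uniq //; last exact: msuppZ_le.
by rewrite mulr_sumr; apply: eq_bigr => m _; rewrite mcoeffZ mulrA.
Qed.

Lemma mlinearX m : mlinear (mpolyX K m) = phi m.
Proof. by rewrite /mlinear msuppX big_seq1 mcoeffX eqxx mul1r. Qed.

Lemma mlinear_mulr p q : mlinear (p * q) = \sum_(m <- msupp q) mcoeff m q * mlinear (p * mpolyX K m).
Proof.
rewrite {1}[q]mpolyE mulr_sumr raddf_sum; apply: eq_bigr => m _.
by rewrite /= -scalerAr mlinearZ.
Qed.
End LinearExtension.

Section Path.
Variables (L : int -> nat -> rat) (c : int).

(* The product assigned to a monomial by phi_n^{N,k}, for c = k - N - 1 and s
   the exponents of the remaining z_j: a zero exponent enlarges the current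
   block, of length D, and a positive one closes it (vsc_monomialE). *)
Fixpoint chain_prod (n : int) (D : nat) (s : seq nat) : rat :=
  match s with
  | [::] => L n D
  | a :: s' => if a == 0%N then chain_prod n D.+1 s'
               else L n D * chain_prod (n - c * D%:Z - a%:Z) 1 s'
  end.

(** A positive exponent cuts the product in two; the right part starts at the index lowered by c for
    each step and by every exponent met. *)
Lemma chain_prod_cat n D s1 a s2 : (0 < a)%N ->
  chain_prod n D (s1 ++ a :: s2) =
  chain_prod n D s1 * chain_prod (n - c * (D + size s1)%:Z - (sumn s1)%:Z - a%:Z) 1 s2.
Proof.
move=> a0; elim: s1 n D => [|x s1 IH] n D /=.
  by rewrite gtn_eqF // addn0 subr0.
case: eqP => [->|_]; rewrite IH; first by rewrite addSnnS add0n.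
by rewrite mulrA; congr (_ * chain_prod _ _ _); lia.
Qed.

Lemma chain_prod_nseq0 n D l : chain_prod n D (nseq l 0%N) = L n (D + l).
Proof. by elim: l D => [|l IH] D /=; rewrite ?addn0 // IH addSnnS. Qed.

Hypothesis L_neg : forall n D, (0 < D)%N -> n < 0 -> L n D = 0.

Lemma chain_prod_neg n D s : (0 < D)%N -> n < 0 -> chain_prod n D s = 0.
Proof.
move=> + n0; elim: s D => [|a s IH] D D0 /=; first exact: L_neg.
by case: eqP => _; rewrite ?IH // L_neg // mul0r.
Qed.

(* Along the chain the index stays below n + |c| * (number of steps). *)
Lemma chain_prod_large n D s A a : (0 < D)%N -> n + `|c| * (D + size s)%:Z < A%:Z ->
  (A <= a)%N -> a \in s -> chain_prod n D s = 0.
Proof.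
elim: s n D => [//|x s IH] n D D0 h Aa; rewrite in_cons /= => /orP[/eqP <-|ms].
  case: eqP => [a0|_].
    rewrite chain_prod_neg //; move: h; have := normr_ge0 c; rewrite a0 in Aa; nia.
  rewrite [chain_prod (_ - _ - _) _ _]chain_prod_neg ?mulr0 //.
  have := ler_norm (- c); rewrite normrN; have := normr_ge0 c; nia.
case: eqP => _; first by apply: IH => //; move: h; rewrite /= addSnnS.
rewrite [chain_prod (_ - _ - _) _ _]IH ?mulr0 //.
have := ler_norm (- c); rewrite normrN; have := normr_ge0 c; move: h => /=; nia.
Qed.

Variables B d : nat.
Hypothesis L_big : forall n D, (0 < D <= d)%N -> B%:Z <= n -> L n D = 0.

Lemma chain_prod_big n D s : (0 < D)%N -> (D + size s <= d)%N -> B%:Z <= n -> chain_prod n D s = 0.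
Proof.
move=> + + nB; elim: s D => [|a s IH] D D0 Ds /=.
  by rewrite L_big // D0 /= -(addn0 D).
case: eqP => _; first by rewrite IH //; move: Ds => /=; lia.
by rewrite L_big ?mul0r // D0; move: Ds => /=; lia.
Qed.
End Path.

Lemma exchange_big_triangle (A : nmodType) (d : nat) (F : nat -> nat -> A) :
  \sum_(1 <= s < d) \sum_(s.+1 <= t < d) F s t =
  \sum_(1 <= t < d) \sum_(1 <= s < t) F s t.
Proof.
transitivity (\sum_(1 <= s < d) \sum_(1 <= t < d | (s < t)%N) F s t).
  apply: eq_big_nat => s hs; rewrite (big_nat_widenl s.+1 1); last by lia.
  by apply: eq_bigl => t.
rewrite (exchange_big_dep_nat predT) //=; apply: eq_big_nat => t ht.
by rewrite [RHS](big_nat_widen _ _ d) //; lia.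
Qed.

(** Both sides sum over all chains 0 < s_1 < ... < d; X splits off the last link, Y the first
    one. *)
Lemma first_last_decomposition (A : comNzRingType) (d : nat) (E : nat -> nat -> A)
    (m X Y : nat -> A) :
  (0 < d)%N ->
  (forall q, (0 < q <= d)%N -> X q = E 0%N q + \sum_(1 <= s < q) X s * (m s * E s q)) ->
  (forall i, (i < d)%N -> Y i = E i d + \sum_(i.+1 <= s < d) E i s * (m s * Y s)) ->
  X d = Y 0%N.
Proof.
move=> d0 hX hY; rewrite hX ?hY ?d0 //=; congr (_ + _).
have e1 : \sum_(1 <= s < d) X s * (m s * Y s) = \sum_(1 <= s < d) X s * (m s * E s d) +
   \sum_(1 <= s < d) \sum_(s.+1 <= t < d) X s * m s * E s t * m t * Y t.
  rewrite -big_split; apply: eq_big_nat => s hs /=.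
  rewrite hY; last by lia.
  rewrite mulrDr mulrDr; congr (_ + _); rewrite !mulr_sumr.
  by apply: eq_bigr => t _; ring.
have e2 : \sum_(1 <= s < d) X s * (m s * Y s) = \sum_(1 <= s < d) E 0%N s * (m s * Y s) +
   \sum_(1 <= t < d) \sum_(1 <= s < t) X s * m s * E s t * m t * Y t.
  rewrite -big_split; apply: eq_big_nat => s hs /=.
  rewrite hX; last by lia.
  rewrite mulrDl; congr (_ + _); rewrite mulr_suml.
  by apply: eq_bigr => t _; ring.
by move: e1; rewrite e2 exchange_big_triangle => /addIr.
Qed.

(** Negative integers go to 0, so that [upper_path] has an empty sum for them. *)
Definition nat_of_int (r : int) : nat := if r is Posz k then k else 0%N.

Section PathSum.
Variables (K : fieldType) (w : nat -> K).

(* For w f = ∂_x + f and c = k - N, T f n is the coefficient of e^{fx} in the sum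
   of the system for alpha = N - 2 - n, and upper_path T f r is that of
   psi_{N-1-r} (gauss_manin_path). *)
Definition upper_path (T : nat -> int -> K) (f : nat) (r : int) : K :=
  if f == 0%N then w 0 ^ (- r)
  else w f ^ (- r) * \sum_(0 <= n < nat_of_int r) w f ^+ n * T f n%:Z.

(** Recursive in f, hence always solvable, and meaningful for c of either sign: the descent starts
    at N = 2k, where c = -k. *)
Definition path_sum (a : int -> nat -> K) (c : int) (T : nat -> int -> K) : Prop :=
  forall f n, (0 < f)%N -> T f n = \sum_(1 <= D < f.+1)
    a n D * upper_path T (f - D)%N (n - c * D%:Z).

Lemma path_sum_eq0 a c T f n : path_sum a c T -> (0 < f)%N ->
  (forall D, (0 < D <= f)%N -> a n D = 0) -> T f n = 0.
Proof.
move=> hT f0 ha; rewrite hT // big_nat big1 // => D hD.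
by rewrite ha // mul0r.
Qed.

(** Counting the index downwards from r exhibits a geometric series in 1 / w f: the origin of the
    resolvents. A larger A is allowed since T vanishes at negative indices. *)
Lemma upper_pathE T f (r : int) (A : nat) :
  (0 < f)%N -> w f != 0 -> (forall n, n < 0 -> T f n = 0) -> r <= A%:Z ->
  upper_path T f r = \sum_(1 <= a < A.+1) w f ^ (- a%:Z) * T f (r - a%:Z).
Proof.
move=> f0 wf Tneg rA; rewrite /upper_path gtn_eqF //.
case: r rA => k rA /=; last first.
  rewrite big_geq // mulr0 big_nat big1 // => a ha.
  by rewrite Tneg ?mulr0 // NegzE; lia.
have kA : (k <= A)%N by lia.
rewrite [RHS](@big_cat_nat _ _ _ k.+1) //=.
rewrite [X in _ = _ + X]big_nat [X in _ = _ + X]big1 ?addr0; last first.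
  by move=> a ha; rewrite Tneg ?mulr0 //; lia.
rewrite big_add1 /= big_nat_rev /= add0n mulr_sumr; apply: eq_big_nat => n hn.
rewrite mulrA exprnP -expfzDr //; congr (_ ^ _ * T f _); lia.
Qed.
End PathSum.

(** * Comparison of the totals for the parameters N + 1 ([L], [b]) and N ([L'], [c]) *)

Section LevelStep.
Variables (K : fieldType) (emb : {rmorphism rat -> K}).
Variable Pol : forall m : nat, mpoly m.+1 rat.
Hypothesis Pol_homog : forall m, (0 < m)%N -> Pol m \is ishomog1 m.-1 (@mdeg m.+1).
Hypothesis Pol_family :
  forall (B : comNzRingType) (emb : {rmorphism rat -> B}) d (z : nat -> B),
  (forall j, (d < j)%N -> z j = 0) ->
  exists P Q De, poly_family d z P Q De /\
    forall p m, (0 < m)%N -> (p + m <= d)%N ->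
      (P p m).[z p] = mmap emb (fun i : 'I_m.+1 => z (p + i)%N) (Pol m).

Variables (y0 : K) (d : nat).
Hypothesis d0 : (0 < d)%N.
Let w (f : nat) : K := y0 + f%:R.
Hypothesis w_neq0 : forall f, w f != 0.

Variables (L L' : int -> nat -> rat) (b : int) (B : nat).
Hypothesis L_neg : forall n D, (0 < D)%N -> n < 0 -> L n D = 0.
Hypothesis L_big : forall n D, (0 < D <= d)%N -> B%:Z <= n -> L n D = 0.
Let c : int := b + 1.

Let v (j : nat) : K := y0 + d%:R - j%:R.

Lemma vE j : (j <= d)%N -> v j = w (d - j).
Proof. by move=> jd; rewrite /v /w natrB // addrA. Qed.

Lemma v_neq0 j : (j <= d)%N -> v j != 0.
Proof. by move=> jd; rewrite vE. Qed.

(** Chosen beyond every index that a chain of length at most d can reach from a start below B + d,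
    for either slope [b] or [c]; truncating at this exponent then loses nothing. *)
Let A : nat := (B + d + (`|b|%N + 1) * d).+1.

Local Notation Rg := (mpoly d.+1 K).
Local Notation cst := (@mpolyC d.+1 K).

Definition mnm_fun (e : nat -> nat) : multinom d.+1 := Multinom [tuple e (nat_of_ord i) | i < d.+1].
Definition expo (D : nat) (m : multinom D.+1) (j : nat) : nat := m (inord j).
Definition inner_expo (e : nat -> nat) (i s : nat) : seq nat := [seq e j | j <- iota i.+1 (s - i.+1)].
Definition monom (e : nat -> nat) : Rg := mpolyX K (mnm_fun e).
Definition mvar (j : nat) : Rg := mpolyX K (mnm1 (inord j)).

Lemma mnm_funE e (i : 'I_d.+1) : mnm_fun e i = e i.
Proof. by rewrite mnmE. Qed.

Lemma expo_mnm_fun e j : (j <= d)%N -> expo (mnm_fun e) j = e j.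
Proof. by move=> jd; rewrite /expo mnm_funE inordK. Qed.

Lemma mnm_fun_expo (m : multinom d.+1) : mnm_fun (expo m) = m.
Proof. by apply/mnmP => i; rewrite mnm_funE /expo inord_val. Qed.

Lemma monomD e e' : monom e * monom e' = monom (fun j => e j + e' j)%N.
Proof.
by rewrite -mpolyXD; congr mpolyX; apply/mnmP => i; rewrite mnmDE !mnm_funE.
Qed.

Lemma mvar_exp j k : (j <= d)%N -> mvar j ^+ k = monom (fun i => if i == j then k else 0%N).
Proof.
move=> jd; rewrite /mvar mpolyXn; congr mpolyX; apply/mnmP => i.
rewrite mulmnE mnm_funE mnm1E -val_eqE /= inordK // eq_sym.
by case: eqP => _; rewrite ?mul1n.
Qed.

Lemma monom_prod e : monom e = \prod_(0 <= j < d.+1) mvar j ^+ e j.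
Proof.
rewrite /monom mpolyXE_id big_mkord; apply: eq_bigr => i _.
by rewrite mnm_funE /mvar inord_val.
Qed.

(* The exponent of [v d] is minus the index reached at the end of the path. *)
Definition mono_eval (i : nat) (n : int) (e : nat -> nat) : K :=
  emb (chain_prod L b (n - (e i)%:Z) 1 (inner_expo e i d)) *
  v d ^ (b * (d - i)%:Z + (\sum_(i <= j < d) e j)%:Z - n).

Definition path_eval (i : nat) (n : int) : Rg -> K := mlinear (fun m => mono_eval i n (expo m)).
HB.instance Definition _ i n := GRing.Additive.on (path_eval i n).

Lemma path_evalZ i n a p : path_eval i n (a *: p) = a * path_eval i n p.
Proof. exact: mlinearZ. Qed.

Lemma eq_mono_eval i n e e' : (i < d)%N -> (forall j, (j < d)%N -> e j = e' j) -> mono_eval i n e = mono_eval i n e'.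
Proof.
move=> id ee; rewrite /mono_eval ee // /inner_expo; congr (emb (chain_prod _ _ _ _ _) * _ ^ (_ + Posz _ - _)).
  by apply/eq_in_map => j; rewrite mem_iota => hj; apply: ee; lia.
by apply: eq_big_nat => j hj; apply: ee; lia.
Qed.

Lemma path_evalX i n e : (i < d)%N -> path_eval i n (monom e) = mono_eval i n e.
Proof.
move=> id; rewrite /path_eval mlinearX; apply: eq_mono_eval => // j jd.
by rewrite expo_mnm_fun // ltnW.
Qed.

Lemma path_eval_mul i n p q : path_eval i n (p * q) = \sum_(m <- msupp q) mcoeff m q * path_eval i n (p * monom (expo m)).
Proof.
rewrite /path_eval mlinear_mulr; apply: eq_bigr => m _.
by rewrite /monom mnm_fun_expo.
Qed.

(** The exponent at the starting position is subtracted from n before any constant is read, and the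
    power of v_d depends on their difference only. *)
Lemma path_eval_shift i n k p : (i < d)%N -> path_eval i n (mvar i ^+ k * p) = path_eval i (n - k%:Z) p.
Proof.
move=> id; rewrite path_eval_mul -[p in RHS]mul1r [RHS]path_eval_mul; apply: eq_bigr => m _.
congr (_ * _); rewrite mul1r mvar_exp ?(ltnW id) // monomD !path_evalX // /mono_eval eqxx.
congr (emb (chain_prod _ _ _ _ _) * _ ^ _).
- lia.
- apply/eq_in_map => j; rewrite mem_iota => hj.
  by rewrite gtn_eqF //; lia.
- rewrite !(big_ltn id) eqxx.
  have -> : \sum_(i.+1 <= j < d) ((if j == i then k else 0%N) + expo m j)%N =
            \sum_(i.+1 <= j < d) expo m j.
    by apply: eq_big_nat => j hj; rewrite gtn_eqF //; lia.
  by rewrite !PoszD; ring.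
Qed.

Definition supported (s : nat) (p : Rg) : Prop :=
  forall m, m \in msupp p -> forall j, (j < s)%N -> expo m j = 0%N.

(** The extra factor [mvar s] makes the exponent at s positive, so [chain_prod_cat] cuts the chain
    there. This is the multiplicativity that the functional does possess. *)
Lemma path_eval_block i s n e h : (i < s < d)%N ->
  (forall j, (s < j)%N -> e j = 0%N) -> supported s h ->
  path_eval i n (monom e * (mvar s * h)) =
  emb (chain_prod L b (n - (e i)%:Z) 1 (inner_expo e i s)) *
  path_eval s (n - b * (s - i)%:Z - (\sum_(i <= j < s) e j)%:Z - (e s)%:Z - 1) h.
Proof.
move=> hs e0 sh; have sd : (s < d)%N by lia.
have -> : n - b * (s - i)%:Z - (\sum_(i <= j < s) e j)%:Z - (e s)%:Z - 1 =
  n - b * (s - i)%:Z - (\sum_(i <= j < s) e j)%:Z - (e s).+1%:Z.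
  by rewrite -addn1 PoszD; ring.
rewrite -path_eval_shift // mulrA path_eval_mul path_eval_mul mulr_sumr.
apply: eq_big_seq => m /sh sm.
rewrite mulrCA; congr (_ * _).
rewrite -[mvar s in LHS]expr1 !mvar_exp ?(ltnW sd) // !monomD !path_evalX //; last by lia.
rewrite /mono_eval eqxx.
have -> : inner_expo (fun j => (e j + (if j == s then 1 else 0) + expo m j)%N) i d =
   inner_expo e i s ++ ((e s).+1 + expo m s)%N :: inner_expo (fun j => ((if j == s then (e s).+1 else 0) + expo m j)%N) s d.
  rewrite /inner_expo; have -> : (d - i.+1 = (s - i.+1) + (d - s.+1).+1)%N by lia.
  rewrite iotaD map_cat /=; have -> : (i.+1 + (s - i.+1) = s)%N by lia.
  rewrite eqxx addn1; congr (_ ++ _ :: _).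
    apply/eq_in_map => j; rewrite mem_iota => hj.
    by rewrite sm ?ltn_eqF //; lia.
  apply/eq_in_map => j; rewrite mem_iota => hj.
  by rewrite e0 ?gtn_eqF //; lia.
rewrite sm; last by lia.
rewrite [i == s]ltn_eqF ?addn0; last by lia.
rewrite chain_prod_cat // rmorphM -mulrA; congr (_ * (emb (chain_prod _ _ _ _ _) * _ ^ _)).
- rewrite size_map size_iota sumnE big_map /=.
  rewrite (big_ltn (_ : i < s)%N); last by lia.
  rewrite -/(index_iota i.+1 s); move: (\sum_(_ <- _) _) => S.
  rewrite add1n; have -> : (s - i.+1).+1 = (s - i)%N by lia.
  rewrite !PoszD; lia.
- rewrite (@big_cat_nat _ _ _ s) /=; [|lia|lia].
  have -> : \sum_(i <= j < s) (e j + (if j == s then 1 else 0) + expo m j)%N = \sum_(i <= j < s) e j.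
    by apply: eq_big_nat => j hj; rewrite sm ?ltn_eqF ?addn0 //; lia.
  have -> : \sum_(s <= j < d) (e j + (if j == s then 1 else 0) + expo m j)%N =
            \sum_(s <= j < d) ((if j == s then (e s).+1 else 0) + expo m j)%N.
    apply: eq_big_nat => j hj; case: eqP => [->|ne]; first by rewrite addn1.
    by rewrite e0 //; lia.
  set S1 := \sum_(_ <= _ < _) _; set S2 := \sum_(_ <= _ < _) _.
  have -> : ((d - i)%:Z = (d - s)%:Z + (s - i)%:Z)%R by lia.
  rewrite !PoszD; ring.
Qed.

Lemma supportedD s p q : supported s p -> supported s q -> supported s (p + q).
Proof.
move=> hp hq m /msuppD_le; rewrite mem_cat => /orP[mp|mq] j js; [exact: hp|exact: hq].
Qed.

Lemma supported0 s : supported s 0.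
Proof. by move=> m; rewrite msupp0. Qed.

Lemma supported_sum s (I : eqType) (r : seq I) (F : I -> Rg) :
  {in r, forall i, supported s (F i)} -> supported s (\sum_(i <- r) F i).
Proof.
move=> h; rewrite big_seq; apply: (big_ind (supported s)) => //.
  exact: supported0.
by move=> p q; apply: supportedD.
Qed.

Lemma supportedM s p q : supported s p -> supported s q -> supported s (p * q).
Proof.
move=> hp hq m /msuppM_le /allpairsP[[m1 m2] /= [m1p m2q ->]] j js.
by rewrite /expo mnmDE -![_ (inord j)]/(expo _ j) hp ?hq.
Qed.

Lemma supportedZ s a p : supported s p -> supported s (a *: p).
Proof. by move=> hp m /msuppZ_le; apply: hp. Qed.

Lemma supported1 s : supported s 1.
Proof. by move=> m; rewrite msupp1 inE => /eqP -> j _; rewrite /expo mnm0E. Qed.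

Lemma supported_exp s p k : supported s p -> supported s (p ^+ k).
Proof.
by move=> hp; elim: k => [|k IH]; [exact: supported1|rewrite exprS; apply: supportedM].
Qed.

Lemma supportedX s j : (s <= j <= d)%N -> supported s (mvar j).
Proof.
move=> hj m; rewrite msuppX inE => /eqP -> i is_.
rewrite /expo mnm1E -val_eqE /= !inordK; try lia.
Qed.

Lemma supported_le s t p : (t <= s)%N -> supported s p -> supported t p.
Proof. by move=> ts hp m mp j jt; apply: hp => //; lia. Qed.

(** The arguments of the blocks: x and y become scalars, the inner z_j stay variables whose
    exponents the functional reads. *)
Let z (j : nat) : Rg :=
  if j == 0%N then cst (v 0) else if (j < d)%N then mvar j else
  if j == d then cst (v d) else 0.

Let zscal (j e : nat) : K :=
  if j == 0%N then v 0 ^+ e else if (j < d)%N then 1 else v d ^+ e.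

Lemma z_exp j e : (j <= d)%N ->
  z j ^+ e = zscal j e *: mvar j ^+ (if (0 < j < d)%N then e else 0%N).
Proof.
move=> jd; rewrite /z /zscal; case: eqP => [->|j0].
  by rewrite -mul_mpolyC mulr1 rmorphXn.
have -> : (0 < j)%N by lia.
case: ltnP => jd' /=; first by rewrite scale1r.
have -> : (j == d)%N by lia.
by rewrite -mul_mpolyC mulr1 rmorphXn.
Qed.

Definition place (i s : nat) (u : nat -> nat) (j : nat) : nat :=
  if (0 < j < d)%N && (i <= j <= s)%N then u (j - i)%N else 0%N.

Definition Poly_block (i s : nat) : Rg :=
  mmap (cst \o emb) (fun k : 'I_(s - i).+1 => z (i + k)%N) (Pol (s - i)).

Let head_scal (i : nat) (u : nat -> nat) : K := if i == 0%N then v 0 ^+ u 0%N else 1.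
Let tail_scal (i s : nat) (u : nat -> nat) : K := if s == d then v d ^+ u (s - i)%N else 1.

Lemma prod_zscal i s u : (i < s <= d)%N ->
  \prod_(i <= j < s.+1) zscal j (u (j - i)%N) = head_scal i u * tail_scal i s u.
Proof.
move=> hs; rewrite big_ltn ?big_nat_recr /=; try lia.
rewrite big_nat big1 ?mul1r => [|j hj]; last first.
  by rewrite /zscal; case: ifP => [/eqP|_]; [lia|case: ifP => //; lia].
rewrite /zscal /head_scal /tail_scal subnn; congr (_ * _).
  by case: eqP => // _; case: ifP => //; lia.
have -> : (s == 0)%N = false by lia.
case: eqP => [->|sd]; first by rewrite ltnn.
by case: ifP => //; lia.
Qed.

Lemma prod_nat_shift (F : nat -> Rg) i s : (i <= s)%N ->
  \prod_(i <= j < s.+1) F j = \prod_(k < (s - i).+1) F (i + k)%N.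
Proof.
move=> hs; rewrite -{1}[(i)]add0n big_addn subSn // big_mkord.
by apply: eq_bigr => k _; rewrite addnC.
Qed.

Lemma Poly_blockE i s : (i < s <= d)%N -> Poly_block i s = \sum_(m <- msupp (Pol (s - i)))
  (emb (mcoeff m (Pol (s - i))) * (head_scal i (expo m) * tail_scal i s (expo m))) *:
     monom (place i s (expo m)).
Proof.
move=> hs; rewrite /Poly_block /mmap; apply: eq_bigr => m _ /=.
rewrite -scalerA -[in RHS]mul_mpolyC; congr (_ * _).
rewrite -prod_zscal // /mmap1.
have -> : \prod_(k < (s - i).+1) z (i + k)%N ^+ m k =
   \prod_(i <= j < s.+1) z j ^+ expo m (j - i)%N.
  rewrite prod_nat_shift; last by lia.
  by apply: eq_bigr => k _; rewrite /expo addKn inord_val.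
have -> : \prod_(i <= j < s.+1) z j ^+ expo m (j - i)%N =
  \prod_(i <= j < s.+1) (cst (zscal j (expo m (j - i)%N)) * mvar j ^+ place i s (expo m) j).
  apply: eq_big_nat => j hj; rewrite z_exp; last by lia.
  have ij : (i <= j <= s)%N by lia.
  by rewrite mul_mpolyC /place ij andbT.
rewrite big_split /= -rmorph_prod mul_mpolyC; congr (_ *: _).
rewrite monom_prod (@big_cat_nat _ _ _ i 0) /=; [|lia|lia].
rewrite [X in X * _]big_nat [X in X * _]big1 ?mul1r => [|j hj]; last first.
  rewrite /place; have -> : (i <= j <= s)%N = false by lia.
  by rewrite andbF expr0.
rewrite [RHS](@big_cat_nat _ _ _ s.+1) /=; [|lia|lia].
rewrite [X in _ = _ * X]big_nat [X in _ = _ * X]big1 ?mulr1 // => j hj.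
rewrite /place; have -> : (i <= j <= s)%N = false by lia.
by rewrite andbF expr0.
Qed.

Lemma supported_Poly_block i s : (0 < i < s)%N -> (s <= d)%N -> supported i (Poly_block i s).
Proof.
move=> hs sd; rewrite Poly_blockE; last by lia.
apply: supported_sum => m _; apply: supportedZ; rewrite monom_prod.
rewrite (@big_cat_nat _ _ _ i 0) /=; [|lia|lia].
rewrite big_nat big1 ?mul1r => [|j hj]; last first.
  rewrite /place; have -> : (i <= j <= s)%N = false by lia.
  by rewrite andbF expr0.
rewrite big_nat; apply: (big_ind (supported i)) => [||j hj].
- exact: supported1.
- by move=> p q; apply: supportedM.
- by apply/supported_exp/supportedX; lia.
Qed.

Lemma sum_expo D (m : multinom D.+1) : (0 < D)%N -> m \in msupp (Pol D) ->
  (\sum_(0 <= k < D.+1) expo m k = D.-1)%N.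
Proof.
move=> D0 ms; have /dhomogP/(_ m ms) /= <- := Pol_homog D0.
by rewrite mdegE big_mkord; apply: eq_bigr => i _; rewrite /expo inord_val.
Qed.

(** The exponent of x in a block starting at 0; it becomes a power of v_0 and does not lower the
    index. *)
Let hd (i : nat) (u : nat -> nat) : nat := if i == 0%N then u 0%N else 0%N.

Lemma place_head i s u : (i < s <= d)%N ->
  place i s u i = (if i == 0%N then 0%N else u 0%N).
Proof.
move=> hs; rewrite /place subnn; case: eqP => [->|i0] //.
by have -> : (0 < i < d)%N && (i <= i <= s)%N by lia.
Qed.

Lemma place_head0 s u (n : int) : (0 < s <= d)%N -> n - (place 0 s u 0)%:Z = n.
Proof. by move=> hs; rewrite place_head // /= subr0. Qed.

Lemma place_inner_expo i s u : (i < s <= d)%N -> inner_expo (place i s u) i s = inner_expo u 0 (s - i).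
Proof.
move=> hs; rewrite /inner_expo -addn1 addnC [(1 + i)%N]addnC iotaDl -map_comp.
have -> : (s - (i + 1) = s - i - 1)%N by lia.
apply/eq_in_map => j; rewrite mem_iota /= => hj; rewrite /place addKn.
by have -> : (0 < i + j < d)%N && (i <= i + j <= s)%N by lia.
Qed.

Lemma sum_place i s u : (i < s <= d)%N ->
  (hd i u + \sum_(i <= j < s) place i s u j = \sum_(0 <= k < s - i) u k)%N.
Proof.
move=> hs; have e : (s - i = (s - i).-1.+1)%N by lia.
rewrite e big_nat_recl // big_ltn; last by lia.
rewrite place_head // addnA; congr (_ + _)%N.
  by rewrite /hd; case: eqP => _; rewrite ?addn0 ?add0n.
rewrite big_add1 -[i in index_iota i]add0n big_addn.
have -> : (s.-1 - i = (s - i).-1)%N by lia.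
apply: eq_big_nat => j hj; rewrite /place.
have -> : (0 < (j + i).+1 < d)%N && (i <= (j + i).+1 <= s)%N by lia.
by congr u; lia.
Qed.

Lemma place_sum i s (m : multinom (s - i).+1) : (i < s <= d)%N ->
  m \in msupp (Pol (s - i)) ->
  (hd i (expo m) + \sum_(i <= j < s) place i s (expo m) j + expo m (s - i) =
   (s - i).-1)%N.
Proof.
move=> hs ms; rewrite -(sum_expo _ ms); last by lia.
rewrite big_nat_recr //=; congr (_ + _)%N; exact: sum_place.
Qed.

(** A block of length D has degree D - 1 and [mvar s] adds one: apart from the exponent of x they
    lower the index by D, which turns the slope b into c = b + 1. *)
Lemma path_eval_Poly_block i s n h : (i < s < d)%N -> supported s h ->
  path_eval i n (Poly_block i s * (mvar s * h)) = \sum_(m <- msupp (Pol (s - i)))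
    emb (mcoeff m (Pol (s - i))) * head_scal i (expo m) *
    emb (chain_prod L b (n - (place i s (expo m) i)%:Z) 1 (inner_expo (expo m) 0 (s - i))) *
    path_eval s (n + (hd i (expo m))%:Z - c * (s - i)%:Z) h.
Proof.
move=> hs sh; have hs' : (i < s <= d)%N by lia.
rewrite Poly_blockE // mulr_suml raddf_sum; apply: eq_big_seq => m ms.
rewrite -scalerAl /= path_evalZ /tail_scal ltn_eqF ?mulr1 -?mulrA; last by lia.
do 2!congr (_ * _); rewrite path_eval_block //; last first.
  move=> j sj; have ij : (i <= j <= s)%N = false by lia.
  by rewrite /place ij andbF.
rewrite place_inner_expo //; congr (_ * path_eval _ _ _).
have -> : place i s (expo m) s = expo m (s - i).
  rewrite /place; have -> // : (0 < s < d)%N && (i <= s <= s)%N by lia.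
have e := place_sum hs' ms; have {}e : (\sum_(i <= j < s) place i s (expo m) j)%:Z + (expo m (s - i)%N)%:Z + 1 =
  (s - i)%:Z - (hd i (expo m))%:Z by move: e; lia.
by rewrite /c mulrDl mul1r; move: (b * _) e => X; lia.
Qed.

(** The end of the chain has no closing variable; the degree is then D - 1 instead of D, whence the
    factor 1 / v_d. *)
Lemma path_eval_Poly_end i n : (i < d)%N ->
  path_eval i n (Poly_block i d) = \sum_(m <- msupp (Pol (d - i)))
    emb (mcoeff m (Pol (d - i))) * head_scal i (expo m) *
    emb (chain_prod L b (n - (place i d (expo m) i)%:Z) 1 (inner_expo (expo m) 0 (d - i))) *
    ((v d)^-1 * v d ^ (- (n + (hd i (expo m))%:Z - c * (d - i)%:Z))).
Proof.
move=> id; have hs' : (i < d <= d)%N by lia.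
rewrite Poly_blockE // raddf_sum; apply: eq_big_seq => m ms.
rewrite /= path_evalZ path_evalX // /mono_eval place_inner_expo // /tail_scal eqxx -!mulrA.
do 2!congr (_ * _); rewrite mulrCA; congr (_ * _).
rewrite exprnP -expfzDr ?v_neq0 // -[(v d)^-1]/(v d ^ (-1)) -expfzDr ?v_neq0 //.
congr (_ ^ _); have := place_sum hs' ms => e.
have {}e : (\sum_(i <= j < d) place i d (expo m) j)%:Z =
  (d - i)%:Z - (hd i (expo m))%:Z - (expo m (d - i)%N)%:Z - 1 by move: e; lia.
by rewrite e /c; ring.
Qed.

Hypothesis L'E : forall n D, (0 < D)%N -> L' n D =
  \sum_(m <- msupp (Pol D)) mcoeff m (Pol D) *
    chain_prod L b (n - (expo m 0)%:Z) 1 (inner_expo (expo m) 0 D).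
Variables T Tp : nat -> int -> K.
Hypothesis T_path : path_sum w (fun n D => emb (L' n D)) c T.
Hypothesis Tp_path : path_sum w (fun n D => emb (L n D)) b Tp.

Lemma L'_neg n D : (0 < D)%N -> n < 0 -> L' n D = 0.
Proof.
move=> D0 n0; rewrite L'E // big1 // => m _.
by rewrite (chain_prod_neg _ L_neg) ?mulr0 //; lia.
Qed.

(* The inverse of v j - z j modulo z j ^+ A; no path reaches the exponent A. *)
Let g (j : nat) : Rg := \sum_(0 <= k < A) (v j)^-1 ^+ k.+1 *: mvar j ^+ k.

(** G i sums over the chains of blocks from i to d, joined at s by z_s^2 g_s, with the first block
    split off. The recursion runs on the distance d - i. *)
Let G_step (f : nat) (G : nat -> Rg) : Rg :=
  Poly_block (d - f) d + \sum_((d - f).+1 <= s < d) Poly_block (d - f) s * (z s ^+ 2 * g s * G (d - s)%N).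

Let G (i : nat) : Rg := strong_rec 0 G_step (d - i)%N.

Lemma GE i : (i < d)%N ->
  G i = Poly_block i d + \sum_(i.+1 <= s < d) Poly_block i s * (z s ^+ 2 * g s * G s).
Proof.
move=> id; rewrite {1}/G strong_recE.
  by rewrite /G_step; have -> : (d - (d - i) = i)%N by lia.
move=> f G1 G2 h; rewrite /G_step; congr (_ + _).
by apply: eq_big_nat => s hs; rewrite h //; lia.
Qed.

Lemma supported_g s j : (s <= j <= d)%N -> supported s (g j).
Proof.
move=> hj; apply: supported_sum => k _.
by apply/supportedZ/supported_exp/supportedX.
Qed.

Lemma z_mvar s : (0 < s < d)%N -> z s = mvar s.
Proof. by move=> hs; rewrite /z gtn_eqF; [case: ltnP => //; lia|lia]. Qed.

Lemma supported_G i : (0 < i < d)%N -> supported i (G i).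
Proof.
move=> hi; have [n hn] : exists n, (d - i <= n)%N by exists (d - i)%N.
elim: n i hi hn => [|n IH] i hi hn; first by lia.
rewrite GE; last by lia.
apply: supportedD; first by apply: supported_Poly_block; lia.
apply: supported_sum => s; rewrite mem_index_iota => hs.
apply: supportedM; first by apply: supported_Poly_block; lia.
apply: supportedM.
  apply: supportedM; first by rewrite z_mvar; [apply/supported_exp/supportedX; lia|lia].
  by apply: supported_g; lia.
by apply: (@supported_le s); [lia|apply: IH; lia].
Qed.

(** Lowering the index by a is multiplication by z_s^a, and w (d - s) = v_s: the geometric series of
    [upper_pathE] becomes a truncated resolvent. *)
Lemma upper_path_eval (F : nat -> int -> K) (k : K) s (r : int) C h :
  (0 < s < d)%N -> (forall n, n < 0 -> F (d - s)%N n = 0) ->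
  r <= C%:Z ->
  (forall a, (0 < a <= C)%N -> F (d - s)%N (r - a%:Z) = k * path_eval s (r - a%:Z) h) ->
  upper_path w F (d - s) r =
  k * path_eval s r (mvar s * ((\sum_(0 <= i < C) (v s)^-1 ^+ i.+1 *: mvar s ^+ i) * h)).
Proof.
move=> hs Fneg rC hF; rewrite (upper_pathE (A := C)) //; last by lia.
rewrite [_ * h]mulr_suml [mvar s * _]mulr_sumr raddf_sum mulr_sumr big_add1 /=.
apply: eq_big_nat => i hi; rewrite hF; last by lia.
rewrite -scalerAl -scalerAr /= path_evalZ [mvar s * _]mulrA -exprS path_eval_shift; last by lia.
rewrite vE; last by lia.
by rewrite mulrCA exprVn exprnN.
Qed.

Lemma T_neg f n : (0 < f)%N -> n < 0 -> T f n = 0.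
Proof.
by move=> f0 n0; apply: (path_sum_eq0 T_path) => // D /andP[D0 _]; rewrite L'_neg ?rmorph0.
Qed.

Lemma Tp_neg f n : (0 < f)%N -> n < 0 -> Tp f n = 0.
Proof.
by move=> f0 n0; apply: (path_sum_eq0 Tp_path) => // D /andP[D0 _]; rewrite L_neg ?rmorph0.
Qed.

Lemma path_sum_position (F : nat -> int -> K) (L0 : int -> nat -> rat) c0 i n :
  path_sum w (fun n D => emb (L0 n D)) c0 F -> (i < d)%N ->
  F (d - i)%N n = \sum_(i.+1 <= s < d)
     emb (L0 n (s - i)%N) * upper_path w F (d - s) (n - c0 * (s - i)%:Z) +
   emb (L0 n (d - i)%N) * v d ^ (- (n - c0 * (d - i)%:Z)).
Proof.
move=> hF id; rewrite hF; last by lia.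
rewrite big_nat_recr /=; last by lia.
rewrite {2}/upper_path subnn eqxx vE // subnn; congr (_ + _).
rewrite -[in RHS](add1n i) big_addn; apply: eq_big_nat => D hD.
by rewrite addnK; have -> : (d - i - D = d - (D + i))%N by lia.
Qed.

Lemma absz_norm (x : int) : `|x| = `|x|%N%:Z.
Proof. by rewrite abszE. Qed.

Lemma le_c : `|c| <= `|b| + 1.
Proof. by apply: (le_trans (ler_normD _ _)). Qed.

Lemma bound_next (c0 n : int) i s : (i < s <= d)%N ->
  n - c0 * (s - i)%:Z + `|c0| * (d - s)%:Z <= n + `|c0| * (d - i)%:Z.
Proof.
move=> hs; have := ler_norm (- c0); rewrite normrN.
have -> : ((d - i)%:Z = (d - s)%:Z + (s - i)%:Z)%R by lia.
rewrite mulrDr; move: (`|c0| * (d - s)%:Z) => Y h; nia.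
Qed.

(** Both sides are unfolded at the first block. Position 0 is excluded: there the exponent of x is a
    scalar factor and not a shift of the index. *)
Lemma level_path_eval i n : (0 < i < d)%N -> n + `|c| * (d - i)%:Z <= A%:Z ->
  T (d - i)%N n = v d * path_eval i n (G i).
Proof.
move=> hi; have [k hk] : exists k, (d - i <= k)%N by exists (d - i)%N.
elim: k i n hi hk => [|k IH] i n hi hk hn; first by lia.
have id : (i < d)%N by lia.
have i0 : (i == 0)%N = false by lia.
rewrite (path_sum_position _ T_path) // GE // [path_eval i n _]raddfD /= mulrDr addrC; congr (_ + _).
  rewrite path_eval_Poly_end // L'E; last by lia.
  rewrite rmorph_sum mulr_suml mulr_sumr; apply: eq_bigr => m _.
  rewrite place_head; last by lia.
  rewrite /head_scal /hd i0 addr0 mulr1 rmorphM /= [in RHS]mulrCA [v d * _]mulrA.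
  by rewrite divff ?v_neq0 // mul1r.
rewrite [path_eval i n _]raddf_sum mulr_sumr; apply: eq_big_nat => s hs.
have bn := @bound_next c n i s ltac:(lia).
rewrite (@upper_path_eval T (v d) s _ A (G s)) //; first last.
- move=> a ha; apply: IH; [lia|lia|].
  by apply: le_trans hn; apply: le_trans bn; lia.
- apply: le_trans hn; apply: le_trans bn.
  by rewrite lerDl mulr_ge0.
- by move=> n' n0; apply: T_neg => //; lia.
- lia.
rewrite -/(g s) z_mvar; last by lia.
have -> : mvar s ^+ 2 * g s * G s = mvar s * (mvar s * (g s * G s)) by ring.
rewrite /= path_eval_Poly_block; [|lia|]; last first.
  apply: supportedM; first by apply: supportedX; lia.
  by apply: supportedM; [apply: supported_g; lia|apply: supported_G; lia].
rewrite mulrCA; congr (_ * _).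
rewrite L'E; last by lia.
rewrite rmorph_sum mulr_suml; apply: eq_bigr => m _.
rewrite place_head; last by lia.
by rewrite /head_scal /hd i0 addr0 mulr1 rmorphM.
Qed.

Lemma reindex_sum (x : K) (f : int -> K) e : (e <= d)%N ->
  (forall n, n < 0 -> f n = 0) -> (forall n, B%:Z <= n -> f n = 0) ->
  \sum_(0 <= n < B + d) x ^+ n * f (n%:Z - e%:Z) =
  x ^+ e * \sum_(0 <= n < B) x ^+ n * f n%:Z.
Proof.
move=> ed fneg fbig.
rewrite (@big_cat_nat _ _ _ e 0) /=; [|lia|lia].
rewrite [X in X + _]big_nat [X in X + _]big1 ?add0r => [|n hn]; last first.
  by rewrite fneg ?mulr0 //; lia.
rewrite (@big_cat_nat _ _ _ (B + e)%N) /=; [|lia|lia].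
rewrite [X in _ + X]big_nat [X in _ + X]big1 ?addr0 => [|n hn]; last first.
  by rewrite fbig ?mulr0 //; lia.
rewrite -{1}[e]add0n big_addn addnK mulr_sumr; apply: eq_bigr => n _.
by rewrite exprD PoszD addrK; ring.
Qed.

(** The exponent e of x lowers the index of the first constants by e; moving the summation variable
    trades this for v_0^e, the value of x^e. *)
Lemma first_block_reindex s (H : int -> K) : (0 < s <= d)%N ->
  \sum_(0 <= n < B + d) v 0 ^+ n * (emb (L' n%:Z s) * H (n%:Z - c * s%:Z)) =
  \sum_(m <- msupp (Pol s)) emb (mcoeff m (Pol s)) * v 0 ^+ expo m 0 *
    \sum_(0 <= n < B) v 0 ^+ n * (emb (chain_prod L b n%:Z 1 (inner_expo (expo m) 0 s)) *
        H (n%:Z + (expo m 0)%:Z - c * s%:Z)).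
Proof.
move=> hs.
transitivity (\sum_(m <- msupp (Pol s)) emb (mcoeff m (Pol s)) *
   \sum_(0 <= n < B + d) v 0 ^+ n * (emb (chain_prod L b (n%:Z - (expo m 0)%:Z) 1 (inner_expo (expo m) 0 s)) *
     H (n%:Z - (expo m 0)%:Z + (expo m 0)%:Z - c * s%:Z))).
  under [RHS]eq_bigr => m _ do rewrite mulr_sumr.
  rewrite exchange_big; apply: eq_bigr => n _ /=.
  rewrite L'E; last by lia.
  rewrite rmorph_sum mulr_suml mulr_sumr; apply: eq_bigr => m _.
  by rewrite rmorphM subrK; ring.
apply: eq_big_seq => m ms; rewrite -mulrA; congr (_ * _).
have ed : (expo m 0 <= d)%N.
  have s0 : (0 < s)%N by lia.
  by have := sum_expo s0 ms; rewrite big_ltn //; lia.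
apply: (reindex_sum (v 0) (f := fun n => emb (chain_prod L b n 1 (inner_expo (expo m) 0 s)) *
   H (n + (expo m 0)%:Z - c * s%:Z)) ed).
- by move=> n n0; rewrite (chain_prod_neg _ L_neg) // rmorph0 mul0r.
move=> n nB; rewrite (chain_prod_big _ L_big) ?rmorph0 ?mul0r //.
by rewrite size_map size_iota; lia.
Qed.

Lemma upper_path_total s (r : int) : (0 < s < d)%N -> r + `|c| * (d - s)%:Z <= A%:Z ->
  upper_path w T (d - s) r = v d * path_eval s r (mvar s * (g s * G s)).
Proof.
move=> hs hr; apply: upper_path_eval => //.
- by move=> n n0; apply: T_neg => //; lia.
- by apply: le_trans hr; rewrite lerDl mulr_ge0.
- by move=> a ha; apply: level_path_eval => //; apply: le_trans hr; lia.
Qed.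

Lemma bound_A : (B + d)%:Z + `|c| * d%:Z <= A%:Z.
Proof.
have h := le_c; rewrite /A.
have : `|c| * d%:Z <= (`|b| + 1) * d%:Z by apply: ler_wpM2r.
rewrite !absz_norm; lia.
Qed.

Lemma level_total : \sum_(0 <= n < B + d) v 0 ^+ n * T d n%:Z =
  v d * \sum_(0 <= n < B) v 0 ^+ n * path_eval 0 n%:Z (G 0).
Proof.
have TE n : T d n%:Z = \sum_(1 <= s < d) emb (L' n%:Z s) * upper_path w T (d - s) (n%:Z - c * s%:Z) +
   emb (L' n%:Z d) * v d ^ (- (n%:Z - c * d%:Z)).
  rewrite -{1}[d]subn0 (path_sum_position _ T_path) // subn0; congr (_ + _).
  by apply: eq_bigr => s _; rewrite subn0.
transitivity (\sum_(1 <= s < d) \sum_(0 <= n < B + d) v 0 ^+ n *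
     (emb (L' n%:Z s) * upper_path w T (d - s) (n%:Z - c * s%:Z)) +
   \sum_(0 <= n < B + d) v 0 ^+ n * (emb (L' n%:Z d) * v d ^ (- (n%:Z - c * d%:Z)))).
  rewrite exchange_big -big_split; apply: eq_bigr => n _ /=.
  by rewrite TE mulrDr mulr_sumr.
transitivity (\sum_(1 <= s < d) v d * \sum_(0 <= n < B) v 0 ^+ n *
    path_eval 0 n%:Z (Poly_block 0 s * (z s ^+ 2 * g s * G s)) +
    v d * \sum_(0 <= n < B) v 0 ^+ n * path_eval 0 n%:Z (Poly_block 0 d)); last first.
  rewrite GE // -mulr_sumr -mulrDr exchange_big -big_split; congr (_ * _).
  apply: eq_bigr => n _; rewrite [path_eval 0 _ (_ + _)]raddfD addrC mulrDr /=; congr (_ + _).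
  by rewrite [path_eval 0 _ _]raddf_sum mulr_sumr.
congr (_ + _); last first.
  rewrite (first_block_reindex (fun r => v d ^ (- r))); last by lia.
  transitivity (\sum_(0 <= n < B) v d * (v 0 ^+ n * path_eval 0 n%:Z (Poly_block 0 d))); last first.
    by rewrite mulr_sumr.
  under eq_bigr => m _ do rewrite mulr_sumr.
  rewrite exchange_big; apply: eq_bigr => n _ /=.
  rewrite path_eval_Poly_end // !subn0 !mulr_sumr; apply: eq_bigr => m _.
  rewrite place_head0; last by lia.
  rewrite /head_scal /hd /=.
  rewrite -[v d ^ _ in LHS]mul1r -(divff (v_neq0 (leqnn d))); ring.
apply: eq_big_nat => s hs.
rewrite (first_block_reindex (fun r => upper_path w T (d - s) r)); last by lia.
rewrite mulr_sumr.
under eq_bigr => m _ do rewrite mulr_sumr.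
rewrite exchange_big; apply: eq_big_nat => n hn /=.
rewrite z_mvar; last by lia.
have -> : mvar s ^+ 2 * g s * G s = mvar s * (mvar s * (g s * G s)) by ring.
rewrite path_eval_Poly_block; [|lia|]; last first.
  apply: supportedM; first by apply: supportedX; lia.
  by apply: supportedM; [apply: supported_g; lia|apply: supported_G; lia].
rewrite !mulr_sumr subn0; apply: eq_big_seq => m ms.
rewrite place_head0; last by lia.
rewrite /head_scal /hd /= upper_path_total; [ring|lia|].
have ed : (expo m 0 < s)%N.
  have s0 : (0 < s)%N by lia.
  by have := sum_expo s0 ms; rewrite big_ltn //; lia.
have := bound_A; have := @bound_next c (n%:Z + (expo m 0)%:Z) 0 s ltac:(lia).
rewrite !subn0; move: (`|c| * d%:Z) => Y; move: (`|c| * (d - s)%:Z) => Z0; lia.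
Qed.

Lemma prod_1D_telescope (t : nat -> Rg) i : (i <= d)%N ->
  \prod_(i <= j < d) (1 + t j) = 1 + \sum_(i <= s < d) t s * \prod_(s.+1 <= j < d) (1 + t j).
Proof.
move=> id; have [n hn] : exists n, (d - i <= n)%N by exists (d - i)%N.
elim: n i id hn => [|n IH] i id hn.
  have -> : i = d by lia.
  by rewrite !big_geq ?addr0.
have [->|ne] := eqVneq i d; first by rewrite !big_geq ?addr0.
rewrite big_ltn; last by lia.
rewrite [in RHS]big_ltn; last by lia.
by rewrite mulrDl mul1r {1}IH; [ring|lia|lia].
Qed.

Let g1 (j : nat) : Rg := \sum_(0 <= k < A.-1) (v j)^-1 ^+ k.+1 *: mvar j ^+ k.

(** The two terms are the two ways of passing position j: 1 lets the current block grow, a multiple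
    of z_j closes it. *)
Lemma gE j : (j <= d)%N -> v j *: g j = 1 + mvar j * g1 j.
Proof.
move=> jd; rewrite /g -[A]/(A.-1.+1) big_nat_recl //= scalerDr; congr (_ + _).
  by rewrite expr0 expr1 scalerA divff ?v_neq0 // scale1r.
rewrite mulr_sumr scaler_sumr; apply: eq_bigr => k _.
by rewrite scalerA -scalerAr -exprS exprS mulrA divff ?v_neq0 // mul1r.
Qed.

Lemma supported_prod_g i : supported i (\prod_(i.+1 <= j < d) (v j *: g j)).
Proof.
rewrite big_nat; apply: (big_ind (supported i)) => [||j hj].
- exact: supported1.
- by move=> p q; apply: supportedM.
- by apply/supportedZ/supported_g; lia.
Qed.

Lemma inner_expo0 i s : inner_expo (fun=> 0%N) i s = nseq (s - i.+1) 0%N.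
Proof.
by rewrite /inner_expo; move: (s - i.+1)%N => l; elim: l i.+1 => //= l IH k; rewrite IH.
Qed.

(** Expanding the product by the first s where the multiple of z_s is chosen: the skipped factors 1
    add up to a constant of degree s - i, and the rest is the chain from s. *)
Lemma upper_level_path_eval i n : (i < d)%N -> n + `|b| * (d - i)%:Z <= A.-1%:Z ->
  Tp (d - i)%N n = path_eval i n (\prod_(i.+1 <= j < d) (v j *: g j)).
Proof.
have [k hk] : exists k, (d - i <= k)%N by exists (d - i)%N.
elim: k i n hk => [|k IH] i n hk id hn; first by lia.
have XX0 : monom (fun=> 0%N) = 1.
  by rewrite /monom -mpolyX0; congr mpolyX; apply/mnmP => j; rewrite mnm_funE mnm0E.
have gE (m : nat) : \prod_(m.+1 <= j < d) (v j *: g j) = \prod_(m.+1 <= j < d) (1 + mvar j * g1 j).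
  by apply: eq_big_nat => j hj; rewrite gE //; lia.
rewrite (path_sum_position _ Tp_path) // gE prod_1D_telescope // [path_eval i n _]raddfD /= addrC.
congr (_ + _).
  rewrite -XX0 path_evalX // /mono_eval inner_expo0 chain_prod_nseq0; congr (emb (L _ _) * _ ^ _); first by lia.
    by lia.
  by rewrite big1_eq; ring.
rewrite [path_eval i n _]raddf_sum; apply: eq_big_nat => s hs /=.
have bn := @bound_next b n i s ltac:(lia).
have h1 (p : Rg) : p = monom (fun=> 0%N) * p by rewrite XX0 mul1r.
rewrite -gE -mulrA [mvar s * _]h1 path_eval_block; [|lia|by []|]; last first.
  apply: supportedM; last exact: supported_prod_g.
  apply: supported_sum => q _; apply/supportedZ/supported_exp/supportedX; lia.
rewrite inner_expo0 chain_prod_nseq0 subr0; congr (emb (L _ _) * _); first by lia.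
rewrite (@upper_path_eval Tp 1 s _ A.-1 (\prod_(s.+1 <= j < d) (v j *: g j))) //.
- have -> : mvar s * (g1 s * \prod_(s.+1 <= j < d) (v j *: g j)) =
    mvar s ^+ 1 * (g1 s * \prod_(s.+1 <= j < d) (v j *: g j)) by [].
  rewrite mul1r path_eval_shift; last by lia.
  by rewrite big1_eq; congr (path_eval _ _ _); ring.
- lia.
- by move=> n' n0; apply: Tp_neg => //; lia.
- apply: le_trans hn; apply: le_trans bn; by rewrite lerDl mulr_ge0.
- move=> a ha; rewrite mul1r; apply: IH; [lia|lia|].
  by apply: le_trans hn; apply: le_trans bn; lia.
Qed.

(* The ideal of the polynomials that no path can detect. *)
Let null (p : Rg) : Prop := forall (n : nat) q, (n < B)%N -> path_eval 0 n%:Z (q * p) = 0.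

Lemma nullD p q : null p -> null q -> null (p + q).
Proof. by move=> hp hq n r nB; rewrite mulrDr [path_eval _ _ _]raddfD /= hp ?hq ?addr0. Qed.

Lemma nullM p q : null q -> null (p * q).
Proof. by move=> hq n r nB; rewrite mulrA hq. Qed.

Lemma null_mvar j : (0 < j < d)%N -> null (mvar j ^+ A).
Proof.
move=> hj n q nB; rewrite mulrC path_eval_mul big1 // => m _.
rewrite mvar_exp; last by lia.
rewrite monomD path_evalX // /mono_eval (@chain_prod_large L b L_neg _ _ _ A (A + expo m j)) ?rmorph0 ?mul0r ?mulr0 ?leq_addr //.
  rewrite size_map size_iota /A subn1 add1n prednK // absz_norm.
  move: (_ + expo m 0)%N => e0; nia.
apply/mapP; exists j; rewrite ?mem_iota ?eqxx //; lia.
Qed.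

Lemma null_g j : (0 < j < d)%N -> null (g j * (cst (v j) - z j) - 1).
Proof.
move=> hj; rewrite z_mvar //.
have jd : (j <= d)%N by lia.
have -> : g j * (cst (v j) - mvar j) - 1 = - cst ((v j)^-1 ^+ A) * mvar j ^+ A.
  pose f k := - ((v j)^-1 ^+ k *: mvar j ^+ k).
  have -> : g j * (cst (v j) - mvar j) = \sum_(0 <= k < A) (f k.+1 - f k).
    rewrite mulr_suml; apply: eq_bigr => k _.
    rewrite mulrBr [_ * cst _]mulrC mul_mpolyC scalerA -scalerAl -exprSr.
    by rewrite exprS mulrA divff ?v_neq0 // mul1r /f opprK addrC -exprS.
  by rewrite telescope_sumr // /f !expr0 scale1r opprK addrK mulNr mul_mpolyC.
exact/nullM/null_mvar.
Qed.

(** [K_prod] applied with the ideal [null] and the step tau = -1. Of each resulting v_j^2 g_j one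
    factor v_j comes out, and the product of the v_j g_j evaluates the chains for N + 1. *)
Lemma path_eval_total n : (n < B)%N ->
  path_eval 0 n%:Z (G 0) = (\prod_(1 <= j < d) v j) * Tp d n%:Z.
Proof.
move=> nB.
have [P [Q [De [fam PzP]]]] := @Pol_family Rg (cst \o emb) d z
  ltac:(by move=> j dj; rewrite /z !gtn_eqF ?ltnNge ?(ltnW dj) //; lia).
have PzE' i s : (i < s <= d)%N -> (P i (s - i)%N).[z i] = Poly_block i s.
  by move=> hs; rewrite PzP //; lia.
pose F p q Kf := (P p (q - p)%N).[cst (v p)] +
  \sum_(p.+1 <= s < q) Kf s * (z s ^+ 2 * g s * (P s (q - s)%N).[z s]).
pose Kern p := strong_rec 0 (F p).
have KE p q : (p < q)%N -> Kern p q = (P p (q - p)%N).[cst (v p)] +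
    \sum_(p.+1 <= s < q) Kern p s * (z s ^+ 2 * g s * (P s (q - s)%N).[z s]).
  move=> _; rewrite {1}/Kern strong_recE // => m f f' ff'; rewrite /F; congr (_ + _).
  by apply: eq_big_nat => s hs; rewrite ff' //; lia.
have z0 : z 0 = cst (v 0) by rewrite /z.
have zd : z d = cst (v d) by rewrite /z gtn_eqF // ltnn eqxx.
have vS j : cst (v j.+1) = cst (v j) + cst (-1).
  by rewrite -mpolyCD /v -natr1; congr (cst _); ring.
have null_end : null (cst (v d) - z d).
  by rewrite zd subrr => m q _; rewrite mulr0 raddf0.
have := @K_prod Rg null nullD nullM d z (fun j => cst (v j)) g (cst (-1)) P Q De
  fam vS null_g null_end Kern KE 0 d0 n 1 nB.
have -> : Kern 0 d = G 0.
  (* [Kern] splits off the last block of a chain, [G] the first. *)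
  apply: (@first_last_decomposition Rg d Poly_block (fun s => z s ^+ 2 * g s)) => //.
    move=> q hq; rewrite KE; last by lia.
    rewrite -z0 PzE'; last by lia.
    congr (_ + _); apply: eq_big_nat => s hs; rewrite PzE' //; lia.
  by move=> i /GE ->; congr (_ + _).
rewrite mul1r [path_eval 0 _ _]raddfB /= => /eqP; rewrite subr_eq0 => /eqP ->.
have -> : Tp d n%:Z = path_eval 0 n%:Z (\prod_(1 <= j < d) (v j *: g j)).
  by rewrite -[d in LHS]subn0 upper_level_path_eval // subn0 /A /= absz_norm; nia.
rewrite -path_evalZ; congr (path_eval _ _ _).
rewrite -mul_mpolyC rmorph_prod /= -big_split; apply: eq_bigr => j _ /=.
by rewrite -mul_mpolyC; ring.
Qed.

(** The factor w 0 = v_d stems from [level_total], the other ones from [path_eval_total]. *)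
Lemma level_step : \sum_(0 <= n < B + d) w d ^+ n * T d n%:Z =
  (\prod_(0 <= f < d) w f) * \sum_(0 <= n < B) w d ^+ n * Tp d n%:Z.
Proof.
have -> : w d = v 0 by rewrite vE ?subn0.
rewrite level_total !mulr_sumr; apply: eq_big_nat => n nB; rewrite path_eval_total //.
have -> : \prod_(0 <= f < d) w f = v d * \prod_(1 <= j < d) v j.
  rewrite -[RHS]mulrC -big_nat_recr // big_add1 big_nat_rev /=.
  by apply: eq_big_nat => j hj; rewrite vE ?add0n; [congr w|]; lia.
by ring.
Qed.
End LevelStep.

(** * The virtual structure constants *)

Section Blocks.
Variables (L : int -> nat -> rat) (b : int) (e : nat -> nat).

(** [chain_prod] read along the list of block ends, p being the last end passed, to match
    [mon_indices]. *)
Fixpoint block_prod (n : int) (p : nat) (s : seq nat) : rat :=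
  if s is i :: s' then
    L n (i - p)%N * block_prod (n - b * (i - p)%:Z - (e i)%:Z) i s'
  else 1.

Lemma chain_prod_blocks d p q n : (p < q <= d)%N ->
  chain_prod L b n (q - p) [seq e j | j <- iota q (d - q)] =
  block_prod n p ([seq j <- iota q (d - q) | 0 < e j]%N ++ [:: d]).
Proof.
have [r er] : exists r, (d - q = r)%N by exists (d - q)%N.
rewrite er; elim: r p q n er => [|r IH] p q n er hq /=.
  by rewrite mulr1; congr (L _ _); lia.
rewrite lt0n; case: (eqVneq (e q) 0%N) => [e0|ne] /=.
  by rewrite -subSn ?IH //; lia.
congr (_ * _); rewrite -[1%N in LHS](subSnn q) IH //; lia.
Qed.

Lemma block_prodE n p s : (path ltn p s) ->
  block_prod n p s = \prod_(1 <= j < (size s).+1)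
    L (n - b * (nth 0%N (p :: s) j.-1 - p)%:Z - (\sum_(1 <= a < j) e (nth 0%N (p :: s) a))%:Z)
      (nth 0%N (p :: s) j - nth 0%N (p :: s) j.-1)%N.
Proof.
elim: s n p => [|i s IH] n p /=; first by rewrite big_geq.
case/andP => pi pis; rewrite big_ltn // big_geq // subnn mulr0 !subr0; congr (_ * _).
rewrite big_add1 /= IH //; apply: eq_big_nat => j hj.
case: j hj => // j hj; congr (L _ _).
rewrite [\sum_(1 <= a < j.+2) _]big_ltn // [\sum_(2 <= a < _) _]big_add1 /=.
have ij : (i <= nth 0%N (i :: s) j)%N.
  case: j hj => [|j] hj //=; apply: ltnW; apply: (allP (order_path_min ltn_trans pis)).
  by apply/mem_nth; case/andP: hj => _ /ltnW.
rewrite PoszD; have -> : ((nth 0%N (i :: s) j - p)%:Z =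
  (nth 0%N (i :: s) j - i)%:Z + (i - p)%:Z)%R by lia.
by ring.
Qed.
End Blocks.

Lemma mon_indices_filter d (m : multinom d.+1) :
  mon_indices m = [seq j <- iota 0 d.+1 | [|| j == 0%N, j == d | (0 < expo m j)%N]].
Proof.
rewrite -val_enum_ord filter_map; congr map; apply: eq_filter => i /=.
by rewrite /expo inord_val -!val_eqE.
Qed.

Lemma mon_indicesE d (m : multinom d.+1) : (0 < d)%N ->
  mon_indices m = 0%N :: ([seq j <- iota 1 (d - 1) | 0 < expo m j]%N ++ [:: d]).
Proof.
move=> d0; rewrite mon_indices_filter.
have -> : iota 0 d.+1 = 0%N :: (iota 1 (d - 1) ++ [:: d]).
  by rewrite /= subn1 -{1}(prednK d0) -[(d.-1).+1]addn1 iotaD /= add1n prednK.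
rewrite /= filter_cat /= eqxx orbT; congr (_ :: (_ ++ _)).
by apply/eq_in_filter => j; rewrite mem_iota => hj; rewrite gtn_eqF ?ltn_eqF //; lia.
Qed.

Lemma sum_mon_indices d (m : multinom d.+1) : (0 < d)%N ->
  (\sum_(i <- mon_indices m) expo m i = mdeg m)%N.
Proof.
move=> d0; rewrite mdegE /mon_indices big_map big_filter big_enum_cond /=.
rewrite [RHS](bigID (fun i => [|| i == ord0, i == ord_max | (0 < m i)%N])) /=.
rewrite [X in _ = (_ + X)%N]big1 ?addn0 => [|i].
  by apply: eq_bigr => i _; rewrite /expo inord_val.
by rewrite !negb_or -leqNgt leqn0 => /and3P[_ _ /eqP].
Qed.

(** [vsc_delta] adds the exponents from block j onwards, [chain_prod] subtracts the earlier ones;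
    they agree because all exponents add up to d - 1. *)
Lemma vsc_monomialE k N L n d (m : multinom d.+1) : (0 < d)%N -> mdeg m = d.-1 ->
  vsc_monomial k N L n m =
  chain_prod L (k%:Z - (N + 1)) (n - (expo m 0)%:Z) 1 (inner_expo (expo m) 0 d).
Proof.
move=> d0 md; rewrite /inner_expo (@chain_prod_blocks _ _ _ d 0 1) //.
have : sorted ltn (mon_indices m).
  by rewrite mon_indices_filter; apply: (sorted_filter ltn_trans); apply: iota_ltn_sorted.
rewrite mon_indicesE // => /= sorted_ind.
rewrite block_prodE // -mon_indicesE // /vsc_monomial.
have sz : (0 < size (mon_indices m))%N by rewrite mon_indicesE.
have -> : (size ([seq j <- iota 1 (d - 1) | 0 < expo m j]%N ++ [:: d])) = (size (mon_indices m)).-1.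
  by rewrite mon_indicesE.
apply: eq_big_nat => j hj; congr (L _ _).
have := sum_mon_indices m d0; rewrite md (big_nth 0%N) -(prednK sz).
have i0 : nth 0%N (mon_indices m) 0 = 0%N by rewrite mon_indicesE.
rewrite /vsc_delta; set l := (size (mon_indices m)).-1 in hj *.
have hj' : (0 < j <= l)%N by lia.
rewrite big_nat_recr //= (@big_cat_nat _ _ _ j) /=; [|lia|lia].
rewrite big_ltn ?i0; last by lia.
rewrite -/(expo m (nth 0%N (mon_indices m) l)).
have -> : \sum_(j <= a < l) ((m (inord (nth 0%N (mon_indices m) a)))%:Z - 1) =
    (\sum_(j <= a < l) expo m (nth 0%N (mon_indices m) a))%:Z - (l - j)%:Z.
  rewrite sumrB; congr (_ - _); last by rewrite sumr_const_nat natz.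
  by rewrite (big_morph Posz PoszD (erefl 0%:Z)).
move: (\sum_(1 <= a < j) _)%N (\sum_(j <= a < l) _)%N => S1 S2.
have -> : (l - j)%:Z = l%:Z - j%:Z by lia.
have -> : (j.-1)%:Z = j%:Z - 1 by lia.
rewrite subn0 => e.
have {}e : (expo m 0)%:Z + S1%:Z + S2%:Z + (expo m (nth 0%N (mon_indices m) l))%:Z = d%:Z - 1 by lia.
have -> : (expo m 0)%:Z = d%:Z - 1 - S1%:Z - S2%:Z - (expo m (nth 0%N (mon_indices m) l))%:Z by lia.
by ring.
Qed.

Lemma chain_prod_above L b (U : int) n D s :
  (forall n D, (0 < D)%N -> U + b * D%:Z < n -> L n D = 0) -> (0 < D)%N ->
  U + b * (D + size s)%:Z + (sumn s)%:Z < n -> chain_prod L b n D s = 0.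
Proof.
move=> hL; elim: s n D => [|a s IH] n D D0 /=.
  by rewrite addn0 addr0; apply: hL.
move=> h; case: eqP => [a0|_]; first by rewrite IH //; move: h; rewrite a0 addSnnS.
rewrite [X in _ * X]IH ?mulr0 //.
have e : ((D + (size s).+1)%:Z = D%:Z + (1 + size s)%:Z)%R by lia.
rewrite e mulrDr PoszD in h; move: (b * _) (b * _) h => X Y; lia.
Qed.

Lemma vsc_recS R k t n D : (0 < D)%N -> vsc_rec R k t.+1 n D =
  \sum_(m <- msupp (Poly_d R D)) mcoeff m (Poly_d R D) *
    chain_prod (vsc_rec R k t) (t%:Z - k%:Z) (n - (expo m 0)%:Z) 1 (inner_expo (expo m) 0 D).
Proof.
move=> D0; rewrite /= /vsc_phi; apply: eq_big_seq => m ms; congr (_ * _).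
have [/dhomogP/(_ m ms) /= hm _] := Poly_dP R D0.
rewrite vsc_monomialE //; congr (chain_prod _ _ _ _ _); lia.
Qed.

Lemma sumn_inner_expo d (m : multinom d.+1) : (0 < d)%N ->
  (expo m 0 + sumn (inner_expo (expo m) 0 d) <= mdeg m)%N.
Proof.
move=> d0; have -> : mdeg m = (\sum_(0 <= j < d.+1) expo m j)%N.
  by rewrite mdegE big_mkord; apply: eq_bigr => i _; rewrite /expo inord_val.
rewrite big_ltn // big_nat_recr //= /inner_expo sumnE big_map.
by rewrite addnA leq_addr.
Qed.

Definition init_poly (k : nat) : {poly rat} :=
  k%:R *: \prod_(1 <= j < k) (j%:R *: 'X + (k - j)%:R%:P).

Lemma size_init_poly k : (size (init_poly k) <= k)%N.
Proof.
rewrite /init_poly; case: k => [|k]; first by rewrite scale0r size_poly0.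
apply: (leq_trans (size_scale_leq _ _)).
have size2 a b : (size (a *: 'X + b%:P : {poly rat})%R <= 2)%N.
  by rewrite -mul_polyC size_MXaddC; case: ifP => // _; rewrite ltnS size_polyC leq_b1.
move: {2}k.+1 => k'; elim: k => [|k IH]; first by rewrite big_geq // size_poly1.
rewrite big_nat_recr //=; apply: (leq_trans (size_polyMleq _ _)).
by rewrite -subn1 leq_subLR (leq_trans (leq_add IH (size2 _ _))) // addn2.
Qed.

(** From t to t + 1 the upper bound rises by D - 1, the degree of [Poly_d] R D, which is the most
    that the exponents of a monomial can take off the index. *)
Lemma vsc_rec_eq0 R k t n D : (0 < D)%N ->
  (n < 0) || ((2 * k)%:Z - t%:Z - 1 + (t%:Z - k%:Z) * D%:Z < n) ->
  vsc_rec R k t n D = 0.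
Proof.
elim: t n D => [|t IH] n D D0 h.
  rewrite /= /vsc_init; case: n h => [n|n] h; last by case: D D0 h.
  case: D D0 h => [|[|D]] // _ /= h.
  apply: nth_default; apply: (leq_trans (size_init_poly k)); lia.
rewrite vsc_recS // big_seq big1 // => m ms.
have [/dhomogP/(_ m ms) /= hm _] := Poly_dP R D0.
have := sumn_inner_expo m D0; rewrite hm => hs.
have neg n' D' : (0 < D')%N -> n' < 0 -> vsc_rec R k t n' D' = 0.
  by move=> D'0 n'0; rewrite IH // n'0.
case/orP: h => h; first by rewrite (chain_prod_neg _ neg) ?mulr0 //; lia.
rewrite (@chain_prod_above _ _ ((2 * k)%:Z - t%:Z - 1)) ?mulr0 //.
  by move=> n' D' D'0 h'; rewrite IH // h' orbT.
have -> : (1 + size (inner_expo (expo m) 0 D) = D)%N by rewrite size_map size_iota; lia.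
move: h; have -> : (t.+1%:Z - k%:Z) * D%:Z = (t%:Z - k%:Z) * D%:Z + D%:Z by rewrite -addn1 PoszD; ring.
move: (_ * _) => X; lia.
Qed.

(** * Totals of the path sums, from N = 2k downwards *)

Section PathTotal.
Variables (K : fieldType) (w : nat -> K).

Lemma path_sum_exists a c : exists T, path_sum w a c T.
Proof.
pose F (f : nat) (T : nat -> int -> K) (n : int) := \sum_(1 <= D < f.+1)
    a n D * upper_path w T (f - D)%N (n - c * D%:Z).
exists (strong_rec (fun=> 0) F) => f n f0.
rewrite {1}strong_recE // => m T1 T2 e; apply/funext => n'.
rewrite /F; apply: eq_big_nat => D hD; rewrite /upper_path.
case: eqP => // _; congr (_ * (_ * _)); apply: eq_bigr => i _; rewrite e //; lia.
Qed.

Lemma path_total_bound a c T f X Y : path_sum w a c T -> (0 < f)%N -> (X <= Y)%N ->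
  (forall n D, (0 < D <= f)%N -> X%:Z <= n -> a n D = 0) ->
  \sum_(0 <= n < Y) w f ^+ n * T f n%:Z = \sum_(0 <= n < X) w f ^+ n * T f n%:Z.
Proof.
move=> hT f0 XY ha; rewrite (@big_cat_nat _ _ _ X) //=.
rewrite [X in _ + X]big_nat [X in _ + X]big1 ?addr0 // => n hn.
rewrite (path_sum_eq0 hT f0) ?mulr0 // => D hD; rewrite ha //; lia.
Qed.
End PathTotal.

Section Total.
Variables (R : realType) (k : nat).
Hypothesis k0 : (0 < k)%N.
Variables (K : fieldType) (emb : {rmorphism rat -> K}) (y0 : K).
Let w (f : nat) : K := y0 + f%:R.
Hypothesis w_neq0 : forall f, w f != 0.

(* The ratio of the coefficients of e^{(f+1)x} and e^{fx} in F_oo, for the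
   parameter N = 2k - t. *)
Definition step_factor (t f : nat) : K :=
  k%:R * \prod_(1 <= j < k) (k%:R * w f + j%:R) * w f ^ (t%:Z - (2 * k)%:Z + 1).

(** At w_{f+1} / w_f, where w_{f+1} = w_f + 1, the factor j X + k - j equals (k w_f + j) / w_f. *)
Lemma init_poly_horner f :
  \sum_(0 <= n < k) w f.+1 ^+ n * (emb (vsc_init k n%:Z 1) * w f ^ (- (n%:Z + k%:Z))) =
  step_factor 0 f.
Proof.
transitivity (w f ^ (- k%:Z) * (map_poly emb (init_poly k)).[w f.+1 / w f]).
  rewrite (@horner_coef_wide _ k); last by rewrite size_map_poly; apply: size_init_poly.
  rewrite mulr_sumr big_mkord; apply: eq_bigr => n _.
  rewrite coef_map /= opprD expfzDr // expr_div_n -!exprnN -/(init_poly k); ring.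
rewrite /step_factor /init_poly linearZ /= rmorph_nat rmorph_prod hornerZ horner_prod.
have -> : \prod_(1 <= j < k) (map_poly emb (j%:R *: 'X + (k - j)%:R%:P)).[w f.+1 / w f] =
  \prod_(1 <= j < k) ((k%:R * w f + j%:R) * (w f)^-1).
  apply: eq_big_nat => j hj.
  rewrite rmorphD /= linearZ /= map_polyX map_polyC /= hornerD hornerZ hornerX hornerC !rmorph_nat.
  have -> : w f.+1 = w f + 1 by rewrite /w -natr1 addrA.
  have -> : (k - j)%:R = k%:R - j%:R :> K by rewrite natrB //; lia.
  by field.
rewrite big_split /= prodr_const_nat exprVn mulrCA -!mulrA; congr (_ * _).
rewrite mulrCA; congr (_ * _); rewrite exprnN -expfzDr //; congr (_ ^ _); lia.
Qed.

Lemma vsc_init_eq0 n D : (1 < D)%N -> vsc_init k n D = 0.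
Proof. by case: n D => n [|[|D]]. Qed.

Lemma vsc_init_big n D : k%:Z <= n -> vsc_init k n D = 0.
Proof.
case: n => // n kn; case: D => [|[|D]] //=.
by apply: nth_default; apply: (leq_trans (size_init_poly k)).
Qed.

Lemma total_init d T : (0 < d)%N ->
  path_sum w (fun n D => emb (vsc_init k n D)) (- k%:Z) T ->
  \sum_(0 <= n < k) w d ^+ n * T d n%:Z = \prod_(0 <= f < d) step_factor 0 f.
Proof.
move=> + hT; elim: d => // d IH _.
transitivity (\sum_(0 <= n < k) w d.+1 ^+ n * (emb (vsc_init k n%:Z 1) * w d ^ (- (n%:Z + k%:Z))) *
   \prod_(0 <= f < d) step_factor 0 f); last first.
  by rewrite -mulr_suml init_poly_horner big_nat_recr //= mulrC.
apply: eq_bigr => n _; rewrite -!mulrA; congr (_ * _).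
rewrite hT // [LHS]big_ltn // subn1 [X in _ + X = _](_ : _ = 0) ?addr0; last first.
  rewrite big_nat big1 // => D hD; rewrite vsc_init_eq0 ?rmorph0 ?mul0r //; lia.
congr (_ * _); rewrite mulr1 opprK /upper_path /=.
case: eqP => [->|/eqP d0]; first by rewrite big_geq // mulr1.
congr (_ * _); rewrite -IH ?lt0n //=.
(* The cut-off n + k is at least k, where the constants end: the inner sum is the full total of
   degree d for every n. *)
apply: (path_total_bound hT); rewrite ?lt0n ?leq_addl // => m D _ km.
by rewrite vsc_init_big ?rmorph0.
Qed.

Lemma step_factorS t f : step_factor t.+1 f = w f * step_factor t f.
Proof.
rewrite /step_factor [RHS]mulrCA; congr (_ * _).
have -> : t.+1%:Z - (2 * k)%:Z + 1 = 1 + (t%:Z - (2 * k)%:Z + 1) by lia.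
by rewrite [LHS]expfzDr.
Qed.

(** Each unit step in t multiplies the total by the w f, by [level_step], and the expected product
    likewise, by [step_factorS]. *)
Lemma total_vsc_rec t d T X : (0 < d)%N ->
  path_sum w (fun n D => emb (vsc_rec R k t n D)) (t%:Z - k%:Z) T ->
  (forall n D, (0 < D <= d)%N -> X%:Z <= n -> vsc_rec R k t n D = 0) ->
  \sum_(0 <= n < X) w d ^+ n * T d n%:Z = \prod_(0 <= f < d) step_factor t f.
Proof.
move=> d0; elim: t T X => [|t IH] T X hT hX.
  rewrite sub0r in hT; rewrite -(total_init d0 hT).
  transitivity (\sum_(0 <= n < X + k) w d ^+ n * T d n%:Z).
    by apply/esym/(path_total_bound hT); rewrite ?leq_addr // => n D hD hn; rewrite hX ?rmorph0.
  apply: (path_total_bound hT); rewrite ?leq_addl // => n D hD hn.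
  by rewrite -[vsc_rec _ _ _ _ _]/(vsc_init k n D) vsc_init_big ?rmorph0.
have [Tp hTp] := path_sum_exists w (fun n D => emb (vsc_rec R k t n D)) (t%:Z - k%:Z).
(* Beyond the support of all constants of degree at most d, by [vsc_rec_eq0], and at least X. *)
pose B := (X + (2 * k) + (t + k) * d)%N.
have hB n D : (0 < D <= d)%N -> B%:Z <= n -> vsc_rec R k t n D = 0.
  by move=> hD hn; rewrite vsc_rec_eq0 //; [lia|apply/orP; right; nia].
have neg n D : (0 < D)%N -> n < 0 -> vsc_rec R k t n D = 0.
  by move=> D0 n0; rewrite vsc_rec_eq0 // n0.
have Tpath : path_sum w (fun n D => emb (vsc_rec R k t.+1 n D)) (t%:Z - k%:Z + 1) T.
  by have -> : t%:Z - k%:Z + 1 = t.+1%:Z - k%:Z by lia.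
have homog m : (0 < m)%N -> Poly_d R m \is ishomog1 m.-1 (@mdeg m.+1).
  by case/(Poly_dP R).
have e := level_step homog (@Poly_d_family R) d0 w_neq0 neg hB
  (fun n D => vsc_recS R k t n (D:=D)) Tpath hTp.
transitivity (\sum_(0 <= n < B + d) w d ^+ n * T d n%:Z).
  apply/esym/(path_total_bound Tpath); rewrite /B -?addnA ?leq_addr // => n D hD hn.
  by rewrite hX ?rmorph0.
rewrite e (IH _ _ hTp hB) -big_split; apply: eq_bigr => f _.
by rewrite step_factorS.
Qed.
End Total.

Local Notation "x %:F" := (FracField.tofrac x).

(** * Operators and the Gauss-Manin system *)

Section Operators.
Variable F : fieldType.
Implicit Types (r s : {fraction {poly F}}) (G : pdo F).
Local Notation K := {fraction {poly F}}.

Lemma pdo_addE G H d : (G + H) d = G d + H d.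
Proof. by []. Qed.

Lemma pdo_oppE G d : (- G) d = - G d.
Proof. by []. Qed.

Lemma pdo_oneE d : (1 : pdo F) d = (d == 0%N)%:R.
Proof. by []. Qed.

Lemma pdo_ratM r G d : (pdo_rat r * G) d = frac_shift d%:R r * G d.
Proof.
rewrite /GRing.mul /= /pdo_mul big_ord_recl /= big1 ?addr0 ?subn0 // => i _.
by rewrite /pdo_rat /= rmorph0 mul0r.
Qed.

Lemma pdo_mulrat G r d : (G * pdo_rat r) d = G d * r.
Proof.
rewrite /GRing.mul /= /pdo_mul big_ord_recr /= big1 ?add0r => [|i _].
  by rewrite subnn frac_shift0.
by rewrite /pdo_rat subn_eq0 leqNgt ltn_ord /= mulr0.
Qed.

Lemma pdo_expM e G d : (pdo_exp F e * G) d = if (e <= d)%N then G (d - e)%N else 0.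
Proof.
rewrite /GRing.mul /= /pdo_mul; case: leqP => [ed|de].
  rewrite (bigD1 (Ordinal (ed : (e < d.+1)%N))) //= /pdo_exp eqxx rmorph1 mul1r.
  rewrite big1 ?addr0 // => i; rewrite -val_eqE /= => /negbTE ->.
  by rewrite rmorph0 mul0r.
rewrite big1 // => i _; rewrite /pdo_exp ltn_eqF ?rmorph0 ?mul0r //.
by apply: leq_trans de; rewrite ltnS -ltnS.
Qed.

Lemma pdo_mulexp G d : (G * pdo_exp F 1) d =
  if d is d'.+1 then frac_shift 1%:R (G d') else 0.
Proof.
rewrite /GRing.mul /= /pdo_mul; case: d => [|d].
  by rewrite big_ord1 /pdo_exp mulr0.
rewrite 2!big_ord_recr /= subSnn subnn /pdo_exp eqxx mulr1 mulr0 addr0.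
rewrite big1 ?add0r // => i _; have -> : (d.+1 - i == 1)%N = false by have := ltn_ord i; lia.
by rewrite mulr0.
Qed.

Lemma pdo_rat_is_zmod : zmod_morphism (@pdo_rat F).
Proof.
move=> r s; apply/funext => d; rewrite pdo_addE pdo_oppE /pdo_rat.
by case: eqP; rewrite ?subr0.
Qed.

Lemma pdo_rat_is_monoid : monoid_morphism (@pdo_rat F).
Proof.
split; first by apply/funext => d; rewrite pdo_oneE /pdo_rat; case: eqP.
move=> r s; apply/funext => d; rewrite pdo_mulrat /pdo_rat.
by case: eqP => // _; rewrite mul0r.
Qed.

HB.instance Definition _ :=
  GRing.isZmodMorphism.Build K (pdo F) (@pdo_rat F) pdo_rat_is_zmod.
HB.instance Definition _ :=
  GRing.isMonoidMorphism.Build K (pdo F) (@pdo_rat F) pdo_rat_is_monoid.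

Lemma frac_shift_tofrac (a : F) (p : {poly F}) :
  frac_shift a p%:F = (p \Po ('X + a%:P))%:F.
Proof.
rewrite -[p%:F]divr1 -tofrac1 frac_shiftE ?oner_eq0 //.
by rewrite rmorph1 tofrac1 divr1.
Qed.

(* The operator ∂_x + f. *)
Definition wX (f : nat) : K := 'X%:F + f%:R.

Lemma frac_shiftX (d : nat) : frac_shift d%:R 'X%:F = wX d :> K.
Proof.
by rewrite frac_shift_tofrac comp_polyX tofracD polyC_natr rmorph_nat.
Qed.

Lemma frac_shift_wX (d f : nat) : frac_shift d%:R (wX f) = wX (f + d).
Proof. by rewrite /wX rmorphD /= rmorph_nat frac_shiftX /wX -addrA -natrD addnC. Qed.

Lemma frac_shiftC (a c : F) : frac_shift a c%:P%:F = c%:P%:F.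
Proof. by rewrite frac_shift_tofrac comp_polyC. Qed.

Lemma wX_neq0 f : wX f != 0.
Proof.
rewrite /wX -(rmorph_nat (@FracField.tofrac _)) -tofracD tofrac_eq0.
by rewrite -polyC_natr -size_poly_eq0 size_XaddC.
Qed.

(** * Solutions of the Gauss-Manin system and their limit *)

Section System.
Variables (N k : nat) (L : int -> nat -> F).
Local Notation a := (fun n D => (L n D)%:P%:F : K).
Local Notation c := (k%:Z - N%:Z).

(** On the coefficient of e^{dx}, left multiplication by ∂_x acts as ∂_x + d, while the constants
    are unaffected by shifts. *)
Lemma gauss_maninE psi : gauss_manin N k L psi <-> forall alpha d,
  wX d * psi alpha d = psi (alpha + 1) d +
    \sum_(1 <= e < d.+1) a (N%:Z - 2 - alpha) e * psi (alpha + 1 + c * e%:Z) (d - e)%N.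
Proof.
have E alpha d : (pdo_D F * psi alpha) d = wX d * psi alpha d.
  by rewrite pdo_ratM frac_shiftX.
have E' alpha d : (psi (alpha + 1) + pdo_sum (fun d => pdo_exp F d *
      pdo_rat (L (N%:Z - 2 - alpha) d)%:P%:F * psi (alpha + 1 + c * d%:Z))) d =
    psi (alpha + 1) d +
    \sum_(1 <= e < d.+1) a (N%:Z - 2 - alpha) e * psi (alpha + 1 + c * e%:Z) (d - e)%N.
  rewrite pdo_addE; congr (_ + _); apply: eq_big_nat => e he.
  by rewrite -mulrA pdo_expM ifT ?pdo_ratM ?frac_shiftC //; lia.
split=> h alpha; first by move=> d; rewrite -E h E'.
by apply/funext => d; rewrite E h E'.
Qed.

(** By induction on d the sum is known, and the equation links alpha to alpha + 1; as ∂_x + d is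
    invertible, it can be followed from N - 1 in both directions. *)
Lemma gauss_manin_uniq psi psi' : gauss_manin N k L psi -> gauss_manin N k L psi' ->
  psi (N%:Z - 1) = psi' (N%:Z - 1) -> psi = psi'.
Proof.
move=> /gauss_maninE h /gauss_maninE h' e.
suff eq d : forall alpha, psi alpha d = psi' alpha d.
  by apply/funext => alpha; apply/funext => d; apply: eq.
elim/ltn_ind: d => d IH.
have step alpha : psi (alpha + 1) d = psi' (alpha + 1) d <-> psi alpha d = psi' alpha d.
  have := h alpha d; have := h' alpha d.
  have -> : \sum_(1 <= e < d.+1) a (N%:Z - 2 - alpha) e * psi (alpha + 1 + c * e%:Z) (d - e)%N =
    \sum_(1 <= e < d.+1) a (N%:Z - 2 - alpha) e * psi' (alpha + 1 + c * e%:Z) (d - e)%N.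
    by apply: eq_big_nat => i hi; rewrite IH //; lia.
  move=> e1 e2; split=> e3; last by move: e2; rewrite e3 e1 => /addIr.
  by apply: (mulfI (wX_neq0 d)); rewrite e1 e2 e3.
have up (m : nat) : psi (N%:Z - 1 + m%:Z) d = psi' (N%:Z - 1 + m%:Z) d.
  elim: m => [|m IHm]; first by rewrite addr0 e.
  by rewrite -addn1 PoszD addrA; apply/step.
have down (m : nat) : psi (N%:Z - 1 - m%:Z) d = psi' (N%:Z - 1 - m%:Z) d.
  elim: m => [|m IHm]; first by rewrite subr0 e.
  by apply/step; rewrite -[m.+1]addn1 PoszD opprD addrA subrK.
move=> alpha; have -> : alpha = N%:Z - 1 + (alpha - N%:Z + 1) by ring.
case: (alpha - N%:Z + 1) => m; first exact: up.
by rewrite NegzE; apply: down.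
Qed.

Hypothesis L_neg : forall n D, (0 < D)%N -> n < 0 -> L n D = 0.

(** Passing from r = n to r = n + 1 appends the term w^n T d n to the sum in [upper_path]: the
    equation of the system, once the powers of w are cleared. *)
Lemma gauss_manin_path T : path_sum wX a c T ->
  gauss_manin N k L (fun alpha d => upper_path wX T d (N%:Z - 1 - alpha)).
Proof.
move=> hT; apply/gauss_maninE => alpha d.
have -> : N%:Z - 1 - (alpha + 1) = N%:Z - 2 - alpha by ring.
have -> : N%:Z - 1 - alpha = N%:Z - 2 - alpha + 1 by ring.
have -> : \sum_(1 <= e < d.+1) a (N%:Z - 2 - alpha) e *
     upper_path wX T (d - e) (N%:Z - 1 - (alpha + 1 + c * e%:Z)) =
   \sum_(1 <= e < d.+1) a (N%:Z - 2 - alpha) e *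
     upper_path wX T (d - e) (N%:Z - 2 - alpha - c * e%:Z).
  by apply: eq_bigr => e _; congr (_ * upper_path _ _ _ _); ring.
move: (N%:Z - 2 - alpha) => n; rewrite /upper_path.
have [->|d0] := eqVneq d 0%N.
  rewrite big_geq // addr0 opprD expfzDr ?wX_neq0 // mulrCA.
  by rewrite [X in _ * X]divff ?wX_neq0 // mulr1.
have d1 : (0 < d)%N by lia.
rewrite -[\sum_(1 <= e < d.+1) _]hT //.
case: n => [n|n].
  have -> : n%:Z + 1 = n.+1%:Z by lia.
  rewrite /= big_nat_recr //= mulrA mulrDr.
  have e : wX d * wX d ^ (- n.+1%:Z) = wX d ^ (- n%:Z).
    rewrite -[X in X * _]expr1z -expfzDr ?wX_neq0 //; congr (_ ^ _); lia.
  rewrite e; congr (_ + _); rewrite mulrA -exprnN mulVf ?mul1r //.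
  by rewrite expf_neq0 ?wX_neq0.
rewrite (path_sum_eq0 hT) // => [|D /andP[D0 _]]; last by rewrite L_neg ?tofrac0.
rewrite addr0; have -> : nat_of_int (Negz n + 1) = 0%N by case: n => [|n].
by rewrite !big_geq ?mulr0.
Qed.
End System.

Lemma pdo_DX m G d : (pdo_D F ^+ m * G) d = wX d ^+ m * G d.
Proof. by rewrite /pdo_D -rmorphXn pdo_ratM rmorphXn /= frac_shiftX. Qed.

Section Limit.
Variables (N k : nat) (N0 : (0 < N)%N) (Nk : (N < k)%N).
Variable L : int -> nat -> F.
Local Notation a := (fun n D => (L n D)%:P%:F : K).
Local Notation c := (k%:Z - N%:Z).
Hypothesis L_supp : forall (n : int) (d : nat), (0 < d)%N ->
  ~~ (0 <= n <= N%:Z - 1 + c * d%:Z) -> L n d = 0.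

Definition path_total (T : nat -> int -> K) (d : nat) : K :=
  if d == 0%N then 1 else
  \sum_(0 <= n < N + (k - N) * d) wX d ^+ n * T d n%:Z.

Lemma L_supp_neg n D : (0 < D)%N -> n < 0 -> L n D = 0.
Proof. by move=> D0 n0; rewrite L_supp // negb_and -ltNge n0. Qed.

Lemma L_supp_big d n D : (0 < D <= d)%N -> (N + (k - N) * d)%N%:Z <= n -> L n D = 0.
Proof. by move=> hD hn; rewrite L_supp //; nia. Qed.

(** ∂_x^{N-1+j} cancels the power of ∂_x + d in front of [upper_path], and for such j the cut-off of
    the remaining sum has passed the support. *)
Lemma limit_path T d j : path_sum wX a c T -> (N + (k - N) * d <= j)%N ->
  (pdo_D F ^+ (N.-1 + j) * (fun d => upper_path wX T d (N%:Z - 1 - - j%:Z))) d =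
  path_total T d.
Proof.
move=> hT hj; rewrite pdo_DX.
have -> : N%:Z - 1 - - j%:Z = (N.-1 + j)%N%:Z by lia.
rewrite /upper_path /path_total; have [->|d0] := eqVneq d 0%N.
  by rewrite -exprnN divff // expf_neq0 ?wX_neq0.
rewrite mulrA -exprnN divff ?mul1r ?expf_neq0 ?wX_neq0 //=.
apply: (path_total_bound hT); [lia|lia|] => n D hD hn.
by rewrite (L_supp_big hD) ?tofrac0.
Qed.

Lemma limit_operator_path T : path_sum wX a c T ->
  limit_operator N k L (path_total T).
Proof.
move=> hT; split=> //; exists (fun alpha d => upper_path wX T d (N%:Z - 1 - alpha)); split.
- exact: (gauss_manin_path L_supp_neg).
- apply/funext => d; rewrite subrr pdo_oneE /upper_path.
  by case: eqP => //= _; rewrite big_geq // mulr0.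
- by move=> d; exists (N + (k - N) * d)%N => j hj; apply: limit_path.
Qed.

(** [limit_operator] only asserts that some solution has this limit; uniqueness identifies it with
    the one made of paths. *)
Lemma limit_operator_total T H : path_sum wX a c T -> limit_operator N k L H ->
  H = path_total T.
Proof.
move=> hT [_ [psi [hpsi psi1 lim]]].
have [_ [psi' [hpsi' psi'1 lim']]] := limit_operator_path hT.
have e : psi = psi' by apply: (gauss_manin_uniq hpsi hpsi'); rewrite psi1 psi'1.
apply/funext => d; have [J hJ] := lim d; have [J' hJ'] := lim' d.
by rewrite -(hJ _ (leq_addr J' J)) -(hJ' _ (leq_addl J J')) e.
Qed.
End Limit.
End Operators.

(** At 'X = -b every term but n = 0 vanishes; then 'X + b is divided out. *)
Lemma homogeneous_independent (F : fieldType) (b : F) (m : nat) (x : nat -> F) :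
  b != 0 -> \sum_(0 <= n < m.+1) x n *: (('X + b%:P) ^+ n * 'X^(m - n)) = 0 ->
  forall n, (n <= m)%N -> x n = 0.
Proof.
move=> b0; elim: m x => [|m IH] x e.
  move=> n; rewrite leqn0 => /eqP ->; apply/eqP; rewrite -polyC_eq0.
  by move: e; rewrite big_nat1 !expr0 mulr1 -mul_polyC mulr1 => ->.
rewrite big_nat_recl //= expr0 mul1r subn0 in e.
have e' : \sum_(0 <= n < m.+1) x n.+1 *: (('X + b%:P) ^+ n.+1 * 'X^(m.+1 - n.+1)) =
  ('X + b%:P) * \sum_(0 <= n < m.+1) x n.+1 *: (('X + b%:P) ^+ n * 'X^(m - n)).
  rewrite mulr_sumr; apply: eq_bigr => n _.
  by rewrite subSS exprS -scalerAr mulrA.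
rewrite e' in e.
have x0 : x 0%N = 0.
  have /eqP := congr1 (horner^~ (- b)) e.
  rewrite !hornerE /= addNr mul0r addr0 mulf_eq0 expf_eq0 oppr_eq0 (negbTE b0) /=.
  by rewrite orbF => /eqP.
move: e; rewrite x0 scale0r add0r => /eqP; rewrite mulf_eq0.
rewrite -size_poly_eq0 size_XaddC /= => /eqP /IH hx.
by case=> // n; apply: hx.
Qed.

(** * Recovery of the constants from the limit operator *)

Section Determined.
Variables (F : fieldType) (char0 : forall d, (0 < d)%N -> d%:R != 0 :> F).
Variables (N k : nat) (N0 : (0 < N)%N) (Nk : (N < k)%N).
Variables L M : int -> nat -> F.
Local Notation K := {fraction {poly F}}.
Local Notation c := (k%:Z - N%:Z).
Local Notation wX := (wX F).
Hypothesis L_supp : forall (n : int) (d : nat), (0 < d)%N ->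
  ~~ (0 <= n <= N%:Z - 1 + c * d%:Z) -> L n d = 0.
Hypothesis M_supp : forall (n : int) (d : nat), (0 < d)%N ->
  ~~ (0 <= n <= N%:Z - 1 + c * d%:Z) -> M n d = 0.
Variables T U : nat -> int -> K.
Hypothesis hT : path_sum wX (fun n D => (L n D)%:P%:F) c T.
Hypothesis hU : path_sum wX (fun n D => (M n D)%:P%:F) c U.
Hypothesis TU : forall d, path_total N k T d = path_total N k U d.

Lemma path_total_determines d : (0 < d)%N ->
  (forall n, L n d = M n d) /\ (forall n, T d n = U d n).
Proof.
elim/ltn_ind: d => d IH d0.
have LM e n : (0 < e < d)%N -> L n e = M n e.
  by move=> he; have [-> _] := IH e ltac:(lia) ltac:(lia).
have ext e r : (e < d)%N -> upper_path wX T e r = upper_path wX U e r.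
  move=> ed; rewrite /upper_path; case: eqP => // e0; congr (_ * _).
  by apply: eq_bigr => i _; have [_ ->] := IH e ed ltac:(lia).
have diff n : T d n - U d n = (L n d - M n d)%:P%:F * wX 0 ^ (c * d%:Z - n).
  have same : \sum_(1 <= e < d) (L n e)%:P%:F * upper_path wX T (d - e) (n - c * e%:Z) =
      \sum_(1 <= e < d) (M n e)%:P%:F * upper_path wX U (d - e) (n - c * e%:Z).
    by apply: eq_big_nat => e he; rewrite LM ?ext //; lia.
  rewrite hT // hU // !big_nat_recr //= same subnn /upper_path /= opprB.
  by rewrite polyCB tofracB; ring.
pose m := (N.-1 + (k - N) * d)%N.
have LMd : forall n, L n d = M n d.
  pose x n := L n%:Z d - M n%:Z d.
  suff x0 n : (n <= m)%N -> x n = 0.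
    case=> n; last by rewrite L_supp ?M_supp // NegzE; lia.
    have [nm|nm] := leqP n m; first by apply/eqP; rewrite -subr_eq0; apply/eqP/x0.
    by rewrite L_supp ?M_supp //; rewrite /m in nm; nia.
  move: n; apply: (homogeneous_independent (char0 d0)).
  apply/eqP; rewrite -tofrac_eq0 rmorph_sum /=.
  have := TU d; rewrite /path_total gtn_eqF // => /eqP; rewrite -subr_eq0 -sumrB.
  have -> : (N + (k - N) * d = m.+1)%N by rewrite /m -addSn prednK.
  (* The exponent (k - N) d - n can go down to -(N - 1); this factor turns it into m - n >= 0,
     leaving polynomials homogeneous in ∂_x + d and ∂_x. *)
  move=> /eqP /(congr1 (fun y => y * 'X%:F ^+ N.-1)).
  rewrite mul0r mulr_suml => e; apply/eqP/(etrans _ e); apply: eq_big_nat => n hn; rewrite -mulrBr diff.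
  rewrite -mul_polyC !tofracM !rmorphXn /= tofracD polyC_natr rmorph_nat.
  rewrite [in RHS]mulrCA -!mulrA; congr (_ * (_ * _)).
  have -> : wX 0 = 'X%:F by rewrite /wX addr0.
  have X0 : 'X%:F != 0 :> K by rewrite tofrac_eq0 polyX_eq0.
  rewrite [RHS](_ : _ = 'X%:F ^ (c * d%:Z - n%:Z) * 'X%:F ^ N.-1%:Z) // -expfzDr //.
  rewrite [LHS](_ : _ = 'X%:F ^ (m - n)%N%:Z) //; congr (_ ^ _); rewrite /m; nia.
split=> // n; apply/eqP; rewrite -subr_eq0 diff LMd subrr.
by rewrite tofrac0 mul0r.
Qed.
End Determined.

(** * The hypergeometric operator and its inverse *)

Section Hypergeometric.
Variables (F : fieldType) (N k : nat) (N0 : (0 < N)%N) (Nk : (N < k)%N).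
Local Notation K := {fraction {poly F}}.
Local Notation w := (wX F).
Local Notation factor := (@step_factor k K 'X%:F (2 * k - N)).

Lemma factorE f :
  factor f = k%:R * \prod_(1 <= j < k) (k%:R * w f + j%:R) * w f ^- N.-1.
Proof.
rewrite /step_factor -/(w f) -[_ ^- _]/(w f ^- N.-1) exprnN.
by congr (_ * _ ^ _); lia.
Qed.

Lemma frac_shift_factor (d f : nat) : frac_shift d%:R (factor f) = factor (f + d).
Proof.
rewrite !factorE !rmorphM fmorphV rmorphXn rmorph_prod /= rmorph_nat frac_shift_wX.
congr (_ * _ * _); apply: eq_bigr => j _.
by rewrite rmorphD rmorphM /= !rmorph_nat frac_shift_wX.
Qed.

(** Here m = k f + j; the factor with j = 0 is k (∂_x + f), which cancels one of the N inverse
    powers of ∂_x + f. *)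
Lemma prod_kX d : \prod_(0 <= m < k * d) (k%:R * w 0 + m%:R) =
  \prod_(0 <= f < d) (k%:R * w f * \prod_(1 <= j < k) (k%:R * w f + j%:R)).
Proof.
elim: d => [|d IH]; first by rewrite muln0 !big_geq.
rewrite [RHS]big_nat_recr //= -IH mulnS addnC.
rewrite (@big_cat_nat _ _ _ (k * d)) /= ?leq_addr //; congr (_ * _).
rewrite -{1}[(k * d)%N]add0n big_addn addKn big_ltn; last by lia.
have e j : (k%:R * w 0 + (j + k * d)%:R) = k%:R * w d + j%:R.
  by rewrite /wX natrD natrM; ring.
by rewrite e addr0; congr (_ * _); apply: eq_bigr => j _; rewrite e.
Qed.

Lemma hypergeometricE d : hypergeometric_operator F N k d = \prod_(0 <= f < d) factor f.
Proof.
rewrite /hypergeometric_operator pdo_addE pdo_oneE /pdo_sum.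
case: d => [|d]; first by rewrite !big_geq // addr0.
rewrite add0r big_nat_recr //= big_nat big1 ?add0r => [|e he]; last first.
  rewrite -mulrA pdo_expM ifT; last by lia.
  have -> : \prod_(0 <= m < k * e) (k%:R * pdo_D F + m%:R) =
    pdo_rat (\prod_(0 <= m < k * e) (k%:R * 'X%:F + m%:R)).
    by rewrite rmorph_prod; apply: eq_bigr => m _; rewrite rmorphD rmorphM /= !rmorph_nat.
  rewrite -rmorph_prod -rmorphM /= /pdo_rat; case: eqP => //; lia.
rewrite -mulrA pdo_expM leqnn subnn.
have -> : \prod_(0 <= m < k * d.+1) (k%:R * pdo_D F + m%:R) =
  pdo_rat (\prod_(0 <= m < k * d.+1) (k%:R * 'X%:F + m%:R)).
  by rewrite rmorph_prod; apply: eq_bigr => m _; rewrite rmorphD rmorphM /= !rmorph_nat.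
rewrite -rmorph_prod -rmorphM /= /pdo_rat eqxx.
have := prod_kX d.+1; rewrite [w 0]/wX addr0 => ->.
rewrite -big_split; apply: eq_bigr => f _ /=.
rewrite factorE tofracD rmorph_nat -/(wX F f) -[X in _ / _ ^+ X](prednK N0) exprS.
by rewrite -mulf_div -[k%:R * _ / _]mulrA divff ?wX_neq0 // mulr1 mulrA.
Qed.

Definition inverse_operator : pdo F := 1 - ode_term F k * pdo_Dinv F ^+ N.-1.

Lemma ode_termE : ode_term F k * pdo_Dinv F ^+ N.-1 = pdo_exp F 1 * pdo_rat (factor 0).
Proof.
have kE : k%:R * pdo_exp F 1 = pdo_exp F 1 * k%:R by rewrite (commr_nat _ _).
rewrite /ode_term kE -!mulrA; congr (_ * _).
have -> : \prod_(1 <= j < k) (k%:R * pdo_D F + j%:R) =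
    pdo_rat (\prod_(1 <= j < k) (k%:R * 'X%:F + j%:R)).
  by rewrite rmorph_prod; apply: eq_bigr => m _; rewrite rmorphD rmorphM /= !rmorph_nat.
rewrite /pdo_Dinv -rmorphXn -[k%:R](rmorph_nat (@pdo_rat F)) -!rmorphM /= factorE mulrA.
by rewrite [w 0]/wX addr0 exprVn.
Qed.

(** The series has the first-order recursion with ratio [factor d], and this is [factor 0] moved
    across e^{dx}. *)
Lemma inverse_mul_hypergeometric :
  inverse_operator * hypergeometric_operator F N k = 1.
Proof.
apply/funext => d; rewrite /inverse_operator ode_termE mulrBl mul1r pdo_addE pdo_oppE.
rewrite -mulrA pdo_expM pdo_oneE; case: d => [|d] /=.
  by rewrite hypergeometricE big_geq // subr0.
rewrite subn1 /= pdo_ratM frac_shift_factor !hypergeometricE add0n big_nat_recr //=.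
by rewrite mulrC subrr.
Qed.

(** Moving e^x to the left shifts the product over f by one, and [factor 0] completes it. *)
Lemma hypergeometric_mul_inverse :
  hypergeometric_operator F N k * inverse_operator = 1.
Proof.
apply/funext => d; rewrite /inverse_operator ode_termE mulrBr mulr1 pdo_addE pdo_oppE.
rewrite mulrA pdo_mulrat pdo_mulexp pdo_oneE; case: d => [|d] /=.
  by rewrite hypergeometricE big_geq // mul0r subr0.
rewrite !hypergeometricE rmorph_prod /= big_nat_recl //= mulrC.
apply/eqP; rewrite subr_eq0; apply/eqP; congr (_ * _).
by apply: eq_bigr => f _; rewrite frac_shift_factor addn1.
Qed.

Lemma inverse_operator_ode :
  inverse_operator * pdo_D F ^+ N.-1 = ode_operator F N k.
Proof.
rewrite /inverse_operator mulrBl mul1r -mulrA -[pdo_Dinv F ^+ _](rmorphXn (@pdo_rat F)).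
rewrite -[pdo_D F ^+ _ in X in _ - X](rmorphXn (@pdo_rat F)) -rmorphM /=.
rewrite exprVn mulVf ?expf_neq0 ?tofrac_eq0 ?polyX_eq0 // rmorph1 mulr1 //.
Qed.
End Hypergeometric.

Lemma vscE (R : realType) (k N : nat) : (N < k)%N ->
  vsc R k N%:Z = vsc_rec R k (2 * k - N).
Proof.
move=> Nk; apply/funext => n; apply/funext => d; rewrite /vsc ifF; last by lia.
by congr (vsc_rec R k _ n d); lia.
Qed.

Lemma vsc_supp (R : realType) (k N : nat) : (N < k)%N ->
  forall (n : int) (d : nat), (0 < d)%N ->
  ~~ (0 <= n <= N%:Z - 1 + (k%:Z - N%:Z) * d%:Z) -> vsc R k N%:Z n d = 0.
Proof.
move=> Nk n d d0; rewrite negb_and -!ltNge => h; rewrite vscE // vsc_rec_eq0 //.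
have -> : (2 * k)%:Z - (2 * k - N)%N%:Z = N%:Z by lia.
by have -> : (2 * k - N)%N%:Z - k%:Z = k%:Z - N%:Z by lia.
Qed.

(** The totals are taken over the rational functions, with 'X for ∂_x and the rationals embedded as
    constants, 2k - N steps below 2k. *)
Lemma path_total_vsc (R : realType) (k N : nat) (T : nat -> int -> {fraction {poly R[i]}}) :
  (0 < N)%N -> (N < k)%N ->
  path_sum (wX R[i]) (fun n D => (ratr (vsc R k N%:Z n D))%:P%:F) (k%:Z - N%:Z) T ->
  path_total N k T = hypergeometric_operator R[i] N k.
Proof.
move=> N0 Nk hT; apply/funext => d; rewrite hypergeometricE // /path_total.
case: eqP => [->|/eqP d0]; first by rewrite big_geq.
pose emb : {rmorphism rat -> {fraction {poly R[i]}}} :=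
  @FracField.tofrac {poly R[i]} \o (@polyC R[i] \o @ratr R[i]).
have c : (2 * k - N)%N%:Z - k%:Z = k%:Z - N%:Z by lia.
apply: (@total_vsc_rec R k _ _ emb 'X%:F (wX_neq0 R[i]) (2 * k - N)).
- by lia.
- by lia.
- by rewrite c -vscE.
- move=> n D hD hn; rewrite -vscE // vsc_supp //; [lia|nia].
Qed.

Theorem theorem7 (R : realType) (N k : nat) (hN : (0 < N)%N) (hNk : (N < k)%N) :
  let L : int -> nat -> R[i] := fun n d => ratr (vsc R k N%:Z n d) in
  let D : pdo R[i] := pdo_D R[i] in
  let Dinv : pdo R[i] := pdo_Dinv R[i] in
  (exists F : pdo R[i],
     [/\ limit_operator N k L F,
         exists Finv : pdo R[i],
           [/\ Finv * F = 1,
               F * Finv = 1,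
               Finv * D ^+ N.-1 = (1 - ode_term R[i] k * Dinv ^+ N.-1) * D ^+ N.-1 &
               (1 - ode_term R[i] k * Dinv ^+ N.-1) * D ^+ N.-1 = ode_operator R[i] N k] &
         F = hypergeometric_operator R[i] N k])
  /\
  (forall M : int -> nat -> R[i],
     limit_operator N k M (hypergeometric_operator R[i] N k) ->
     forall (d : nat) (n : int), (0 < d)%N ->
       0 <= n <= N%:Z - 1 + (k%:Z - N%:Z) * d%:Z -> M n d = L n d).
Proof.
move=> L D Dinv.
have L_supp (n : int) (d : nat) : (0 < d)%N ->
    ~~ (0 <= n <= N%:Z - 1 + (k%:Z - N%:Z) * d%:Z) -> L n d = 0.
  by move=> d0 h; rewrite /L vsc_supp ?rmorph0.
have [T hT] := path_sum_exists (wX R[i]) (fun n D => (L n D)%:P%:F) (k%:Z - N%:Z).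
have totalT := path_total_vsc hN hNk hT.
split.
  exists (hypergeometric_operator R[i] N k); split=> //.
    by rewrite -totalT; apply: limit_operator_path.
  exists (inverse_operator R[i] N k); split=> //.
  - exact: inverse_mul_hypergeometric.
  - exact: hypergeometric_mul_inverse.
  - exact: inverse_operator_ode.
move=> M hM d n d0 _; have M_supp := hM.1.
have [U hU] := path_sum_exists (wX R[i]) (fun n D => (M n D)%:P%:F) (k%:Z - N%:Z).
have totalU := limit_operator_total hN hNk M_supp hU hM.
have char0 m : (0 < m)%N -> m%:R != 0 :> R[i] by rewrite pnatr_eq0 lt0n.
have totalUT e : path_total N k U e = path_total N k T e by rewrite -totalU totalT.
by have [-> _] := path_total_determines char0 hN hNk M_supp L_supp hU hT totalUT d0.
Qed.
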